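(* Let $Q$ be a positive integer, let $\chi$ be a quadratic character $\bmod{Q}$ and $\eta=\pm1$. Assume that there exist a positive number $K$ and a non-negative locally integrable function $\delta(x)$ on $[2,+\infty)$ such that for every non-principal Dirichlet character $\chi'\bmod Q$ and all $x\ge2$, \[ \pi(x)\coloneqq\sum_{p\le x}1=\int_{2}^{x}\frac{du}{\log u}+O\left(K\frac{x}{\log x}\delta(x)\right),\qquad \pi(x,\chi')\coloneqq\sum_{p\le x}\chi'(p)\le K\frac{x}{\log x}\delta(x), \] and that $\delta$ satisfies: $\frac{1}{K}\le\frac{x}{\log x}\delta(x)\le K\frac{y}{\log y}\delta(y)$ for $2\le x\le y$; $\delta(y)\log y\le K\delta(x)\log x$ for $2\le x\le y$; and $\int_{2}^{\infty}\frac{\delta(u)}{u}du<+\infty$. Then, for $2\le r\le x/4$, \[ \frac{\#\{pq\le x: p<q\le rp,\ \chi(p)=\chi(q)=\eta\}}{\#\{pq\le x: p<q\le rp,\ (pq,Q)=1\}} =\frac{1}{4}\left(1+H_{\chi,\eta}(x;r)+O(\delta(\sqrt{x}))\right), \] where, writing $s\coloneqq x/r$, \begin{align} H_{\chi,\eta}(x;r)&=\frac{\eta}{\log\log xr-\log\log\frac{x}{r}}\left(\mathcal{L}_{\chi}(s)\left(1+O\left(\frac{1}{\log\log x}\right)\right)+O\left(\frac{\Delta(\sqrt{s})}{\log x}\right)\right),\\ \mathcal{L}_{\chi}(s)&\coloneqq\frac{1}{s}\sum_{p<\sqrt{s}}\chi(p)p+\sum_{p\ge\sqrt{s}}\frac{\chi(p)}{p},\qquad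 \Delta(x)\coloneqq\delta(x)+\int_{x}^{\infty}\frac{\delta(u)}{u}du, \end{align} and the implicit constants depend only on $Q$ and $K$.
   Context: Here $p,q$ denote primes. *)

(* Defs.v *)
From HB Require Import structures.
From mathcomp Require Import all_boot all_order all_algebra.
From mathcomp Require Import all_classical all_reals all_analysis.
From mathcomp Require Import complex.

Set Implicit Arguments.
Unset Strict Implicit.
Unset Printing Implicit Defensive.

Import Order.TTheory GRing.Theory Num.Theory.
Import numFieldNormedType.Exports.

Local Open Scope classical_set_scope.
Local Open Scope ring_scope.

(* Dirichlet character modulo Q with values in a ring T (defined on the
   non-negative integers, which is all that is used): completely
   multiplicative, Q-periodic, and non-zero exactly on integers coprime to Q. *)
Definition dirichlet_char (Q : nat) {T : pzRingType} (chi : nat -> T) : Prop :=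
  [/\ forall m n, chi (m * n)%N = chi m * chi n,
      forall n, chi (n + Q)%N = chi n &
      forall n, chi n != 0 <-> coprime n Q].

Definition principal_char (Q : nat) {T : pzRingType} (chi : nat -> T) : Prop :=
  forall n, chi n = (coprime n Q)%:R.

Definition quadratic_char (Q : nat) {R : realType} (chi : nat -> R) : Prop :=
  [/\ dirichlet_char Q chi, ~ principal_char Q chi &
      forall n, coprime n Q -> chi n ^+ 2 = 1].

Definition cmod {R : realType} (z : R[i]) : R :=
  Num.sqrt (complex.Re z ^+ 2 + complex.Im z ^+ 2).

Definition prime_pi {R : realType} (x : R) : R :=
  \sum_(p < (Num.truncn x).+1 | prime p && (p%:R <= x)) 1.

Definition prime_pi_chi {R : realType} (chi : nat -> R[i]) (x : R) : R[i] :=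
  \sum_(p < (Num.truncn x).+1 | prime p && (p%:R <= x)) chi p.

Definition count_pq {R : realType} (P : nat -> nat -> bool) (x r : R) : R :=
  \sum_(p < (Num.truncn x).+1) \sum_(q < (Num.truncn x).+1)
     ([&& prime p, prime q, ((p * q)%N%:R <= x), (p < q)%N,
          (q%:R <= r * p%:R) & P p q])%:R.

Definition tail_seq {R : realType} (chi : nat -> R) (t : R) : R^nat :=
  fun N => \sum_(p < N | prime p && (t <= p%:R)) chi p / p%:R.

Definition Lchi {R : realType} (chi : nat -> R) (s : R) : R :=
  s^-1 * (\sum_(p < (Num.truncn (Num.sqrt s)).+1 | prime p && (p%:R < Num.sqrt s))
            chi p * p%:R)
  + limn (tail_seq chi (Num.sqrt s)).

Definition Delta {R : realType} (delta : R -> R) (x : R) : R :=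
  delta x + \int[@lebesgue_measure R]_(u in `[x, +oo[) (delta u / u).

(* Main.v *)
Require Import Defs.
From HB Require Import structures.
From mathcomp Require Import all_boot all_order all_algebra.
From mathcomp Require Import all_classical all_reals all_analysis.
From mathcomp Require Import complex.
From mathcomp Require Import zify ring lra.

Import Order.TTheory GRing.Theory Num.Theory.
Import numFieldNormedType.Exports.

Set Implicit Arguments.
Unset Strict Implicit.
Unset Printing Implicit Defensive.

Local Open Scope classical_set_scope.
Local Open Scope ring_scope.

(** Detecting [chi p = chi q = eta] by [(1 + eta chi(p)) (1 + eta chi(q)) / 4]
    turns the quotient into [(1 + eta S1 / N + S2 / N) / 4], where [N] counts
    the pairs coprime to [Q], [S1] sums [chi(p) + chi(q)] and [S2] sums
    [chi(p) chi(q)] over them.  Put [a = sqrt s] and [b = sqrt x].  For fixed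
    [p <= b] the prime [q] runs over [(p, r p]] if [p <= a] and over
    [(p, x / p]] otherwise, so a sum over [q] of [chi(q)] is
    [O (delta b)] times the expected size: only the part
    [\sum chi(p) li(min (r p, x / p))] of [S1] matters, and Abel summation
    identifies it with [x / ln x * L_chi(s)].  The density of the primes
    [p in (a, b]] in the main term of [N] comes from the unconditional theorem of
    Mertens, whose error term is [O (1 / ln s)] and does not involve [delta];
    this is what makes the constants uniform.  When [delta b] is bounded below,
    Mertens' bound [|L_chi(s)| <= O (M + Delta (sqrt s) / ln x)] alone suffices,
    with [M = ln ln (x r) - ln ln (x / r)]. *)

(** * Chebyshev's upper bound and Mertens' first theorem *)

(** Write [X = ln x], [l = ln s], [M = loglog a b]. The obstacle is that the relative error of [N]
    has two sources: the hypothesis on [pi] contributes [O (delta b)], while Mertens' theorem, the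
    range [p <= a] and the asymptotics of li contribute [O (1 / (M * l))], which nothing compares
    with [delta b]. The second kind does not touch the leading 1 of the quotient, which is [N / N];
    it matters only as a factor of [L_chi(s)]. There either it is [O (1 / ln X)], or
    [1 / (M * l ^ 2) = O (1 / X)] and [L_chi(s) = O (Delta a / l)] absorbs it. A density of primes
    deduced from the hypothesis on [pi] would instead carry an integral of [delta u / u], which is
    finite but not bounded in terms of [K]. In the character sum a direct estimate gives an error
    [O (delta a / l)] on the scale of [L_chi(s)], the size of [L_chi(s)] itself, so a factor [l / X]
    must be gained. It comes from comparing li with a linear function whose slope [1 / ln x] is the
    same for every [p]. *)

Definition psum {R : realType} (c : nat -> R) (n : nat) : R := \sum_(0 <= k < n.+1) c k.

Lemma psumB {R : realType} (c : nat -> R) (m n : nat) : (m <= n)%N ->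
  psum c n - psum c m = \sum_(m.+1 <= k < n.+1) c k.
Proof.
move=> mn; rewrite /psum (@big_cat_nat _ _ _ m.+1 0 n.+1) //=; lra.
Qed.

Lemma psumS {R : realType} (c : nat -> R) (n : nat) : psum c n.+1 = psum c n + c n.+1.
Proof. by rewrite /psum big_nat_recr. Qed.

Lemma psum_le {R : realType} (c d : nat -> R) (n : nat) :
  (forall k, (k <= n)%N -> c k <= d k) -> psum c n <= psum d n.
Proof. by move=> h; apply: ler_sum_nat => k /andP[_ kn]; apply: h. Qed.

Lemma sum_nat_ge0 {R : realType} (c : nat -> R) m n :
  (forall k, (m <= k < n)%N -> 0 <= c k) -> 0 <= \sum_(m <= k < n) c k.
Proof. by move=> h; rewrite big_nat; apply: sumr_ge0 => k /h. Qed.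

(** The range bound [N] is left free: it may exceed [n], so that the expansion covers a prescribed
    interval of primes. *)
Lemma ln_logn {R : realType} (n N : nat) : (0 < n <= N)%N ->
  ln n%:R = psum (fun p => (logn p n)%:R * ln p%:R) N :> R.
Proof.
case/andP=> n0 nN; rewrite -{1}(partnT n0) (widen_partn _ nN) /psum.
have H (s : seq nat) : (0 < \prod_(i <- s) i ^ logn i n)%N /\
  ln (\prod_(i <- s) i ^ logn i n)%:R = \sum_(i <- s) (logn i n)%:R * ln i%:R :> R.
  elim: s => [|p s [IH1 IH2]]; first by rewrite !big_nil ln1.
  rewrite !big_cons; have pp : (0 < p ^ logn p n)%N.
    rewrite expn_gt0; case: p => [|p] //=.
  split; first by rewrite muln_gt0 pp.
  rewrite natrM lnM ?posrE ?ltr0n // IH2; congr (_ + _).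
  move: pp; rewrite expn_gt0 => /orP[p0|/eqP ->]; last by rewrite expn0 mul0r ln1.
  by rewrite natrX lnXn ?ltr0n // mulr_natl.
by rewrite /= (H _).2.
Qed.

Lemma ln2_ge {R : realType} : 2^-1 <= ln 2 :> R.
Proof.
have : ln (1 + (- 2^-1)) <= - 2^-1 :> R by apply: le_ln1Dx; lra.
have -> : 1 + - 2^-1 = 2^-1 :> R by lra.
rewrite lnV ?posrE; lra.
Qed.

Lemma ln2_le {R : realType} : ln 2 <= 1 :> R.
Proof.
have : ln (1 + 1) <= 1 :> R by apply: le_ln1Dx; lra.
by have -> : 1 + 1 = 2 :> R by lra.
Qed.

Lemma dvdn_fact_prime p n : prime p -> (p %| n`!)%N -> (p <= n)%N.
Proof.
move=> pp; elim: n => [|n IH]; first by rewrite fact0 dvdn1 => /eqP p1; rewrite p1 in pp.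
rewrite factS Euclid_dvdM // => /orP[/dvdn_leq -> //|/IH] /leq_trans; apply; exact: leqnSn.
Qed.

(** Every prime in [(m, 2m]] divides the central binomial coefficient, which is at most
    [2 ^ (2 * m)]. *)
Lemma theta_double {R : realType} (m : nat) :
  psum (fun p => (prime p)%:R * ln p%:R) (2 * m) - psum (fun p => (prime p)%:R * ln p%:R) m
  <= (2 * m)%:R * ln 2 :> R.
Proof.
rewrite psumB; last by rewrite mul2n -addnn leq_addr.
set C := 'C(2 * m, m)%N.
have C0 : (0 < C)%N by rewrite bin_gt0 mul2n -addnn leq_addr.
have Cle : (C <= 2 ^ (2 * m))%N.
  have := expnDn 1 1 (2 * m); rewrite addn1 => ->.
  under eq_bigr do rewrite !exp1n !muln1.
  have mm : (m < (2 * m).+1)%N by rewrite ltnS mul2n -addnn leq_addr.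
  by rewrite (bigD1 (Ordinal mm)) //= leq_addr.
apply: (@le_trans _ _ (ln C%:R)); last first.
  rewrite mulr_natl -lnXn ?ltr0n //.
  rewrite ler_ln ?posrE ?ltr0n ?exprn_gt0 ?ltr0n //.
  by rewrite -natrX ler_nat.
rewrite (@ln_logn _ C (maxn C (2 * m))); last by rewrite C0 leq_maxl.
have le1 : (m.+1 <= (2 * m).+1)%N by rewrite ltnS mul2n -addnn leq_addr.
have le2 : ((2 * m).+1 <= (maxn C (2 * m)).+1)%N by rewrite ltnS leq_maxr.
have lg0 (p : nat) : 0 <= ln p%:R :> R.
  by case: p => [|p]; [rewrite ln0 | apply: ln_ge0; rewrite ler1n].
rewrite /psum (@big_cat_nat _ _ _ m.+1 0) //=; last exact: leq_trans le2.
rewrite (@big_cat_nat _ _ _ (2 * m).+1 m.+1 (maxn C (2 * m)).+1) //=.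
rewrite addrCA -[leLHS]addr0; apply: lerD; last first.
  by apply: addr_ge0; apply: sum_nat_ge0 => k _; rewrite mulr_ge0.
apply: ler_sum_nat => p /andP[mp p2m].
apply: ler_wpM2r => //; rewrite ler_nat.
case pp : (prime p) => //=.
rewrite logn_gt0 mem_primes pp C0 /=.
have : (p %| (2 * m)`!)%N by apply: dvdn_fact; rewrite prime_gt0.
have := @bin_fact (2 * m) m; rewrite mul2n -addnn leq_addr => /(_ isT) <-.
rewrite addKn Euclid_dvdM // -[('C(_, _))]/('C(m + m, m)) => /orP[|].
  by rewrite /C mul2n -addnn.
by rewrite Euclid_dvdM // => /orP[] /(dvdn_fact_prime pp); rewrite leqNgt mp.
Qed.

(** Strong induction through the upper half [m] of [n]: doubling gives
    [(6 m + 2 m) ln 2 <= 4 (n + 1) ln 2], which is at most [6 n ln 2] as soon as [n >= 2]. *)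
Lemma theta_le {R : realType} (n : nat) :
  psum (fun p => (prime p)%:R * ln p%:R) n <= 6 * ln 2 * n%:R :> R.
Proof.
elim/ltn_ind: n => n IH; case: (leqP n 1) => n1.
  apply: (@le_trans _ _ 0); last by rewrite !mulr_ge0 // ln_ge0 //; lra.
  rewrite /psum big_nat; apply: sumr_le0 => -[|[|k]] /=; rewrite ?mul0r //.
  by case: n n1 {IH} => [|[]].
pose m := uphalf n.
have mlt : (m < n)%N by rewrite /m; lia.
have n2m : (n <= 2 * m)%N by rewrite /m; lia.
have m2 : (2 * m <= n.+1)%N by rewrite /m; lia.
have /= h1 := IH m mlt; have /= h2 := @theta_double R m.
have h3 : psum (fun p => (prime p)%:R * ln p%:R) n <= psum (fun p => (prime p)%:R * ln p%:R) (2 * m) :> R.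
  rewrite -subr_ge0 psumB //; apply: sum_nat_ge0 => k /andP[nk _].
  by rewrite mulr_ge0 // ln_ge0 // ler1n (leq_trans _ nk).
have l2 := @ln2_ge R.
have m2R : 2 * m%:R <= n%:R + 1 :> R by rewrite -natrM natr1 ler_nat.
have n2R : 2 <= n%:R :> R by rewrite ler_nat.
rewrite natrM in h2.
nra.
Qed.

Lemma ln_le_sqrt {R : realType} (y : R) : 0 < y -> ln y <= 2 * Num.sqrt y.
Proof.
move=> y0; have s0 : 0 < Num.sqrt y by rewrite sqrtr_gt0.
rewrite -{1}(sqr_sqrtr (ltW y0)) lnXn // -mulr_natl.
by have := ln_sublinear s0; lra.
Qed.

Lemma ln_sqrt {R : realType} (y : R) : 0 < y -> ln (Num.sqrt y) = ln y / 2.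
Proof.
move=> y0; have s0 : 0 < Num.sqrt y by rewrite sqrtr_gt0.
by rewrite -{2}(sqr_sqrtr (ltW y0)) lnXn // -mulr_natl; lra.
Qed.

Lemma ln_le_sub {R : realType} (u v : R) : 0 < u -> 0 < v -> ln v - ln u <= (v - u) / u.
Proof.
move=> u0 v0; rewrite -ln_div ?posrE //.
have -> : v / u = 1 + (v - u) / u by field; rewrite gt_eqF.
apply: le_ln1Dx; have : 0 < v / u by rewrite divr_gt0.
rewrite mulrBl divff ?gt_eqF //; lra.
Qed.

(** Primes up to [sqrt y] are counted trivially; beyond it [ln p >= ln y / 2] turns the bound on
    Chebyshev's theta into a count. The constant is [2 + 2 * 6]. *)
Lemma pi_le {R : realType} (y : R) : 2 <= y ->
  psum (fun p => (prime p)%:R) (Num.truncn y) <= 14 * (y / ln y).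
Proof.
move=> y2; have y0 : 0 < y by lra.
have ly : 0 < ln y by rewrite ln_gt0 //; lra.
set m := Num.truncn (Num.sqrt y); set n := Num.truncn y.
have sy : Num.sqrt y <= y.
  rewrite -{2}(sqr_sqrtr (ltW y0)) expr2 ler_peMl ?sqrtr_ge0 // -sqrtr1 ler_sqrt; lra.
have mn : (m <= n)%N by apply: le_truncn.
have ms : m%:R <= Num.sqrt y :> R by rewrite truncn_le sqrtr_ge0.
have ny : n%:R <= y :> R by rewrite truncn_le ltW.
have h1 : psum (fun p => (prime p)%:R) m <= m%:R :> R.
  elim: (m) => [|k IH]; first by rewrite /psum big_nat1.
  by rewrite psumS -natr1 (lerD IH) // lern1 leq_b1.
have h2 : psum (fun p => (prime p)%:R) n - psum (fun p => (prime p)%:R) m <=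
    2 / ln y * psum (fun p => (prime p)%:R * ln p%:R) n :> R.
  rewrite psumB //; apply: (@le_trans _ _ (2 / ln y * (\sum_(m.+1 <= k < n.+1) (prime k)%:R * ln k%:R))).
    rewrite mulr_sumr; apply: ler_sum_nat => k /andP[mk _].
    case: prime; rewrite ?mul0r ?mulr0 // !mul1r.
    have sk : Num.sqrt y < k%:R by rewrite -truncn_lt_nat ?sqrtr_ge0.
    have : ln (Num.sqrt y) <= ln k%:R.
      rewrite ler_ln ?posrE ?ltr0n //; [exact: ltW|by rewrite sqrtr_gt0|exact: leq_trans mk].
    rewrite ln_sqrt // mulrAC ler_pdivlMr // -[true%:R]/(1 : R); lra.
  rewrite ler_wpM2l //; first by rewrite divr_ge0 // ltW.
  rewrite -psumB // lerBlDr lerDl /psum; apply: sum_nat_ge0 => -[|k] _; first by rewrite ln0 // mulr0.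
  by rewrite mulr_ge0 // ln_ge0 // ler1n.
have h3 := @theta_le R n.
have h4 : ln 2 <= 1 :> R := ln2_le; have h5 : 2^-1 <= ln 2 :> R := ln2_ge.
have h6 : 2 / ln y * psum (fun p => (prime p)%:R * ln p%:R) n <= 2 / ln y * (6 * y).
  rewrite ler_wpM2l //; first by rewrite divr_ge0 // ltW.
  have n0 : 0 <= n%:R :> R by []. nra.
have h7 : Num.sqrt y <= 2 * (y / ln y).
  rewrite mulrA ler_pdivlMr //; have e := sqr_sqrtr (ltW y0).
  have := ler_wpM2l (sqrtr_ge0 y) (ln_le_sqrt y0); rewrite expr2 in e; lra.
have -> : 14 * (y / ln y) = 2 * (y / ln y) + 2 / ln y * (6 * y) by field; rewrite gt_eqF.
lra.
Qed.

Lemma ln_fact_le {R : realType} (n : nat) : ln (n`!)%:R <= n%:R * ln n%:R :> R.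
Proof.
case: n => [|n]; first by rewrite fact0 ln1 mul0r.
elim: n => [|n IH]; first by rewrite /= ln1 mulr0.
rewrite factS natrM lnM ?posrE ?ltr0n ?fact_gt0 // -[n.+2%:R in X in _ <= X * _]natr1.
rewrite mulrDl mul1r addrC lerD2r (le_trans IH) // ler_wpM2l //.
by rewrite ler_ln ?posrE ?ltr0n // ler_nat.
Qed.

Lemma ln_fact_ge {R : realType} (n : nat) : n%:R * ln n%:R - n%:R <= ln (n`!)%:R :> R.
Proof.
case: n => [|n]; first by rewrite fact0 ln1 mul0r; lra.
elim: n => [|n IH]; first by rewrite /= ln1 mulr0; lra.
rewrite factS natrM lnM ?posrE ?ltr0n ?fact_gt0 // .
have n0 : 0 < n.+1%:R :> R by rewrite ltr0n.
have n1 : 0 < n.+2%:R :> R by rewrite ltr0n.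
have := ln_le_sub n0 n1; rewrite -[n.+2%:R]natr1 ler_pdivlMr //; nra.
Qed.

Lemma logn_fact_ub p n : prime p -> ((p - 1) * logn p n`! <= n)%N.
Proof.
move=> pp; rewrite logn_fact // big_add1 /=.
(* Legendre's sum telescopes once the current quotient [n %/ p ^ m] is kept as a remainder: [p]
   times the next quotient is at most the current one. *)
have H m : ((p - 1) * (\sum_(0 <= k < m) n %/ p ^ k.+1) + n %/ p ^ m <= n)%N.
  elim: m => [|k IH]; first by rewrite big_nil muln0 expn0 divn1.
  rewrite big_nat_recr //= mulnDr -addnA (leq_trans _ IH) // leq_add2l.
  rewrite expnSr divnMA; have := leq_trunc_div (n %/ p ^ k) p.
  have := prime_gt0 pp; 
  move: (n %/ p ^ k %/ p)%N (n %/ p ^ k)%N => v u; nia.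
by apply: leq_trans (H n); rewrite leq_addr.
Qed.

Lemma logn_fact_lb p n : prime p -> (p <= n)%N -> (n %/ p <= logn p n`!)%N.
Proof.
move=> pp pn; rewrite logn_fact // big_ltn ?expn1 ?leq_addr //.
by rewrite ltnS (leq_trans _ pn) // prime_gt0.
Qed.

Lemma ln_fact_logn {R : realType} (n : nat) :
  ln (n`!)%:R = psum (fun p => (logn p n`!)%:R * ln p%:R) n :> R.
Proof.
have nf : (n <= n`!)%N by case: n => // n; apply: dvdn_leq; rewrite ?fact_gt0 // dvdn_fact //= leqnn.
rewrite (@ln_logn R n`! n`!) ?fact_gt0 ?leqnn //.
apply/eqP; rewrite -subr_eq0 psumB //; apply/eqP.
rewrite big_nat big1 // => p /andP[np _].
rewrite lognE; case: ifP; rewrite ?mul0r // => /and3P[pp _].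
by move/(dvdn_fact_prime pp); rewrite leqNgt np.
Qed.

(** [ln n / (n (n - 1))] is dominated by the decrement of [(ln n + 2) / n]. *)
Lemma sum_ln_over {R : realType} (n : nat) :
  psum (fun k => (prime k)%:R * (ln k%:R / (k%:R * (k%:R - 1)))) n <= 2 :> R.
Proof.
case: n => [|n]; first by rewrite /psum big_nat1 mul0r.
apply: (@le_trans _ _ (2 - (ln n.+1%:R + 2) / n.+1%:R)); last first.
  by rewrite lerBlDr lerDl divr_ge0 // addr_ge0 // ln_ge0 // ler1n.
elim: n => [|n IH].
  by rewrite /psum !big_nat_recr //= big_nil ln1; lra.
rewrite psumS; apply: (le_trans (lerD IH (lexx _))).
have n0 : 0 < n.+1%:R :> R by rewrite ltr0n.
have n1 : 0 < n.+2%:R :> R by rewrite ltr0n.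
have l1 : 0 <= ln n.+1%:R :> R by rewrite ln_ge0 // ler1n.
have l2 : 0 <= ln n.+2%:R :> R by rewrite ln_ge0 // ler1n.
have h := ln_le_sub n0 n1.
have e : n.+2%:R = n.+1%:R + 1 :> R by rewrite -natr1.
have n11 : 1 <= n.+1%:R :> R by rewrite ler1n.
move: (n.+1%:R) (n.+2%:R) (ln n.+1%:R) (ln n.+2%:R) e n0 n1 l1 l2 n11 h => u v lu lv -> u0 v0 lu0 lv0 u1 h.
apply: (@le_trans _ _ (2 - (lu + 2) / u + lv / ((u + 1) * u))).
  by rewrite lerD2l addrK; case: prime; rewrite ?mul1r ?mul0r // divr_ge0 // mulr_ge0 // ltW.
rewrite ler_pdivlMr // in h.
rewrite -subr_ge0.
have -> : 2 - (lv + 2) / (u + 1) - (2 - (lu + 2) / u + lv / ((u + 1) * u)) =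
   (u + u * lu + lu + 2 - u * lv - u - lv) / ((u + 1) * u).
  field; rewrite !gt_eqF //.
by apply: divr_ge0; [nra | rewrite mulr_ge0 // ltW].
Qed.

(** Legendre's formula for [ln n!]: the exponent of [p] lies between [n / p - 1] and [n / (p - 1)].
    The [- 1] costs Chebyshev's theta, at most [6 n]; the excess [n / (p (p - 1))], weighted by
    [ln p], costs at most [2 n], and Stirling's lower bound another [n]. *)
Lemma mertens {R : realType} (n : nat) : (0 < n)%N ->
  `|psum (fun p => (prime p)%:R * (ln p%:R / p%:R)) n - ln n%:R| <= 6 :> R.
Proof.
move=> n0; set A := psum _ _.
have nR : 0 < n%:R :> R by rewrite ltr0n.
have lg0 (p : nat) : 0 <= ln p%:R :> R.
  by case: p => [|p]; [rewrite ln0 | apply: ln_ge0; rewrite ler1n].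
have up : n%:R * A <= n%:R * ln n%:R + 6 * n%:R.
  have -> : n%:R * A = n%:R * A - psum (fun p => (prime p)%:R * ln p%:R) n + psum (fun p => (prime p)%:R * ln p%:R) n by lra.
  apply: lerD; last first.
    have := @theta_le R n; have : ln 2 <= 1 :> R := ln2_le; nra.
  apply: le_trans (ln_fact_le n); rewrite ln_fact_logn.
  rewrite /A /psum mulr_sumr -sumrB; apply: ler_sum_nat => p /andP[_ pn].
  case pp : (prime p); last by rewrite !mul0r mulr0 subr0 mulr_ge0.
  have p0 : 0 < p%:R :> R by rewrite ltr0n prime_gt0.
  have -> : n%:R * (true%:R * (ln p%:R / p%:R)) - true%:R * ln p%:R = (n%:R / p%:R - 1) * ln p%:R :> R.
    by rewrite /=; field; rewrite gt_eqF.
  rewrite ler_wpM2r // (@le_trans _ _ (n %/ p)%:R) //; last by rewrite ler_nat logn_fact_lb.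
  rewrite lerBlDr natr1 ler_pdivrMr // -natrM ler_nat ltnW //.
  by rewrite ltn_ceil // prime_gt0.
have lo : n%:R * ln n%:R - n%:R <= n%:R * (A + 2).
  apply: (le_trans (ln_fact_ge n)); rewrite ln_fact_logn.
  apply: (@le_trans _ _ (n%:R * (A + psum (fun k => (prime k)%:R * (ln k%:R / (k%:R * (k%:R - 1)))) n))); last first.
    by rewrite ler_wpM2l // lerD2l sum_ln_over.
  rewrite /A /psum -big_split /= mulr_sumr; apply: ler_sum_nat => p /andP[_ pn].
  case pp : (prime p); last by rewrite lognE pp /= !mul0r add0r mulr0.
  have p1 : (1 < p)%N by apply: prime_gt1.
  have p1R : 1 < p%:R :> R by rewrite ltr1n.
  have -> : 1%:R * (ln p%:R / p%:R) + 1%:R * (ln p%:R / (p%:R * (p%:R - 1))) = ln p%:R / (p%:R - 1) :> R.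
    by field; rewrite gt_eqF ?subr_gt0 //= gt_eqF //; lra.
  rewrite mulrCA mulrC ler_wpM2l // ler_pdivlMr ?subr_gt0 //.
  have := logn_fact_ub n pp; rewrite -(ler_nat R) natrM natrB ?(ltnW p1) //; lra.
rewrite ler_norml; apply/andP; split; rewrite -(ler_pM2l nR); nra.
Qed.

(** * Abel summation and the weighted Mertens sum *)

Lemma abel_sum {R : realType} (S f : nat -> R) (m N : nat) : (m < N)%N ->
  \sum_(m.+1 <= n < N.+1) (S n - S n.-1) * f n =
  S N * f N - S m * f m.+1 + \sum_(m.+1 <= n < N) S n * (f n - f n.+1).
Proof.
elim: N => // N IH; rewrite ltnS leq_eqVlt => /orP[/eqP <-|mN].
  by rewrite big_nat1 big_geq //= addr0 mulrBl.
rewrite big_nat_recr ?ltnS 1?ltnW //= (IH mN) [in RHS]big_nat_recr //=; ring.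
Qed.

Lemma abel_bound {R : realType} (S f g : nat -> R) (m N : nat) : (m < N)%N ->
  (forall n, (m <= n <= N)%N -> `|S n| <= g n) ->
  `|\sum_(m.+1 <= n < N.+1) (S n - S n.-1) * f n|
   <= g N * `|f N| + g m * `|f m.+1| + \sum_(m.+1 <= n < N) g n * `|f n - f n.+1|.
Proof.
move=> mN h; rewrite abel_sum //.
apply: (le_trans (ler_normD _ _)); apply: lerD.
  apply: (le_trans (ler_normB _ _)); rewrite !normrM.
  by apply: lerD; apply: ler_wpM2r => //; apply: h; rewrite ?leqnn ltnW.
apply: (le_trans (ler_norm_sum _ _ _)); apply: ler_sum_nat => n /andP[mn nN].
rewrite normrM ler_wpM2r // h //; apply/andP; split; exact: ltnW.
Qed.

(** Monotonicity lets the variation of [f] telescope to at most [2 * F], which adds to the two end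
    terms. The bounds on [f] are asked only for [m < N], the sum being empty otherwise. *)
Lemma abel_inc {R : realType} (S f : nat -> R) (m N : nat) (B F : R) :
  0 <= F -> (m <= N)%N ->
  (forall n, (m <= n <= N)%N -> `|S n| <= B) ->
  (forall n, (m < n < N)%N -> f n <= f n.+1) ->
  ((m < N)%N -> `|f m.+1| <= F /\ `|f N| <= F) ->
  `|\sum_(m.+1 <= n < N.+1) (S n - S n.-1) * f n| <= 4 * B * F.
Proof.
move=> F0; rewrite leq_eqVlt => /orP[/eqP <-|mN] hS hf hF.
  rewrite big_geq // normr0; have : 0 <= B by apply: le_trans (hS m _); rewrite ?leqnn.
  by move=> B0; apply: mulr_ge0 => //; apply: mulr_ge0.
have B0 : 0 <= B by apply: le_trans (hS m _); rewrite ?leqnn 1?ltnW.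
have [hm hN] := hF mN.
apply: (le_trans (@abel_bound R S f (fun=> B) m N mN hS)).
have -> : \sum_(m.+1 <= n < N) B * `|f n - f n.+1| = B * (f N - f m.+1).
  rewrite -mulr_sumr; congr (_ * _); rewrite -telescope_sumr //.
  by apply: eq_big_nat => n /andP[mn nN]; rewrite distrC ger0_norm // subr_ge0 hf // mn.
have : f N - f m.+1 <= F + F.
  by apply: lerD; [apply: le_trans hN; apply: ler_norm | apply: le_trans hm; rewrite ler_normr lexx orbT].
move: (`|f N|) (`|f m.+1|) hm hN (f N - f m.+1) => u v ? ? w ?; nra.
Qed.

Lemma abel_dec {R : realType} (S f : nat -> R) (m N : nat) (B F : R) :
  0 <= F -> (m <= N)%N ->
  (forall n, (m <= n <= N)%N -> `|S n| <= B) ->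
  (forall n, (m < n < N)%N -> f n.+1 <= f n) ->
  ((m < N)%N -> `|f m.+1| <= F /\ `|f N| <= F) ->
  `|\sum_(m.+1 <= n < N.+1) (S n - S n.-1) * f n| <= 4 * B * F.
Proof.
move=> F0 mN hS hf hF; rewrite -normrN -sumrN.
under eq_bigr do rewrite -mulrN.
apply: (@abel_inc R S (fun n => - f n)) => //.
  by move=> n /hf; rewrite lerN2.
by rewrite !normrN.
Qed.

Lemma ln_trunc {R : realType} (a : R) : 2 <= a ->
  [/\ (2 <= Num.truncn a)%N, ln a / 2 <= ln (Num.truncn a)%:R,
     ln (Num.truncn a)%:R <= ln a & ln a - ln (Num.truncn a)%:R <= 1].
Proof.
move=> a2; have a0 : 0 <= a by lra.
have /andP[h1 h2] := truncn_itv a0.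
have A2 : (2 <= Num.truncn a)%N by rewrite truncn_ge_nat.
move: h1 h2; set A := Num.truncn a => h1 h2; rewrite -natr1 in h2.
have A2R : 2 <= A%:R :> R by rewrite ler_nat.
have A0 : 0 < A%:R :> R by lra.
have aa : 0 < a by lra.
split => //.
(* As [A >= 2], [a < A + 1 <= A ^ 2]. *)
- have : ln a <= ln (A%:R ^+ 2) by rewrite ler_ln ?posrE ?exprn_gt0 //; nra.
  by rewrite lnXn // -mulr_natl; lra.
- by rewrite ler_ln ?posrE.
- apply: (le_trans (ln_le_sub A0 aa)); rewrite ler_pdivrMr //; lra.
Qed.

(** [v^-1 + (X - v)^-1] is the derivative of [ln v - ln (X - v)]. *)
Lemma psi_step {R : realType} (X v w : R) : 0 < w -> w <= v -> v <= X / 2 -> v - w <= 1 ->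
  `|(ln v - ln (X - v)) - (ln w - ln (X - w)) - (v^-1 + (X - v)^-1) * (v - w)|
   <= (w^-1 - v^-1) + ((X - v)^-1 - (X - w)^-1).
Proof.
move=> w0 wv vX d1; have v0 : 0 < v by lra.
have xv0 : 0 < X - v by lra. have xw0 : 0 < X - w by lra.
have h1 := ln_le_sub w0 v0; have h2 := ln_le_sub v0 w0.
have h3 := ln_le_sub xv0 xw0; have h4 := ln_le_sub xw0 xv0.
have i1 : v^-1 <= w^-1 by rewrite lef_pV2.
have i2 : (X - w)^-1 <= (X - v)^-1 by rewrite lef_pV2 ?posrE //; lra.
move: h1 h2 h3 h4 i1 i2; move: (ln _) (ln _) (ln _) (ln _) => lv lxv lw lxw.
move: (v^-1) (w^-1) ((X - v)^-1) ((X - w)^-1) => iv iw ixv ixw h1 h2 h3 h4 i1 i2.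
rewrite ler_norml; apply/andP; split; nra.
Qed.

Lemma psi_diff {R : realType} (X v w : R) : 0 < w -> w <= v -> v <= X / 2 -> v - w <= 1 ->
  `|(ln v - ln (X - v)) - (ln w - ln (X - w))| <= w^-1 + (X - v)^-1.
Proof.
move=> w0 wv vX d1; have v0 : 0 < v by lra.
have xv0 : 0 < X - v by lra. have xw0 : 0 < X - w by lra.
have h1 := ln_le_sub w0 v0; have h3 := ln_le_sub xv0 xw0.
have m1 : ln w <= ln v by rewrite ler_ln ?posrE.
have m2 : ln (X - v) <= ln (X - w) by rewrite ler_ln ?posrE //; lra.
have i1 : 0 < w^-1 by rewrite invr_gt0.
have i2 : 0 < (X - v)^-1 by rewrite invr_gt0.
rewrite ger0_norm; last lra.
move: (w^-1) ((X - v)^-1) i1 i2 h1 h3 => iw ixv; nra.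
Qed.

(** Partial summation against Mertens' theorem: the weight is [ln p / p] times [1 / (v (X - v))] at
    [v = ln p], with primitive [(ln v - ln (X - v)) / X]. It vanishes at [v = ln b = X / 2], and at
    [v = ln a = l / 2] it produces the difference of iterated logarithms. The constant is [16 + 18]:
    16 from Abel summation, 18 from three errors of at most [6 / l], namely the discretisation and
    the rounding of the two ends. *)
Lemma mertens_weighted {R : realType} (K : R) (P : pred nat) (a b : R) : 1 <= K -> 2 <= a -> a <= b ->
  (forall n, (0 < n)%N -> `|psum (fun p => (P p)%:R * (ln p%:R / p%:R)) n - ln n%:R| <= K) ->
  let l := 2 * ln a in let X := 2 * ln b in
  `|\sum_((Num.truncn a).+1 <= p < (Num.truncn b).+1) (P p)%:R * (p%:R^-1 / (X - ln p%:R))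
    - (ln (2 * X - l) - ln l) / X| <= 34 * K / (X * l).
Proof.
move=> K1 a2 ab hM; set l := 2 * ln a; set X := 2 * ln b; cbv zeta.
have b2 : 2 <= b by lra.
have [A2 A3 A4 A5] := ln_trunc a2; have [B2 B3 B4 B5] := ln_trunc b2.
have AB : (Num.truncn a <= Num.truncn b)%N by apply: le_truncn.
set A := Num.truncn a in A2 A3 A4 A5 AB *; set B := Num.truncn b in B2 B3 B4 B5 AB *.
have l0 : 0 < l by rewrite mulr_gt0 // ln_gt0; lra.
have la : ln a <= ln b by rewrite ler_ln ?posrE; lra.
have X0 : 0 < X by rewrite /X /l in l0 *; lra.
have lX : l <= X by rewrite /l /X; lra.
have bet (n : nat) : (A <= n <= B)%N -> [/\ (2 <= n)%N, l / 4 <= ln n%:R & ln n%:R <= X / 2].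
  case/andP=> An nB; have n2 : (2 <= n)%N by apply: leq_trans An.
  split=> //.
    apply: (@le_trans _ _ (ln A%:R)); first by rewrite /l; lra.
    by rewrite ler_ln ?posrE ?ltr0n ?ler_nat // ltnW.
  apply: (@le_trans _ _ (ln B%:R)); last by rewrite /X; lra.
  by rewrite ler_ln ?posrE ?ltr0n ?ler_nat // ltnW.
(* Only [n > A] gives [n > a], hence the full [l / 2]; at [n = A] rounding leaves [l / 4]. *)
have bet2 (n : nat) : (A < n)%N -> l / 2 <= ln n%:R.
  move=> An; have : a <= n%:R by rewrite ltW // -truncn_lt_nat //; lra.
  move=> an; have : ln a <= ln n%:R by rewrite ler_ln ?posrE //; lra.
  rewrite /l; lra.
pose f (n : nat) : R := (ln n%:R * (X - ln n%:R))^-1.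
pose S (n : nat) : R := psum (fun p => (P p)%:R * (ln p%:R / p%:R)) n - ln n%:R.
have part1 : `|\sum_(A.+1 <= n < B.+1) (S n - S n.-1) * f n| <= 4 * K * (4 / (l * X)).
  apply: abel_dec => //.
  - by rewrite divr_ge0 // mulr_ge0 // ltW.
  - move=> n /andP[An _]; apply: hM; apply: leq_trans An; exact: ltnW.
  (* For [v <= X / 2] the product [v (X - v)] increases, so [f] decreases. *)
  - move=> n /andP[An nB].
    have [n2 h1 h2] : [/\ (2 <= n)%N, l / 4 <= ln n%:R & ln n%:R <= X / 2] by apply: bet; rewrite (ltnW An) (ltnW nB).
    have [n2' h1' h2'] : [/\ (2 <= n.+1)%N, l / 4 <= ln n.+1%:R & ln n.+1%:R <= X / 2].
      by apply: bet; rewrite nB ltnW // ltnW.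
    have h3 : ln n%:R <= ln n.+1%:R :> R by rewrite ler_ln ?posrE ?ltr0n ?ler_nat // ltnW.
    clear -h1 h2 h1' h2' h3 l0.
    rewrite /f lef_pV2 ?posrE; [nra|apply: mulr_gt0; lra|apply: mulr_gt0; lra].
  - have F (n : nat) : (A < n <= B)%N -> `|f n| <= 4 / (l * X).
      move=> /andP[An nB].
      have [n2 h1 h2] : [/\ (2 <= n)%N, l / 4 <= ln n%:R & ln n%:R <= X / 2] by apply: bet; rewrite nB ltnW.
      have h3 := bet2 _ An.
      have p0 : 0 < ln n%:R * (X - ln n%:R) by clear -h1 h2 l0 X0; apply: mulr_gt0; lra.
      have p1 : 0 < l * X / 4 by rewrite divr_gt0 // mulr_gt0.
      have -> : 4 / (l * X) = (l * X / 4)^-1 by rewrite invf_div.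
      have -> : `|f n| = (ln n%:R * (X - ln n%:R))^-1 by rewrite ger0_norm // /f invr_ge0 ltW.
      rewrite lef_pV2 ?posrE //; clear -h2 h3 l0 X0; nra.
    by move=> AltB; split; apply: F; rewrite ?leqnn ?AltB.
pose Psi (v : R) := ln v - ln (X - v).
pose w (n : nat) : R := ln n%:R.
have part2 : `|Psi (w B) - Psi (w A) - X * \sum_(A.+1 <= n < B.+1) (w n - w n.-1) * f n| <= 4 / l + 2 / X.
  have -> : Psi (w B) - Psi (w A) = \sum_(A.+1 <= n < B.+1) (Psi (w n) - Psi (w n.-1)).
    by rewrite big_add1 /= telescope_sumr.
  rewrite mulr_sumr -sumrB; apply: (le_trans (ler_norm_sum _ _ _)).
  (* The error of [psi_step] at each [n] is an increment of [(X - w)^-1 - w^-1], so the errors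
     telescope. *)
  apply: (@le_trans _ _ (\sum_(A.+1 <= n < B.+1) ((X - w n)^-1 - (w n)^-1 - ((X - w n.-1)^-1 - (w n.-1)^-1)))).
    apply: ler_sum_nat => n /andP[An nB].
    have [n2 h1 h2] : [/\ (2 <= n)%N, l / 4 <= ln n%:R & ln n%:R <= X / 2] by apply: bet; rewrite -(ltnS n) nB ltnW.
    have [n2' h1' h2'] : [/\ (2 <= n.-1)%N, l / 4 <= ln n.-1%:R & ln n.-1%:R <= X / 2] by apply: bet; clear -An nB; lia.
    have n0 : 0 < n.-1%:R :> R by rewrite ltr0n; clear -n2 n2'; lia.
    have n0' : 0 < n%:R :> R by rewrite ltr0n; clear -n2 n2'; lia.
    have en : n%:R = n.-1%:R + 1 :> R by rewrite natr1 prednK //; clear -n2; lia.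
    have h3 : ln n.-1%:R <= ln n%:R :> R by rewrite ler_ln ?posrE // en lerDl.
    have h4 : ln n%:R - ln n.-1%:R <= 1 :> R.
      apply: (le_trans (ln_le_sub n0 n0')); rewrite ler_pdivrMr // en mul1r.
      have : 2 <= n.-1%:R :> R by rewrite ler_nat.
      clear; lra.
    have p1 : 0 < ln n.-1%:R :> R by clear -h1' l0; lra.
    have := psi_step p1 h3 h2 h4; rewrite /Psi /w /f.
    have -> : X * ((ln n%:R - ln n.-1%:R) * (ln n%:R * (X - ln n%:R))^-1) =
       ((ln n%:R)^-1 + (X - ln n%:R)^-1) * (ln n%:R - ln n.-1%:R) :> R.
      by field; clear -p1 h3 h2; rewrite !gt_eqF //; lra.
    clear; lra.
  rewrite big_add1 /= (telescope_sumr (fun n => (X - w n)^-1 - (w n)^-1)) //.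
  have [_ a1 a2'] : [/\ (2 <= A)%N, l / 4 <= ln A%:R & ln A%:R <= X / 2] by apply: bet; rewrite leqnn.
  have [_ b1 b2'] : [/\ (2 <= B)%N, l / 4 <= ln B%:R & ln B%:R <= X / 2] by apply: bet; rewrite leqnn andbT.
  have q1 : (w A)^-1 <= 4 / l by clear -a1 l0; rewrite -[4 / l]invf_div lef_pV2 ?posrE /w ?divr_gt0 //; lra.
  have q2 : (X - w B)^-1 <= 2 / X by clear -b2' X0; rewrite -[2 / X]invf_div lef_pV2 ?posrE /w ?divr_gt0 //; lra.
  have q3 : 0 <= (w B)^-1 by clear -b1 l0; rewrite invr_ge0 /w; lra.
  have q4 : 0 <= (X - w A)^-1 by clear -a2' X0; rewrite invr_ge0 /w; lra.
  clear -q1 q2 q3 q4; lra.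
have ends (y : R) : 2 <= y -> ln y <= X / 2 -> l / 4 <= ln (Num.truncn y)%:R ->
    `|Psi (ln y) - Psi (w (Num.truncn y))| <= 4 / l + 2 / X.
  move=> y2 h1 h2; have [c1 c2 c3 c4] := ln_trunc y2.
  have p1 : 0 < ln (Num.truncn y)%:R :> R by clear -h2 l0; lra.
  apply: (le_trans (psi_diff p1 c3 h1 c4)); apply: lerD.
    by rewrite -[4 / l]invf_div lef_pV2 ?posrE ?divr_gt0 //.
  by clear -h1 X0; rewrite -[2 / X]invf_div lef_pV2 ?posrE ?divr_gt0 //; lra.
have eb : `|Psi (ln b) - Psi (w B)| <= 4 / l + 2 / X.
  by apply: ends => //; clear -B3 lX; rewrite -/B /X /l in lX *; lra.
have ea : `|Psi (ln a) - Psi (w A)| <= 4 / l + 2 / X.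
  by apply: ends => //; clear -A3 lX; rewrite -/A /X /l in lX *; lra.
have Pb : Psi (ln b) = 0.
  have e : 2 * ln b - ln b = ln b by ring.
  by rewrite /Psi /X e subrr.
have Pa : Psi (ln a) = - (ln (2 * X - l) - ln l).
  rewrite /Psi.
  have la0 : 0 < ln a by clear -l0; rewrite /l in l0; lra.
  have xa0 : 0 < X - ln a by clear -lX la0; rewrite /l in lX; lra.
  have -> : ln (2 * X - l) = ln 2 + ln (X - ln a).
    by rewrite -lnM ?posrE //; congr ln; rewrite /l; ring.
  have -> : ln l = ln 2 + ln (ln a) by rewrite -lnM ?posrE.
  ring.
have sumE : \sum_(A.+1 <= p < B.+1) (P p)%:R * (p%:R^-1 / (X - ln p%:R)) =
  \sum_(A.+1 <= n < B.+1) (S n - S n.-1) * f n + \sum_(A.+1 <= n < B.+1) (w n - w n.-1) * f n.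
  rewrite -big_split /=; apply: eq_big_nat => n /andP[An nB].
  have [n2 h1 h2] : [/\ (2 <= n)%N, l / 4 <= ln n%:R & ln n%:R <= X / 2] by apply: bet; rewrite -(ltnS n) nB ltnW.
  have n0' : 0 < n%:R :> R by rewrite ltr0n; clear -n2; lia.
  rewrite -mulrDl /S /w; have -> : forall u v y z : R, u - v - (y - z) + (v - z) = u - y by clear; move=> *; ring.
  case: n n2 An nB h1 h2 n0' => // n n2 An nB h1 h2 n0' /=.
  rewrite psumS addrAC subrr add0r /f; clear -h1 h2 l0 X0 n0'; field; rewrite !gt_eqF //; lra.
rewrite sumE.
move: part1 part2 eb ea; rewrite Pb Pa.
set S1 := \sum_(A.+1 <= n < B.+1) (S n - S n.-1) * f n.
set S2 := \sum_(A.+1 <= n < B.+1) (w n - w n.-1) * f n.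
set M := ln (2 * X - l) - ln l.
move: (Psi (w A)) (Psi (w B)) => pA pB.
have -> : 4 * K * (4 / (l * X)) = 16 * K / (X * l) by field; rewrite !gt_eqF.
move=> h1 h2 h3 h4.
have i1 : X^-1 <= l^-1 by rewrite lef_pV2.
have h5 : `|M - X * S2| <= 18 / l.
  move: h2 h3 h4; clear -i1; rewrite !ler_norml; move: (X * S2) => t h2 h3 h4; lra.
have h6 : `|S2 - M / X| <= 18 * K / (X * l).
  have -> : S2 - M / X = - (M - X * S2) / X by field; rewrite gt_eqF.
  rewrite normrM normrN normfV (gtr0_norm X0) ler_pdivrMr //.
  have -> : 18 * K / (X * l) * X = 18 * K / l by field; rewrite !gt_eqF.
  have i2 : 0 <= l^-1 by rewrite invr_ge0 ltW.
  apply: (le_trans h5); rewrite ler_wpM2r //; clear -K1; lra.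
rewrite -addrA; apply: (le_trans (ler_normD _ _)); clear -h1 h6; lra.
Qed.

(** * Elementary asymptotics of the iterated logarithm and of li *)

(** The condition [2^-1 <= X - l] stands for [r >= 2]. It keeps [M] above a multiple of [1 / l], so
    that errors of size [1 / (X l)] are absorbed by [M / X]. *)
Lemma inv_le_loglog {R : realType} (l X : R) : 1 <= l -> 2^-1 <= X - l ->
  l^-1 <= 3 * (ln (2 * X - l) - ln l).
Proof.
move=> l1 Xl; have l0 : 0 < l by lra. have w0 : 0 < 2 * X - l by lra.
have h := ln_le_sub w0 l0.
have h2 : 2 * (X - l) / (2 * X - l) <= ln (2 * X - l) - ln l.
  have -> : 2 * (X - l) / (2 * X - l) = - ((l - (2 * X - l)) / (2 * X - l)) by field; rewrite gt_eqF.
  lra.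
apply: (@le_trans _ _ (3 * (2 * (X - l) / (2 * X - l)))); last by rewrite ler_pM2l.
have -> : l^-1 = 1 / l by rewrite mul1r.
rewrite mulrA ler_pdivrMr // mulrAC ler_pdivlMr //; nra.
Qed.

Lemma loglog_le {R : realType} (l X : R) : 0 < l -> l <= X ->
  ln (2 * X - l) - ln l <= 2 * X / l.
Proof.
move=> l0 lX; have w0 : 0 < 2 * X - l by lra.
apply: (le_trans (ln_le_sub l0 w0)); rewrite ler_wpM2r ?invr_ge0 ?(ltW l0) //; lra.
Qed.

Lemma loglog_ge {R : realType} (l X : R) : 0 < l -> l <= X ->
  ln X - ln l <= ln (2 * X - l) - ln l.
Proof. by move=> l0 lX; rewrite lerD2r ler_ln ?posrE; lra. Qed.

(** If [l ^ 2 <= X] then [M >= ln (X / l) >= ln X / 2]. Otherwise [M >= (X - l) / X]: for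
    [l <= X / 2] this is at least [1 / 2], and for larger [l] the weak bound [X - l >= 1 / 2] is
    compensated by [l ^ 2 >= X ^ 2 / 4]. *)
Lemma loglog_dichotomy {R : realType} (l X : R) : 1 <= l -> 2^-1 <= X - l ->
  let M := ln (2 * X - l) - ln l in ln X / 2 <= M * l \/ X / 8 <= M * l ^+ 2.
Proof.
move=> l1 Xl M; have l0 : 0 < l by lra. have w0 : 0 < 2 * X - l by lra.
have X0 : 0 < X by lra.
have M0 : 0 <= M by rewrite subr_ge0 ler_ln ?posrE //; lra.
have [h|h] := leP (l ^+ 2) X.
  left; have h1 : ln (l ^+ 2) <= ln X by rewrite ler_ln ?posrE // exprn_gt0.
  rewrite lnXn // -mulr_natl in h1.
  have lX : l <= X by lra.
  have h2 := loglog_ge l0 lX; rewrite -/M in h2.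
  by apply: (@le_trans _ _ M); [lra|nra].
right; have h1 := ln_le_sub w0 l0.
have h2 : (X - l) / X <= M.
  apply: (@le_trans _ _ (- ((l - (2 * X - l)) / (2 * X - l)))); last by rewrite /M; lra.
  rewrite -mulNr ler_pdivrMr // mulrAC ler_pdivlMr //; nra.
rewrite ler_pdivrMr // in h2.
have [h3|h3] := leP l (X / 2).
  have : 2^-1 <= M by nra.
  move=> M2; apply: (@le_trans _ _ (2^-1 * X)); [lra | apply: ler_pM; lra].
have h4 : 2^-1 <= M * X by lra.
rewrite expr2 in h *.
have : X / 2 * (X / 2) <= l * l by apply: ler_pM; lra.
move: (l * l) => q hq; apply: (@le_trans _ _ (M * (X / 2 * (X / 2)))); last by rewrite ler_wpM2l.
nra.
Qed.

(** Since li is known only through mean value bounds, dyadic induction replaces integration by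
    parts; one step adds [(y / 2) / ln (y / 2)]. For [ln y <= 9 * ln 2] the crude [li y <= 2 * y] is
    enough, whence [162 = 2 * 81]. Beyond, [ln (y / 2) >= 8 / 9 * ln y], and halving [y] nearly
    halves the error, which leaves room for the new term. *)
Lemma li_asymp {R : realType} (li : R -> R) : li 2 = 0 ->
  (forall u v, 2 <= u -> u <= v ->
     (v - u) / ln v <= li v - li u /\ li v - li u <= (v - u) / ln u) ->
  forall y, 2 <= y -> `|li y - y / ln y| <= 162 * y / ln y ^+ 2.
Proof.
move=> li2 hli y y2.
have ly : 0 < ln y by rewrite ln_gt0 //; lra.
have l2 := @ln2_ge R; have l2' := @ln2_le R.
have low : y / ln y - li y <= 162 * y / ln y ^+ 2.
  have [h _] := hli 2 y (lexx _) y2; rewrite li2 subr0 in h.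
  apply: (@le_trans _ _ (2 / ln y)).
    have -> : y / ln y = (y - 2) / ln y + 2 / ln y by rewrite -mulrDl subrK.
    lra.
  rewrite expr2 invfM mulrA ler_wpM2r ?invr_ge0 ?(ltW ly) // ler_pdivlMr //.
  have : ln y < y by apply: ln_sublinear; lra.
  lra.
have up (k : nat) : forall y : R, 2 <= y -> y <= 2 ^+ k -> li y <= y / ln y + 162 * y / ln y ^+ 2.
  elim: k => [|k IH] {y2 ly low} {}y y2 yk; first by rewrite expr0 in yk; lra.
  have ly : 0 < ln y by rewrite ln_gt0 //; lra.
  have [ys|ys] := leP (ln y) (9 * ln 2).
    have [_ h] := hli 2 y (lexx _) y2; rewrite li2 subr0 in h.
    apply: (@le_trans _ _ (2 * y)).
      apply: (le_trans h); rewrite ler_pdivrMr; last lra. nra.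
    rewrite -[leLHS]add0r; apply: lerD; first by rewrite divr_ge0 //; lra.
    rewrite ler_pdivlMr ?exprn_gt0 // expr2.
    have : ln y * ln y <= 9 * 9 by apply: ler_pM; lra.
    move: (ln y * ln y) => q; nra.
  have y0 : 0 < y by lra.
  have y4 : 2 <= y / 2.
    have : 4 <= y; last by lra.
    rewrite -ler_ln ?posrE //; have -> : 4 = 2 ^+ 2 :> R by rewrite expr2; lra.
    by rewrite lnXn // mulr2n; lra.
  have lh : ln (y / 2) = ln y - ln 2 by rewrite ln_div ?posrE.
  have h1 := IH (y / 2) y4; rewrite exprS in yk.
  have {}h1 : li (y / 2) <= y / 2 / ln (y / 2) + 162 * (y / 2) / ln (y / 2) ^+ 2 by apply: h1; lra.
  have q_bound : y / 2 <= y by lra.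
  have [_ h2] := hli (y / 2) y y4 q_bound.
  rewrite lh in h1 h2; set t := ln 2 in l2 l2' ys h1 h2 *; set L := ln y in ly ys h1 h2 *.
  have d0 : 0 < L - t by lra.
  apply: (@le_trans _ _ (y * ((L - t)^-1 + 81 * (L - t)^-1 ^+ 2))).
    have -> : y * ((L - t)^-1 + 81 * (L - t)^-1 ^+ 2) =
      y / 2 / (L - t) + 162 * (y / 2) / (L - t) ^+ 2 + (y - y / 2) / (L - t) by field; rewrite gt_eqF.
    lra.
  have -> : y / L + 162 * y / L ^+ 2 = y * (L^-1 + 162 * L^-1 ^+ 2) by field; rewrite gt_eqF.
  rewrite ler_pM2l //.
  have e1 : (L - t)^-1 <= 9 / 8 * L^-1.
    have -> : 9 / 8 * L^-1 = (8 / 9 * L)^-1 by field; rewrite gt_eqF.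
    by clear -ys l2 ly d0; rewrite lef_pV2 ?posrE //; lra.
  have e2 : (L - t)^-1 - L^-1 = t * L^-1 * (L - t)^-1 by field; rewrite !gt_eqF.
  have i1 : 0 < L^-1 by rewrite invr_gt0.
  have i2 : 0 < (L - t)^-1 by rewrite invr_gt0.
  have e3 : (L - t)^-1 - L^-1 <= 9 / 8 * L^-1 ^+ 2.
    rewrite e2 expr2 mulrA; apply: (@le_trans _ _ (1 * L^-1 * (9 / 8 * L^-1))); last by lra.
    clear -l2 l2' i1 i2 e1; apply: ler_pM => //; [nra|lra|nra].
  have e4 : (L - t)^-1 ^+ 2 <= (9 / 8 * L^-1) ^+ 2.
    by clear -i1 i2 e1; rewrite lerXn2r ?nnegrE //; lra.
  have p0 := sqr_ge0 L^-1.
  rewrite exprMn in e4; move: (L^-1 ^+ 2) ((L - t)^-1 ^+ 2) p0 e3 e4 => p q p0 e3 e4.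
  lra.
have [k yk] : exists k : nat, y <= 2 ^+ k.
  exists (Num.truncn y).+1; apply: (@le_trans _ _ (Num.truncn y).+1%:R).
    by rewrite ltW // truncnS_gt.
  by rewrite -natrX ler_nat ltnW // ltn_expl.
have h := up k y y2 yk.
rewrite ler_norml; apply/andP; split; lra.
Qed.

(** * The analytic hypotheses over the primes coprime to Q *)

Definition err {R : realType} (delta : R -> R) (y : R) : R := y / ln y * delta y.

(** [P] is the set of primes coprime to [Q] and [chi] is supported on it; a
    single [K] absorbs the constants, including those depending on [Q].  [D]
    stands for [Delta], of which only [st_D], [st_dD] and [st_Dm] are needed. *)
Record setting {R : realType} (K : R) (P : pred nat) (chi : nat -> R)
    (delta D li : R -> R) : Prop := Setting {
  st_K : 1 <= K;
  st_P : forall n, P n -> (2 <= n)%N;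
  st_chi : forall n, `|chi n| <= (P n)%:R;
  st_cheb : forall y, 2 <= y -> psum (fun n => (P n)%:R) (Num.truncn y) <= K * (y / ln y);
  st_mert : forall n, (0 < n)%N ->
    `|psum (fun p => (P p)%:R * (ln p%:R / p%:R)) n - ln n%:R| <= K;
  st_d0 : forall u, 2 <= u -> 0 <= delta u;
  st_pi : forall y, 2 <= y ->
    `|psum (fun n => (P n)%:R) (Num.truncn y) - li y| <= K * err delta y;
  st_Pi : forall y, 2 <= y -> `|psum chi (Num.truncn y)| <= K * err delta y;
  st_low : forall y, 2 <= y -> K^-1 <= err delta y;
  st_mono : forall u v, 2 <= u -> u <= v -> err delta u <= K * err delta v;
  st_dec : forall u v, 2 <= u -> u <= v -> delta v * ln v <= K * (delta u * ln u);
  st_li2 : li 2 = 0;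
  st_li : forall u v, 2 <= u -> u <= v ->
     (v - u) / ln v <= li v - li u /\ li v - li u <= (v - u) / ln u;
  st_D : forall t N, 2 <= t ->
     \sum_((Num.truncn t).+1 <= n < N.+1) delta n%:R / n%:R <= K * D t;
  st_dD : forall t, 2 <= t -> delta t <= D t;
  st_Dm : forall t u, 2 <= t -> t <= u -> D u <= K * D t }.

(** From here on [a = sqrt s] and [b = sqrt x], so that [x = b * b] and
    [r = b * b / (a * a)]. *)
Definition loglog {R : realType} (a b : R) : R :=
  ln (2 * (2 * ln b) - 2 * ln a) - ln (2 * ln a).

(** Expected number of pairs. *)
Definition pair_main {R : realType} (a b : R) : R := b * b * (loglog a b / (2 * ln b)).

(** [min (r p) (x / p)]. *)
Definition q_bound {R : realType} (a b : R) (p : nat) : R :=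
  if p%:R <= a then b * b / (a * a) * p%:R else b * b / p%:R.

(** The hypotheses [2 <= a] and [2 * (a * a) <= b * b] are [s >= 4] and [r >= 2]; the latter gives
    [2 * ln b - 2 * ln a = ln r >= ln 2]. *)
Lemma range_facts {R : realType} (a b : R) : 2 <= a -> 2 * (a * a) <= b * b -> 0 < b ->
  [/\ a <= b, 1 <= 2 * ln a, 2^-1 <= 2 * ln b - 2 * ln a,
      (2 * ln a)^-1 <= 3 * loglog a b & 0 < loglog a b].
Proof.
move=> a2 ab b0; have l2 := @ln2_ge R.
have leab : a <= b by nra.
have la : ln 2 <= ln a by rewrite ler_ln ?posrE //; lra.
have l1 : 1 <= 2 * ln a by lra.
have a0 : 0 < a by lra.
have Xl : 2^-1 <= 2 * ln b - 2 * ln a.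
  have : ln (2 * (a * a)) <= ln (b * b) by rewrite ler_ln ?posrE //; nra.
  by rewrite !lnM ?posrE ?mulr_gt0 //; lra.
have h := inv_le_loglog l1 Xl.
split => //; have : 0 < (2 * ln a)^-1 by rewrite invr_gt0; lra.
rewrite /loglog; lra.
Qed.

Lemma err_ge0 {R : realType} K P (chi : nat -> R) delta D li (H : setting K P chi delta D li) y :
  2 <= y -> 0 <= err delta y.
Proof.
move=> y2; rewrite mulr_ge0 //; last exact: (st_d0 H).
by rewrite divr_ge0 ?ln_ge0; lra.
Qed.

(** Since [delta * ln] is almost decreasing, so is [delta]. This brings [delta] at points beyond
    [b], such as [x / a] and [x / p], back to [delta b]. *)
Lemma err_large {R : realType} K P (chi : nat -> R) delta D li (H : setting K P chi delta D li) b z :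
  2 <= b -> b <= z -> delta z <= K * delta b.
Proof.
move=> b2 bz; have z2 : 2 <= z by lra.
have lb : 0 < ln b by rewrite ln_gt0; lra.
have lz : 0 < ln z by rewrite ln_gt0; lra.
have lbz : ln b <= ln z by rewrite ler_ln ?posrE; lra.
have h := st_dec H b2 bz; have d := st_d0 H b2; have K1 := st_K H.
rewrite -(ler_pM2r lz); apply: (le_trans h).
rewrite -mulrA; apply: ler_wpM2l; [lra|exact: ler_wpM2l].
Qed.

(** The error [34 * K / (X * l)] is absorbed through [1 / l <= 3 * M], whence [103 = 1 + 3 * 34]. *)
Lemma weighted_le {R : realType} K P (chi : nat -> R) delta D li (H : setting K P chi delta D li)
   (a b : R) : 2 <= a -> 2 * (a * a) <= b * b -> 0 < b ->
  \sum_((Num.truncn a).+1 <= p < (Num.truncn b).+1) (P p)%:R * (p%:R^-1 / (2 * ln b - ln p%:R))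
    <= 103 * K * (loglog a b / (2 * ln b)).
Proof.
move=> a2 hab b0; have [ab l1 Xl il M0] := range_facts a2 hab b0.
have := mertens_weighted (st_K H) a2 ab (st_mert H).
cbv zeta; rewrite -/(loglog a b) ler_norml => /andP[_].
set V := \sum_(_ <= _ < _) _; move: (loglog a b) M0 il => M M0 il.
set X := 2 * ln b in Xl *; set l := 2 * ln a in l1 Xl il *.
have X0 : 0 < X by lra. have l0 : 0 < l by lra.
move=> h; have K1 := st_K H.
have e : 34 * K / (X * l) <= 102 * K * (M / X).
  have -> : 34 * K / (X * l) = 34 * K * X^-1 * l^-1 by field; rewrite !gt_eqF.
  have -> : 102 * K * (M / X) = 34 * K * X^-1 * (3 * M) by field; rewrite !gt_eqF.
  by rewrite ler_wpM2l // mulr_ge0 ?invr_ge0; lra.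
have : M / X <= K * (M / X) by rewrite ler_peMl // divr_ge0; lra.
lra.
Qed.

Lemma psum_supp {R : realType} (P : pred nat) (c d : nat -> R) m n :
  (forall k, (m <= k < n)%N -> P k -> c k <= d k) ->
  \sum_(m <= k < n) (P k)%:R * c k <= \sum_(m <= k < n) (P k)%:R * d k.
Proof.
move=> h; apply: ler_sum_nat => k kn; case pk: (P k); last by rewrite !mul0r.
by rewrite !mul1r h.
Qed.

(** For [p <= a] the point [r p] may lie below [b], so [err] is first moved up to [z = x / a], the
    value at [p = a]; the loss is acceptable because only [O (a / l)] primes are concerned. For
    [p > a] the point [x / p] is at least [b], and the weighted Mertens sum applies. The errors at
    [p] itself are moved up to [b]. The constants add up to [12 + 103 + 12]. *)
Lemma err_sum {R : realType} K P (chi : nat -> R) delta D li (H : setting K P chi delta D li)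
   (a b : R) : 2 <= a -> 2 * (a * a) <= b * b -> 0 < b ->
  \sum_(0 <= p < (Num.truncn b).+1) (P p)%:R * (err delta (q_bound a b p) + err delta p%:R)
    <= 130 * K ^+ 3 * (delta b * pair_main a b).
Proof.
move=> a2 hab b0; have [ab l1 Xl il M0] := range_facts a2 hab b0.
have hV := weighted_le H a2 hab b0; rewrite /pair_main.
set X := 2 * ln b in Xl hV *; set l := 2 * ln a in l1 Xl il *.
set M := loglog a b in il M0 hV *.
have X0 : 0 < X by lra. have l0 : 0 < l by lra. have lX : l <= X by lra.
have b2 : 2 <= b by lra. have K1 := st_K H. have d0 := st_d0 H b2.
have a0 : 0 < a by lra.
have AB : (Num.truncn a <= Num.truncn b)%N by apply: le_truncn.
have Aa : (Num.truncn a)%:R <= a by rewrite truncn_le ltW.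
have Bb : (Num.truncn b)%:R <= b by rewrite truncn_le ltW.
have lbX : ln b = X / 2 by rewrite /X; lra.
have laX : ln a = l / 2 by rewrite /l; lra.
set W := delta b * (b * b * (M / X)).
have W1 : delta b * (b * b) / (X * l) <= 3 * W.
  have -> : delta b * (b * b) / (X * l) = delta b * (b * b) / X * l^-1 by field; rewrite !gt_eqF.
  have -> : 3 * W = delta b * (b * b) / X * (3 * M) by rewrite /W; field; rewrite !gt_eqF.
  rewrite ler_wpM2l // divr_ge0 ?(ltW X0) // !mulr_ge0 //; lra.
have W0 : 0 <= W.
  by rewrite /W; apply: mulr_ge0 => //; apply: mulr_ge0; [apply: mulr_ge0|apply: divr_ge0]; exact: ltW.
under eq_bigr do rewrite mulrDr.
rewrite big_split /=.
have h3 : \sum_(0 <= p < (Num.truncn b).+1) (P p)%:R * err delta p%:R <= 12 * K ^+ 2 * W.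
  apply: (@le_trans _ _ (\sum_(0 <= p < (Num.truncn b).+1) (P p)%:R * (K * err delta b))).
    apply: psum_supp => p /andP[_ pb] /(st_P H) p2; apply: (st_mono H); first by rewrite ler_nat.
    by rewrite (le_trans _ Bb) // ler_nat.
  rewrite -mulr_suml.
  apply: (@le_trans _ _ (K * (b / ln b) * (K * err delta b))).
    apply: ler_wpM2r; last exact: (st_cheb H).
    by rewrite mulr_ge0 ?(err_ge0 H) //; lra.
  rewrite /err lbX.
  have -> : K * (b / (X / 2)) * (K * (b / (X / 2) * delta b)) = 4 * K ^+ 2 * (delta b * (b * b) / (X * X)).
    by field; rewrite !gt_eqF.
  have -> : 12 * K ^+ 2 * W = 4 * K ^+ 2 * (3 * W) by ring.
  apply: ler_wpM2l; first by rewrite mulr_ge0 // sqr_ge0.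
  apply: le_trans W1; apply: ler_wpM2l; first by rewrite !mulr_ge0 // ltW.
  have xx : X * l <= X * X by apply: ler_wpM2l => //; lra.
  by rewrite lef_pV2 ?posrE //; apply: mulr_gt0.
rewrite (@big_cat_nat _ _ _ (Num.truncn a).+1) //=.
have h1 : \sum_(0 <= p < (Num.truncn a).+1) (P p)%:R * err delta (q_bound a b p) <= 12 * K ^+ 3 * W.
  pose z := b * b / a.
  have bz : b <= z by rewrite /z ler_pdivlMr // ler_wpM2l // ltW.
  have z0 : 0 < z by exact: lt_le_trans bz.
  have z2 : 2 <= z by exact: le_trans bz.
  have lz : ln z = X - l / 2 by rewrite /z ln_div ?posrE ?mulr_gt0 // lnM ?posrE //; clear -lbX laX; lra.
  have Ez : err delta z <= 2 * K * (z / X * delta b).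
    rewrite /err lz; apply: (@le_trans _ _ (z / (X / 2) * (K * delta b))); last first.
      by rewrite le_eqVlt; apply/orP; left; apply/eqP; field; rewrite gt_eqF.
    apply: ler_pM; [by clear -z0 lX X0; apply: divr_ge0; lra|exact: (st_d0 H)| |exact: (err_large H)].
    by clear -z0 lX X0; rewrite ler_wpM2l ?(ltW z0) // lef_pV2 ?posrE; lra.
  apply: (@le_trans _ _ (\sum_(0 <= p < (Num.truncn a).+1) (P p)%:R * (K * err delta z))).
    apply: psum_supp => p /andP[_ pa] /(st_P H) p2.
    have pa' : p%:R <= a by rewrite (le_trans _ Aa) // ler_nat.
    have p2R : 2 <= p%:R :> R by rewrite ler_nat.
    rewrite /q_bound pa'; apply: (st_mono H).
      clear -p2R hab a0; have : 1 <= b * b / (a * a) by rewrite ler_pdivlMr ?mulr_gt0 //; nra.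
      move: (_ / _) => q; nra.
    have -> : z = b * b / (a * a) * a by rewrite /z; field; rewrite gt_eqF.
    by clear -pa' a0 b0; rewrite ler_wpM2l // divr_ge0 // mulr_ge0 // ltW.
  rewrite -mulr_suml.
  apply: (@le_trans _ _ (K * (a / ln a) * (K * (2 * K * (z / X * delta b))))).
    have K0 : 0 <= K by exact: le_trans ler01 K1.
    apply: ler_pM; last by apply: ler_wpM2l.
    - by apply: sum_nat_ge0.
    - by apply: mulr_ge0 => //; apply: (err_ge0 H).
    - exact: (st_cheb H).
  rewrite laX.
  have -> : K * (a / (l / 2)) * (K * (2 * K * (z / X * delta b))) = 4 * K ^+ 3 * (delta b * (b * b) / (X * l)).
    by rewrite /z; field; rewrite !gt_eqF.
  have -> : 12 * K ^+ 3 * W = 4 * K ^+ 3 * (3 * W) by ring.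
  by clear -W1 K1; apply: ler_wpM2l W1; rewrite mulr_ge0 // exprn_ge0; lra.
have h2 : \sum_((Num.truncn a).+1 <= p < (Num.truncn b).+1) (P p)%:R * err delta (q_bound a b p) <= 103 * K ^+ 2 * W.
  apply: (@le_trans _ _ (\sum_((Num.truncn a).+1 <= p < (Num.truncn b).+1)
      (P p)%:R * (K * delta b * (b * b) * (p%:R^-1 / (X - ln p%:R))))).
    apply: psum_supp => p /andP[pa pb] /(st_P H) p2.
    have pa' : a < p%:R by rewrite -truncn_lt_nat // ltW.
    have pb' : p%:R <= b by rewrite (le_trans _ Bb) // ler_nat.
    have p0 : 0 < p%:R :> R by exact: lt_trans pa'.
    have bz : b <= b * b / p%:R by rewrite ler_pdivlMr // ler_wpM2l // ltW.
    have npa : (p%:R <= a) = false by rewrite leNgt pa'.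
    rewrite /q_bound npa /err.
    have -> : ln (b * b / p%:R) = X - ln p%:R by rewrite ln_div ?posrE ?mulr_gt0 // lnM ?posrE //; clear -lbX; lra.
    have lpb : ln p%:R <= ln b by rewrite ler_ln ?posrE.
    have Xp : 0 < X - ln p%:R by clear -lpb lbX X0; lra.
    apply: (@le_trans _ _ (b * b / p%:R / (X - ln p%:R) * (K * delta b))).
      apply: ler_wpM2l; last exact: (err_large H).
      by clear -b0 p0 Xp; rewrite !divr_ge0 // ?mulr_ge0 // ltW.
    by rewrite le_eqVlt; apply/orP; left; apply/eqP; field; rewrite !gt_eqF.
  under eq_bigr do rewrite mulrCA.
  rewrite -mulr_sumr.
  have -> : 103 * K ^+ 2 * W = K * delta b * (b * b) * (103 * K * (M / X)) by rewrite /W; ring.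
  by clear -hV K1 d0 b0; apply: ler_wpM2l hV; rewrite !mulr_ge0 //; lra.
have k2 : K ^+ 2 * W <= K ^+ 3 * W.
  by rewrite ler_wpM2r // [leRHS]exprS ler_peMl // sqr_ge0.
have k3 : 0 <= K ^+ 3 * W by clear -K1 W0; rewrite mulr_ge0 // exprn_ge0; lra.
clear -h1 h2 h3 k2 k3; lra.
Qed.

Lemma err_sum_bound {R : realType} K P (chi : nat -> R) delta D li (H : setting K P chi delta D li)
   (a b c : R) (u h : nat -> R) : 2 <= a -> 2 * (a * a) <= b * b -> 0 < b -> 0 <= c ->
  (forall n, `|u n| <= (P n)%:R) ->
  (forall p, P p -> p%:R <= b -> `|h p| <= c * (err delta (q_bound a b p) + err delta p%:R)) ->
  `|\sum_(0 <= p < (Num.truncn b).+1) u p * h p| <= c * (130 * K ^+ 3) * (delta b * pair_main a b).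
Proof.
move=> a2 hab b0 c0 hu hh; apply: (le_trans (ler_norm_sum _ _ _)).
rewrite -[leRHS]mulrA; apply: le_trans (ler_wpM2l c0 (err_sum H a2 hab b0)).
rewrite mulr_sumr; apply: ler_sum_nat => p /andP[_ pb].
rewrite normrM mulrCA; case Pp : (P p).
  have pb' : p%:R <= b by rewrite -truncn_ge_nat // ltW.
  rewrite mul1r; apply: le_trans (hh p Pp pb').
  by rewrite ler_piMl //; move: (hu p); rewrite Pp.
by move: (hu p); rewrite Pp normr_le0 => /eqP ->; rewrite normr0 !mul0r.
Qed.

(** * Sums over the pairs (p, q) *)

Lemma q_bound_bounds {R : realType} (a b : R) (p : nat) : 2 <= a -> 2 * (a * a) <= b * b -> 0 < b ->
  (0 < p)%N -> p%:R <= b -> p%:R <= q_bound a b p /\ q_bound a b p <= b * b.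
Proof.
move=> a2 hab b0 p0 pb; have p1 : 1 <= p%:R :> R by rewrite ler1n.
have aa0 : 0 < a * a by rewrite mulr_gt0 //; lra.
rewrite /q_bound; case: ifP => pa; split.
- rewrite ler_peMl //; rewrite ler_pdivlMr //; lra.
- rewrite mulrAC ler_pdivrMr // ler_wpM2l ?mulr_ge0 // ?(ltW b0) //.
  by apply: (le_trans pa); rewrite ler_peMr; lra.
- by rewrite ler_pdivlMr ?ltr0n //; apply: ler_pM.
- by rewrite ler_pdivrMr ?ltr0n // ler_peMr // mulr_ge0 // ltW.
Qed.

Definition pair_sum {R : realType} (x r : R) (u v : nat -> R) : R :=
  \sum_(p < (Num.truncn x).+1) \sum_(q < (Num.truncn x).+1)
    [&& (p * q)%N%:R <= x, (p < q)%N & q%:R <= r * p%:R]%:R * (u p * v q).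

(** As [p < q] and [p q <= x] force [p <= b], the outer sum stops at [b]. The two upper conditions
    on [q] merge into [q_bound], since [r p <= x / p] exactly when [p <= a]. *)
Lemma pair_sumE {R : realType} (a b : R) (u v : nat -> R) : 2 <= a -> 2 * (a * a) <= b * b -> 0 < b ->
  (forall n, u n != 0 -> (0 < n)%N) ->
  pair_sum (b * b) (b * b / (a * a)) u v =
  \sum_(0 <= p < (Num.truncn b).+1) u p * (psum v (Num.truncn (q_bound a b p)) - psum v p).
Proof.
move=> a2 hab b0 hu; have aa0 : 0 < a * a by rewrite mulr_gt0 //; lra.
have a0 : 0 < a by lra.
have bb0 : 0 <= b * b by rewrite mulr_ge0 // ltW.
have b2 : 2 <= b by nra.
set T := Num.truncn (b * b); set B := Num.truncn b.
have BT : (B <= T)%N by apply: le_truncn; rewrite ler_peMl; lra.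
rewrite /pair_sum -/T.
under eq_bigr do rewrite -(big_mkord xpredT (fun q =>
  [&& (_ * q)%N%:R <= b * b, (_ < q)%N & q%:R <= b * b / (a * a) * _%:R]%:R * (u _ * v q))).
rewrite -(big_mkord xpredT (fun p => \sum_(0 <= q < T.+1)
  [&& (p * q)%N%:R <= b * b, (p < q)%N & q%:R <= b * b / (a * a) * p%:R]%:R * (u p * v q))).
rewrite (@big_cat_nat _ _ _ B.+1) //= [X in _ + X]big_nat [X in _ + X]big1 ?addr0; last first.
  move=> p /andP[pB _]; apply: big1 => q _; case: and3P => [[h1 h2 _]|]; last by rewrite mul0r.
  have bp : b < p%:R by rewrite -truncn_lt_nat // ltW.
  have bq : b < q%:R by apply: (lt_trans bp); rewrite ltr_nat.
  rewrite natrM in h1; suff : b * b < p%:R * q%:R by rewrite ltNge h1.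
  by apply: ltr_pM => //; exact: ltW.
apply: eq_big_nat => p /andP[_ pB].
have [->|up] := eqVneq (u p) 0.
  by rewrite mul0r; apply: big1 => q _; rewrite mul0r mulr0.
have p0 := hu _ up.
have p0R : 0 < p%:R :> R by rewrite ltr0n.
have pb : p%:R <= b by rewrite -truncn_ge_nat // ltW.
have [py yb] := q_bound_bounds a2 hab b0 p0 pb.
have y0 : 0 <= q_bound a b p by rewrite (le_trans _ py).
have pT : (p <= Num.truncn (q_bound a b p))%N by rewrite truncn_ge_nat.
have TT : (Num.truncn (q_bound a b p) <= T)%N by apply: le_truncn.
rewrite psumB // mulr_sumr.
rewrite (@big_cat_nat _ _ _ p.+1 0 T.+1) //=; last by rewrite ltnS (leq_trans pT).
rewrite [X in X + _]big_nat [X in X + _]big1 ?add0r; last first.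
  by move=> q; rewrite /= ltnS => qp; rewrite [(p < q)%N]ltnNge qp andbF mul0r.
rewrite (@big_cat_nat _ _ _ (Num.truncn (q_bound a b p)).+1 p.+1 T.+1) //=.
have key (q : nat) : (q <= Num.truncn (q_bound a b p))%N =
   ((p * q)%N%:R <= b * b) && (q%:R <= b * b / (a * a) * p%:R).
  rewrite truncn_ge_nat // natrM /q_bound; case: ifP => pa.
    apply/idP/andP => [h|[] //]; split => //.
    apply: (@le_trans _ _ (p%:R * (b * b / (a * a) * p%:R))); first by rewrite ler_wpM2l // ltW.
    have -> : p%:R * (b * b / (a * a) * p%:R) = (b * b) * (p%:R * p%:R / (a * a)) by field; rewrite gt_eqF.
    rewrite ler_piMr // ler_pdivrMr // mul1r; apply: ler_pM => //; exact: ltW.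
  have {}pa : a < p%:R by rewrite ltNge pa.
  apply/idP/andP => [h|[h _]]; last by rewrite ler_pdivlMr // mulrC.
  split; first by rewrite mulrC -ler_pdivlMr.
  apply: (le_trans h).
  have -> : b * b / (a * a) * p%:R = b * b / p%:R * (p%:R * p%:R / (a * a)) by field; rewrite !gt_eqF.
  rewrite ler_peMr ?divr_ge0 ?(ltW p0R) // ler_pdivlMr // mul1r.
  by apply: ler_pM; rewrite ltW.
rewrite [X in _ + X]big_nat [X in _ + X]big1 ?addr0; last first.
  move=> q /andP[Tq _]; have := key q; rewrite leqNgt Tq /= => k.
  by rewrite andbCA -k andbF mul0r.
apply: eq_big_nat => q /andP[pq qT].
by rewrite andbCA -key -(ltnS q) qT pq mul1r.
Qed.

Lemma psum_nat {R : realType} (c : nat -> R) (p : nat) : psum c (Num.truncn (p%:R : R)) = psum c p.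
Proof. by rewrite natrK. Qed.

(** Reverses the summation over a triangle, diagonal included, hence the extra [c p]. It moves the
    outer factor into a window sum, where a character cancels. *)
Lemma sum_psum_swap {R : realType} (c d : nat -> R) (n : nat) :
  \sum_(0 <= p < n.+1) c p * psum d p =
  \sum_(0 <= p < n.+1) d p * (psum c n - psum c p + c p).
Proof.
elim: n => [|n IH]; first by rewrite !big_nat1 /psum !big_nat1; ring.
rewrite big_nat_recr //= IH [in RHS]big_nat_recr //= !psumS.
rewrite /psum.
have -> : \sum_(0 <= i < n.+1) d i * (\sum_(0 <= k < n.+1) c k + c n.+1 - \sum_(0 <= k < i.+1) c k + c i) =
 \sum_(0 <= i < n.+1) d i * (\sum_(0 <= k < n.+1) c k - \sum_(0 <= k < i.+1) c k + c i)
  + c n.+1 * \sum_(0 <= i < n.+1) d i.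
  by rewrite mulr_sumr -big_split /=; apply: eq_bigr => i _; ring.
ring.
Qed.

Lemma pcount_ge0 {R : realType} (P : pred nat) n : 0 <= psum (fun n => (P n)%:R : R) n.
Proof. exact: sum_nat_ge0. Qed.

Lemma flat_sum {R : realType} K P (chi : nat -> R) delta D li (H : setting K P chi delta D li)
   (a b : R) : 2 <= a -> 2 * (a * a) <= b * b -> 0 < b ->
  psum (fun n => (P n)%:R) (Num.truncn b) * err delta b <= 12 * K * (delta b * pair_main a b).
Proof.
move=> a2 hab b0; have [ab l1 Xl il M0] := range_facts a2 hab b0.
rewrite /pair_main.
set X := 2 * ln b in Xl *; set l := 2 * ln a in l1 Xl il *.
set M := loglog a b in il M0 *.
have X0 : 0 < X by lra. have l0 : 0 < l by lra. have lX : l <= X by lra.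
have b2 : 2 <= b by lra. have K1 := st_K H. have d0 := st_d0 H b2.
have lbX : ln b = X / 2 by rewrite /X; lra.
apply: (@le_trans _ _ (K * (b / ln b) * err delta b)).
  by apply: ler_wpM2r; [exact: (err_ge0 H) | exact: (st_cheb H)].
rewrite /err lbX.
have -> : K * (b / (X / 2)) * (b / (X / 2) * delta b) = 4 * K * (delta b * (b * b)) / X * X^-1.
  by field; rewrite !gt_eqF.
have -> : 12 * K * (delta b * (b * b * (M / X))) = 4 * K * (delta b * (b * b)) / X * (3 * M).
  by field; rewrite !gt_eqF.
apply: ler_wpM2l.
  by rewrite divr_ge0 ?(ltW X0) // !mulr_ge0 //; lra.
by apply: le_trans il; rewrite lef_pV2.
Qed.

Lemma pair_main_gt0 {R : realType} (a b : R) : 2 <= a -> 2 * (a * a) <= b * b -> 0 < b ->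
  0 < pair_main a b.
Proof.
move=> a2 hab b0; have [ab l1 Xl il M0] := range_facts a2 hab b0.
by rewrite /pair_main; apply: mulr_gt0; [apply: mulr_gt0|apply: divr_gt0 => //; lra].
Qed.

Lemma chi_supp {R : realType} (P : pred nat) (u : nat -> R) :
  (forall n, P n -> (2 <= n)%N) -> (forall n, `|u n| <= (P n)%:R) ->
  forall n, u n != 0 -> (0 < n)%N.
Proof.
move=> hP hu n; case Pn : (P n) (hu n); first by have := hP n Pn; case: n {Pn}.
by rewrite normr_le0 => ->.
Qed.

(** With the character on [q] there is no main term: both ends of the range of [q] are pure errors,
    whatever the outer weight. *)
Lemma pair_sum_chi {R : realType} K P (chi : nat -> R) delta D li (H : setting K P chi delta D li)
   (a b : R) (u : nat -> R) : 2 <= a -> 2 * (a * a) <= b * b -> 0 < b ->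
  (forall n, `|u n| <= (P n)%:R) ->
  `|pair_sum (b * b) (b * b / (a * a)) u chi| <= 130 * K ^+ 4 * (delta b * pair_main a b).
Proof.
move=> a2 hab b0 hu; rewrite pair_sumE //; last exact: chi_supp (st_P H) hu.
have K1 := st_K H.
have -> : 130 * K ^+ 4 = K * (130 * K ^+ 3) by ring.
apply: (err_sum_bound H) => //; first by lra.
move=> p Pp pb; have p2 := st_P H Pp.
have p2R : 2 <= p%:R :> R by rewrite ler_nat.
have [py _] := q_bound_bounds a2 hab b0 (ltnW p2) pb.
apply: (le_trans (ler_normB _ _)); rewrite mulrDr; apply: lerD.
  by apply: (st_Pi H); lra.
by rewrite -psum_nat; apply: (st_Pi H).
Qed.

(** Only the upper end of the range of [q] is replaced by li. The lower end stays exact, because it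
    is removed by cancellation when [u] is the character and by a trivial bound when [u] is the
    indicator of [P]. *)
Lemma pair_sum_P {R : realType} K P (chi : nat -> R) delta D li (H : setting K P chi delta D li)
   (a b : R) (u : nat -> R) : 2 <= a -> 2 * (a * a) <= b * b -> 0 < b ->
  (forall n, `|u n| <= (P n)%:R) ->
  `|pair_sum (b * b) (b * b / (a * a)) u (fun n => (P n)%:R)
    - (\sum_(0 <= p < (Num.truncn b).+1) u p * li (q_bound a b p)
       - \sum_(0 <= p < (Num.truncn b).+1) u p * psum (fun n => (P n)%:R) p)|
   <= 130 * K ^+ 4 * (delta b * pair_main a b).
Proof.
move=> a2 hab b0 hu; rewrite pair_sumE //; last exact: chi_supp (st_P H) hu.
have K1 := st_K H.
rewrite -!sumrB.
under eq_bigr do rewrite -!mulrBr opprD opprK addrACA addNr addr0.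
have -> : 130 * K ^+ 4 = K * (130 * K ^+ 3) by ring.
apply: (err_sum_bound H) => //; first by lra.
move=> p Pp pb; have p2 := st_P H Pp.
have p2R : 2 <= p%:R :> R by rewrite ler_nat.
have [py _] := q_bound_bounds a2 hab b0 (ltnW p2) pb.
apply: (@le_trans _ _ (K * err delta (q_bound a b p))); first by apply: (st_pi H); lra.
by rewrite ler_wpM2l; [|lra|rewrite lerDl; exact: (err_ge0 H)].
Qed.

Lemma pair_sum_chi_P {R : realType} K P (chi : nat -> R) delta D li (H : setting K P chi delta D li)
   (a b : R) : 2 <= a -> 2 * (a * a) <= b * b -> 0 < b ->
  `|pair_sum (b * b) (b * b / (a * a)) chi (fun n => (P n)%:R)
    - \sum_(0 <= p < (Num.truncn b).+1) chi p * li (q_bound a b p)|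
   <= 166 * K ^+ 4 * (delta b * pair_main a b).
Proof.
move=> a2 hab b0; have [ab l1 Xl il M0] := range_facts a2 hab b0.
have h1 := pair_sum_P H a2 hab b0 (st_chi H).
have b2 : 2 <= b by lra. have K1 := st_K H.
have N0 : 0 <= delta b * pair_main a b by rewrite mulr_ge0 ?(st_d0 H) // ltW // pair_main_gt0.
have Bb : (Num.truncn b)%:R <= b by rewrite truncn_le ltW.
have h2 : `|\sum_(0 <= p < (Num.truncn b).+1) chi p * psum (fun n => (P n)%:R) p| <=
   36 * K ^+ 3 * (delta b * pair_main a b).
  (* After the swap each prime carries two partial sums of the character and a diagonal term, all
     three at most [K ^ 2 * err delta b]; for the diagonal term this is the lower bound [st_low]. *)
  rewrite sum_psum_swap; apply: (le_trans (ler_norm_sum _ _ _)).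
  apply: (@le_trans _ _ (psum (fun n => (P n)%:R) (Num.truncn b) * (3 * K ^+ 2 * err delta b))); last first.
    rewrite mulrCA; have -> : 36 * K ^+ 3 * (delta b * pair_main a b) = 3 * K ^+ 2 * (12 * K * (delta b * pair_main a b)) by ring.
    by apply: ler_wpM2l; [rewrite mulr_ge0 // sqr_ge0 | exact: (flat_sum H)].
  rewrite /psum mulr_suml; apply: ler_sum_nat => p /andP[_ pb].
  case Pp : (P p); last by rewrite !mul0r normr0.
  rewrite !mul1r; have p2 := st_P H Pp.
  have p2R : 2 <= p%:R :> R by rewrite ler_nat.
  have pb' : p%:R <= b by rewrite -truncn_ge_nat // ltW.
  have Eb := err_ge0 H b2.
  have c1 : `|psum chi (Num.truncn b)| <= K ^+ 2 * err delta b.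
    apply: le_trans (st_Pi H b2) _; rewrite expr2 ler_wpM2r //; nra.
  have c2 : `|psum chi p| <= K ^+ 2 * err delta b.
    rewrite -psum_nat; apply: le_trans (st_Pi H p2R) _.
    by rewrite expr2 -mulrA ler_wpM2l //; [lra | exact: (st_mono H)].
  have c3 : `|chi p| <= K ^+ 2 * err delta b.
    apply: le_trans (st_chi H p) _; rewrite Pp.
    have := st_low H b2; rewrite -(ler_pM2l (_ : 0 < K)); last by lra.
    rewrite divff; last by rewrite gt_eqF //; lra.
    move=> h; apply: le_trans h _; rewrite expr2 ler_wpM2r //; nra.
  have -> : 3 * K ^+ 2 * err delta b = K ^+ 2 * err delta b + K ^+ 2 * err delta b + K ^+ 2 * err delta b by ring.
  apply: (le_trans (ler_normD _ _)); apply: lerD => //.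
  by apply: (le_trans (ler_normB _ _)); apply: lerD.
have h3 : K ^+ 3 * (delta b * pair_main a b) <= K ^+ 4 * (delta b * pair_main a b).
  by rewrite ler_wpM2r // [leRHS]exprS ler_peMl // exprn_ge0; lra.
move: h1 h2; set x1 := pair_sum _ _ _ _; set x2 := \sum_(_ <= _ < _) _; set x3 := \sum_(_ <= _ < _) _.
rewrite !ler_norml => /andP[? ?] /andP[? ?]; apply/andP; split; lra.
Qed.

(** * Asymptotics of the number of pairs *)

Lemma li_ge0 {R : realType} K P (chi : nat -> R) delta D li (H : setting K P chi delta D li) y :
  2 <= y -> 0 <= li y.
Proof.
move=> y2; have [h _] := st_li H (lexx 2) y2; rewrite (st_li2 H) subr0 in h.
by apply: le_trans h; rewrite divr_ge0 ?ln_ge0; lra.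
Qed.

Lemma li_le {R : realType} K P (chi : nat -> R) delta D li (H : setting K P chi delta D li) y :
  2 <= y -> li y <= 325 * (y / ln y).
Proof.
move=> y2; have ly : 2^-1 <= ln y.
  by apply: le_trans (@ln2_ge R) _; rewrite ler_ln ?posrE; lra.
have := li_asymp (st_li2 H) (st_li H) y2; rewrite ler_norml => /andP[_ h].
have : 162 * y / ln y ^+ 2 <= 324 * (y / ln y); last by lra.
have -> : 162 * y / ln y ^+ 2 = (y / ln y) * (162 / ln y) by field; rewrite gt_eqF //; lra.
rewrite [leRHS]mulrC; apply: ler_wpM2l; first by rewrite divr_ge0; lra.
rewrite ler_pdivrMr; lra.
Qed.

Lemma weighted_le_inv {R : realType} K P (chi : nat -> R) delta D li (H : setting K P chi delta D li)
   (a b : R) : 2 <= a -> 2 * (a * a) <= b * b -> 0 < b ->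
  \sum_((Num.truncn a).+1 <= p < (Num.truncn b).+1) (P p)%:R * (p%:R^-1 / (2 * ln b - ln p%:R))
    <= 206 * K / (2 * ln a).
Proof.
move=> a2 hab b0; have [ab l1 Xl _ _] := range_facts a2 hab b0.
have K1 := st_K H; apply: le_trans (weighted_le H a2 hab b0) _.
have l0 : 0 < 2 * ln a by exact: lt_le_trans l1.
have lX : 2 * ln a <= 2 * ln b by clear -Xl; lra.
have X0 : 0 < 2 * ln b by exact: lt_le_trans lX.
have Ml : loglog a b <= 2 * (2 * ln b) / (2 * ln a) by apply: loglog_le.
have -> : 206 * K / (2 * ln a) = 103 * K * (2 * (2 * ln b) / (2 * ln a) / (2 * ln b)).
  by move: (2 * ln a) (2 * ln b) l0 X0; clear => l X l0 X0; field; rewrite !gt_eqF.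
apply: ler_wpM2l; first by clear -K1; lra.
by apply: ler_wpM2r Ml; rewrite invr_ge0 ltW.
Qed.

Lemma count_sq_le {R : realType} K P (chi : nat -> R) delta D li (H : setting K P chi delta D li)
   (a b : R) : 2 <= a -> 2 * (a * a) <= b * b -> 0 < b ->
  0 <= \sum_(0 <= p < (Num.truncn b).+1) (P p)%:R * psum (fun n => (P n)%:R : R) p
    <= 4 * K ^+ 2 * (b * b / (2 * ln b * (2 * ln a))).
Proof.
move=> a2 hab b0; have [ab l1 Xl _ _] := range_facts a2 hab b0.
have b2 : 2 <= b by exact: le_trans ab.
apply/andP; split.
  by apply: sum_nat_ge0 => p _; apply: mulr_ge0 => //; exact: pcount_ge0.
apply: (@le_trans _ _ (K * (b / ln b) * (K * (b / ln b)))).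
  apply: (@le_trans _ _ (psum (fun n => (P n)%:R) (Num.truncn b) * psum (fun n => (P n)%:R) (Num.truncn b))).
    rewrite {2}/psum mulr_suml; apply: ler_sum_nat => p /andP[_ pB].
    apply: ler_wpM2l => //; rewrite -subr_ge0 psumB //; exact: sum_nat_ge0.
  by apply: ler_pM; rewrite ?(st_cheb H) ?pcount_ge0.
have lX : 2 * ln a <= 2 * ln b by clear -Xl; lra.
have lb : 0 < ln b by clear -lX l1; lra.
have -> : K * (b / ln b) = 2 * K * (b / (2 * ln b)) by field; rewrite gt_eqF.
clear Xl lb; move: (2 * ln a) (2 * ln b) l1 lX b0; clear => l X l1 lX b0.
have l0 : 0 < l by lra. have X0 : 0 < X by lra.
have -> : 2 * K * (b / X) * (2 * K * (b / X)) = 4 * K ^+ 2 * (b * b / X) * X^-1.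
  by field; rewrite !gt_eqF.
have -> : 4 * K ^+ 2 * (b * b / (X * l)) = 4 * K ^+ 2 * (b * b / X) * l^-1 by field; rewrite !gt_eqF.
apply: ler_wpM2l; last by rewrite lef_pV2.
apply: (mulr_ge0 (mulr_ge0 (ler0n _ _) (sqr_ge0 K))).
by apply: divr_ge0; [apply: mulr_ge0|]; exact: ltW.
Qed.

(** The primes up to [a] do not reach the main term: there are [O (a / l)] of them, each
    contributing at most [li (x / a) = O (x / (a X))]. *)
Lemma li_sum_small {R : realType} K P (chi : nat -> R) delta D li (H : setting K P chi delta D li)
   (a b : R) : 2 <= a -> 2 * (a * a) <= b * b -> 0 < b ->
  0 <= \sum_(0 <= p < (Num.truncn a).+1) (P p)%:R * li (q_bound a b p)
    <= 1300 * K * (b * b / (2 * ln b * (2 * ln a))).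
Proof.
move=> a2 hab b0; have [ab l1 Xl _ _] := range_facts a2 hab b0.
have a0 : 0 < a by exact: lt_le_trans a2.
have Aa : (Num.truncn a)%:R <= a by rewrite truncn_le ltW.
have bz : b <= b * b / a by rewrite ler_pdivlMr // ler_wpM2l // ltW.
have z2 : 2 <= b * b / a by exact: le_trans (le_trans a2 ab) bz.
have lz : ln (b * b / a) = 2 * ln b - (2 * ln a) / 2.
  by rewrite ln_div ?posrE ?mulr_gt0 // lnM ?posrE //; field.
have aa0 : 0 <= b * b / (a * a) by apply: divr_ge0; apply: mulr_ge0; exact: ltW.
have yA (p : nat) : (p < (Num.truncn a).+1)%N -> P p -> 2 <= q_bound a b p /\ q_bound a b p <= b * b / a.
  move=> pa /(st_P H) p2.
  have pa' : p%:R <= a by rewrite (le_trans _ Aa) // ler_nat.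
  have p2R : 2 <= p%:R :> R by rewrite ler_nat.
  have [h _] := q_bound_bounds a2 hab b0 (ltnW p2) (le_trans pa' ab).
  split; first exact: le_trans h.
  have -> : b * b / a = b * b / (a * a) * a by field; rewrite gt_eqF.
  by rewrite /q_bound pa' ler_wpM2l.
have liz := li_le H z2; have liz0 := li_ge0 H z2.
apply/andP; split.
  apply: sum_nat_ge0 => p /andP[_ pa]; case Pp : (P p); last by rewrite mul0r.
  by rewrite mul1r; apply: (li_ge0 H); have [] := yA p pa Pp.
apply: (@le_trans _ _ (\sum_(0 <= p < (Num.truncn a).+1) (P p)%:R * li (b * b / a))).
  apply: psum_supp => p /andP[_ pa] Pp; have [q1 q2] := yA p pa Pp.
  rewrite -subr_ge0; have [h _] := st_li H q1 q2; apply: le_trans h.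
  apply: divr_ge0; first by rewrite subr_ge0.
  by apply: ln_ge0; exact: le_trans (ler1n R 2) z2.
rewrite -mulr_suml; apply: (@le_trans _ _ (K * (a / ln a) * (325 * (b * b / a / ln (b * b / a))))).
  by apply: ler_pM => //; [exact: pcount_ge0|exact: (st_cheb H)].
have la : 0 < ln a by clear -l1; lra.
have -> : K * (a / ln a) = K * (a / (2 * ln a / 2)) by field; rewrite gt_eqF.
rewrite lz; have K1 := st_K H.
have {}Xl : 2 * ln a <= 2 * ln b by clear -Xl; lra.
move: (2 * ln a) (2 * ln b) l1 Xl a0 b0 K1; clear => l X l1 lX a0 b0 K1.
have l0 : 0 < l by lra. have X0 : 0 < X by lra.
have -> : K * (a / (l / 2)) * (325 * (b * b / a / (X - l / 2))) = 325 * (2 * K * (b * b / l) * (X - l / 2)^-1).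
  by field; rewrite !gt_eqF //; lra.
have -> : 1300 * K * (b * b / (X * l)) = 325 * (2 * K * (b * b / l) * (X / 2)^-1) by field; rewrite !gt_eqF.
apply: (ler_wpM2l (ler0n _ _)); apply: ler_wpM2l; last by rewrite lef_pV2 ?posrE; lra.
apply: mulr_ge0; first by lra.
by apply: divr_ge0; [apply: mulr_ge0|]; exact: ltW.
Qed.

(** Replacing [li y] by [y / ln y] costs a relative [O (1 / ln y)], and [ln y = X - ln p >= X / 2]
    because [p <= b]. *)
Lemma li_sum_large {R : realType} K P (chi : nat -> R) delta D li (H : setting K P chi delta D li)
   (a b : R) : 2 <= a -> 2 * (a * a) <= b * b -> 0 < b ->
  `|\sum_((Num.truncn a).+1 <= p < (Num.truncn b).+1) (P p)%:R * li (q_bound a b p)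
    - b * b * \sum_((Num.truncn a).+1 <= p < (Num.truncn b).+1) (P p)%:R * (p%:R^-1 / (2 * ln b - ln p%:R))|
   <= 206 * 324 * K * (b * b / (2 * ln b * (2 * ln a))).
Proof.
move=> a2 hab b0; have [ab l1 Xl _ _] := range_facts a2 hab b0.
have a0 : 0 < a by exact: lt_le_trans a2.
have b2 : 2 <= b by exact: le_trans ab.
have V1 := weighted_le_inv H a2 hab b0.
have Bb : (Num.truncn b)%:R <= b by rewrite truncn_le ltW.
have l0 : 0 < 2 * ln a by exact: lt_le_trans l1.
have X0 : 0 < 2 * ln b by clear -l0 Xl; lra.
have lb0 : 0 < ln b by clear -X0; lra.
have bb0 : 0 <= b * b by rewrite mulr_ge0 // ltW.
have c0 : 0 <= 324 * (b * b) / (2 * ln b) := divr_ge0 (mulr_ge0 (ler0n _ _) bb0) (ltW X0).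
have := ler_wpM2l c0 V1.
have -> : 324 * (b * b) / (2 * ln b) * (206 * K / (2 * ln a)) = 206 * 324 * K * (b * b / (2 * ln b * (2 * ln a))).
  by move: (2 * ln a) (2 * ln b) l0 X0; clear => l X l0 X0; field; rewrite !gt_eqF.
apply: le_trans; clear V1 c0.
rewrite !mulr_sumr -sumrB; apply: (le_trans (ler_norm_sum _ _ _)).
apply: ler_sum_nat => p /andP[pa pb].
case Pp : (P p); last by rewrite !mul0r !mulr0 subrr normr0.
have p2 := st_P H Pp.
have pa' : a < p%:R by rewrite -truncn_lt_nat // ltW.
have pb' : p%:R <= b by rewrite (le_trans _ Bb) // ler_nat.
have p0 : 0 < p%:R :> R by exact: lt_trans pa'.
have bz' : b <= b * b / p%:R by rewrite ler_pdivlMr // ler_wpM2l // ltW.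
have npa : (p%:R <= a) = false by rewrite leNgt pa'.
rewrite /q_bound npa !mul1r.
have lpb : ln p%:R <= ln b by rewrite ler_ln ?posrE.
have ly : ln (b * b / p%:R) = 2 * ln b - ln p%:R.
  by rewrite ln_div ?posrE ?mulr_gt0 // lnM ?posrE //; ring.
have := li_asymp (st_li2 H) (st_li H) (le_trans b2 bz'); rewrite ly.
move: (li _) (ln p%:R) (ln b) lpb lb0 p0 bb0; clear => Y lp lb lpb lb0 p0 bb0.
have Xp : 0 < 2 * lb - lp by lra.
have -> : b * b / p%:R / (2 * lb - lp) = b * b * (p%:R^-1 / (2 * lb - lp)) by ring.
move=> h; apply: le_trans h _.
have q0 : 0 <= b * b * (p%:R^-1 / (2 * lb - lp)).
  by apply: mulr_ge0 => //; apply: divr_ge0; [rewrite invr_ge0|]; exact: ltW.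
move: q0; have -> : 162 * (b * b / p%:R) / (2 * lb - lp) ^+ 2 =
   162 * (b * b * (p%:R^-1 / (2 * lb - lp)) * (2 * lb - lp)^-1) by field; rewrite !gt_eqF.
have -> : 324 * (b * b) / (2 * lb) * (p%:R^-1 / (2 * lb - lp)) =
   162 * (b * b * (p%:R^-1 / (2 * lb - lp)) * lb^-1) by field; rewrite !gt_eqF.
move=> q0; apply: (ler_wpM2l (ler0n _ _)); apply: (ler_wpM2l q0).
by rewrite lef_pV2 ?posrE //; lra.
Qed.

(** The second error, of relative size [1 / (M l)], is not governed by [delta] and is kept apart for
    that reason. Its constant majorises [206 * 324 + 1300 + 34 + 4]: the two li sums, the weighted
    Mertens sum, and the pairs with [q <= p]. *)
Lemma pair_sum_PP {R : realType} K P (chi : nat -> R) delta D li (H : setting K P chi delta D li)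
   (a b : R) : 2 <= a -> 2 * (a * a) <= b * b -> 0 < b ->
  `|pair_sum (b * b) (b * b / (a * a)) (fun n => (P n)%:R) (fun n => (P n)%:R) - pair_main a b|
   <= 130 * K ^+ 4 * (delta b * pair_main a b)
      + 70 * 1000 * K ^+ 2 * (b * b / (2 * ln b * (2 * ln a))).
Proof.
move=> a2 hab b0; have [ab l1 Xl _ _] := range_facts a2 hab b0.
have hP n : `|(P n)%:R| <= (P n)%:R :> R by rewrite normr_nat.
have h1 := pair_sum_P H a2 hab b0 hP.
have AB : (Num.truncn a <= Num.truncn b)%N by apply: le_truncn.
rewrite (@big_cat_nat _ _ _ (Num.truncn a).+1 0 (Num.truncn b).+1 xpredT (fun p => (P p)%:R * li (q_bound a b p))) //= in h1.
have s1 := li_sum_small H a2 hab b0; have s2 := li_sum_large H a2 hab b0.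
have pis := count_sq_le H a2 hab b0.
have K1 := st_K H.
have bb0 : 0 <= b * b by rewrite mulr_ge0 // ltW.
have G0 : 0 <= b * b / (2 * ln b * (2 * ln a)).
  apply: divr_ge0 => //; apply: mulr_ge0; clear -l1 Xl; lra.
have s3 := mertens_weighted (st_K H) a2 ab (st_mert H); cbv zeta in s3.
rewrite -/(loglog a b) in s3.
have {}s3 := ler_wpM2l bb0 s3.
rewrite -{1}(ger0_norm bb0) -normrM mulrBr in s3.
have e : b * b * (34 * K / (2 * ln b * (2 * ln a))) = 34 * K * (b * b / (2 * ln b * (2 * ln a))) by ring.
rewrite e in s3; rewrite /pair_main in h1 *.
have kk : K * (b * b / (2 * ln b * (2 * ln a))) <= K ^+ 2 * (b * b / (2 * ln b * (2 * ln a))).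
  by apply: ler_wpM2r => //; rewrite expr2 ler_peMr //; exact: le_trans ler01 K1.
have kk0 : 0 <= K * (b * b / (2 * ln b * (2 * ln a))).
  by apply: mulr_ge0 => //; exact: le_trans ler01 K1.
move: h1 s1 s2 s3 pis kk kk0; clear.
move: (pair_sum _ _ _ _) (\sum_(_ <= _ < _) (P _)%:R * psum _ _) (\sum_(0 <= _ < _) _ * li _) (\sum_(_.+1 <= _ < _) _ * li _) => x1 x2 x3 x4.
move: (b * b * \sum_(_ <= _ < _) _) (b * b * (_ / _)) => v n0.
move: (b * b / _) (130 * _ * _) => G E.
rewrite !ler_norml => /andP[? ?] /andP[? ?] /andP[? ?] /andP[? ?] /andP[? ?] ? ?.
apply/andP; split; lra.
Qed.

(** * Lower bound for the number of pairs; character sums *)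

Lemma psum_window {R : realType} (c : nat -> R) (m n T : nat) : (m <= n)%N -> (n <= T)%N ->
  psum c n - psum c m = \sum_(k < T.+1) ((m < k)%N && (k <= n)%N)%:R * c k.
Proof.
move=> mn nT; rewrite psumB // (@big_nat_widenl _ _ _ m.+1 0) // (@big_nat_widen _ _ _ 0 n.+1 T.+1) //.
rewrite big_mkcond big_mkord; apply: eq_bigr => k _.
by rewrite /= ltnS; case: ifP; rewrite ?mul1r ?mul0r.
Qed.

(** The expected count is at least [b / (4 * ln b)], and the threshold on [delta b] makes each of
    the two end errors at most a quarter of it. *)
Lemma pi_window {R : realType} K P (chi : nat -> R) delta D li (H : setting K P chi delta D li)
   (b u v : R) : 2 <= u -> v - u = b / 4 -> v <= b -> 0 < b -> delta b <= (16 * K ^+ 2)^-1 ->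
  b / (8 * ln b) <= psum (fun n => (P n)%:R) (Num.truncn v) - psum (fun n => (P n)%:R) (Num.truncn u).
Proof.
move=> u2 vu vb b0 db; have K1 := st_K H.
have v2 : 2 <= v by lra. have uv : u <= v by lra. have b2 : 2 <= b by lra.
have lb : 0 < ln b by rewrite ln_gt0; lra.
have lv : 0 < ln v by rewrite ln_gt0; lra.
have lvb : ln v <= ln b by rewrite ler_ln ?posrE; lra.
have := st_pi H u2; have := st_pi H v2; have [h _] := st_li H u2 uv.
have e1 := st_mono H u2 (le_trans uv vb); have e2 := st_mono H v2 vb.
have h2 : b / (4 * ln b) <= (v - u) / ln v.
  rewrite vu invfM mulrA ler_wpM2l ?lef_pV2 ?posrE //; lra.
have h3 : K * (K * err delta b) <= b / (16 * ln b).
  rewrite /err; have -> : K * (K * (b / ln b * delta b)) = b / ln b * K ^+ 2 * delta b by ring.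
  have -> : b / (16 * ln b) = b / ln b * K ^+ 2 * (16 * K ^+ 2)^-1 by field; rewrite !gt_eqF //; lra.
  by apply: ler_wpM2l => //; rewrite mulr_ge0 ?sqr_ge0 // divr_ge0; lra.
have {}e1 : K * err delta u <= b / (16 * ln b).
  by apply: le_trans h3; rewrite ler_wpM2l //; lra.
have {}e2 : K * err delta v <= b / (16 * ln b).
  by apply: le_trans h3; rewrite ler_wpM2l //; lra.
have -> : b / (8 * ln b) = b / (4 * ln b) - b / (16 * ln b) - b / (16 * ln b) by field; rewrite gt_eqF.
rewrite !ler_norml => /andP[? ?] /andP[? ?]; lra.
Qed.

(** The pairs with [p] in [(b/2, 3b/4]] and [q] in [(3b/4, b]] are enough. *)
Lemma pair_sum_PP_ge {R : realType} K P (chi : nat -> R) delta D li (H : setting K P chi delta D li)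
   (a b : R) : 2 <= a -> 2 * (a * a) <= b * b -> 0 < b -> delta b <= (16 * K ^+ 2)^-1 ->
  b * b / (16 * (2 * ln b) ^+ 2) <= pair_sum (b * b) (b * b / (a * a)) (fun n => (P n)%:R) (fun n => (P n)%:R).
Proof.
move=> a2 hab b0 db; have K1 := st_K H; have [ab l1 Xl il M0] := range_facts a2 hab b0.
have b2 : 2 <= b by lra. have lb : 0 < ln b by lra.
have lb2 : 2^-1 <= ln b by lra.
(* For [b < 4] a small [delta b] would contradict the lower bound [st_low]. This makes [b / 2] an
   admissible left end for [pi_window]. *)
have b4 : 4 <= b.
  rewrite leNgt; apply/negP => b4; have := st_low H b2; rewrite /err => h.
  have : b / ln b * delta b <= 8 * (16 * K ^+ 2)^-1.
    apply: ler_pM => //; first by clear -lb b0; rewrite divr_ge0; lra.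
      exact: (st_d0 H).
    by clear -lb lb2 b4; rewrite ler_pdivrMr; lra.
  have -> : 8 * (16 * K ^+ 2)^-1 = K^-1 * (K^-1 / 2) by field; rewrite gt_eqF //; lra.
  have k1 : K^-1 <= 1 by rewrite invf_le1; lra.
  have k0 : 0 < K^-1 by rewrite invr_gt0; lra.
  nra.
have w1 := pi_window H (u := b / 2) (v := 3 * b / 4).
have {}w1 : b / (8 * ln b) <= psum (fun n => (P n)%:R) (Num.truncn (3 * b / 4)) - psum (fun n => (P n)%:R) (Num.truncn (b / 2)) by apply: w1 => //; clear -b4; lra.
have w2 := pi_window H (u := 3 * b / 4) (v := b).
have {}w2 : b / (8 * ln b) <= psum (fun n => (P n)%:R) (Num.truncn b) - psum (fun n => (P n)%:R) (Num.truncn (3 * b / 4)) by apply: w2 => //; clear -b4; lra.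
have aa0 : 0 < a * a by apply: mulr_gt0; exact: lt_le_trans a2.
have bb0 : 0 <= b * b by rewrite mulr_ge0 // ltW.
set T := Num.truncn (b * b).
have t12 : (Num.truncn (b / 2) <= Num.truncn (3 * b / 4))%N by apply: le_truncn; lra.
have t23 : (Num.truncn (3 * b / 4) <= Num.truncn b)%N by apply: le_truncn; lra.
have t3T : (Num.truncn b <= T)%N by apply: le_truncn; clear -b4; rewrite ler_peMl; lra.
rewrite (psum_window _ t12 (leq_trans t23 t3T)) in w1.
rewrite (psum_window _ t23 t3T) in w2.
have q0 : 0 <= b / (8 * ln b) by clear -lb b0; rewrite divr_ge0 //; lra.
have -> : b * b / (16 * (2 * ln b) ^+ 2) = b / (8 * ln b) * (b / (8 * ln b)) by field; rewrite gt_eqF.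
apply: (le_trans (ler_pM q0 q0 w1 w2)).
rewrite mulr_suml /pair_sum -/T; apply: ler_sum => p _; rewrite mulr_sumr; apply: ler_sum => q _.
rewrite mulrACA; apply: ler_wpM2r; first by rewrite mulr_ge0.
case: andP => [[p1 p2]|_]; last by rewrite mul0r.
case: andP => [[q1 q2]|_]; last by rewrite mulr0.
rewrite truncn_ge_nat in p2; last by clear -b4; lra.
rewrite truncn_ge_nat in q2; last by clear -b4; lra.
rewrite truncn_lt_nat in p1; last by clear -b4; lra.
rewrite (leq_ltn_trans _ q1) /=; last by clear -p2 b4; rewrite truncn_ge_nat; lra.
have -> : (p * q)%N%:R <= b * b.
  by rewrite natrM; clear -p2 q2 b4; apply: ler_pM => //; lra.
have -> // : q%:R <= b * b / (a * a) * p%:R; last by rewrite mulr1.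
have r2 : 2 <= b * b / (a * a) by rewrite ler_pdivlMr.
have p0 : 0 <= p%:R :> R by []. clear -r2 p0 p1 q2 b0; move: (b * b / (a * a)) r2 => r r2; nra.
Qed.

Lemma psum_chi_le {R : realType} K P (chi : nat -> R) delta D li (H : setting K P chi delta D li)
   (y : R) (n : nat) : 2 <= y -> n%:R <= y -> `|psum chi n| <= K ^+ 2 * err delta y.
Proof.
move=> y2 ny; have K1 := st_K H; have E0 := err_ge0 H y2.
have [n2|n2] := leqP 2 n.
  have n2R : 2 <= n%:R :> R by rewrite ler_nat.
  rewrite -psum_nat; apply: le_trans (st_Pi H n2R) _.
  by rewrite expr2 -mulrA ler_wpM2l //; [lra | exact: (st_mono H)].
have z k : (k < 2)%N -> chi k = 0.
  move=> k2; apply/eqP; rewrite -normr_le0; have := st_chi H k.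
  case Pk : (P k) => //; by have := st_P H Pk; rewrite leqNgt k2.
rewrite (_ : psum chi n = 0); first by rewrite normr0 mulr_ge0 // sqr_ge0.
rewrite /psum big_nat big1 // => k /andP[_ kn]; apply: z; exact: leq_trans kn _.
Qed.

Lemma chi_small_sum {R : realType} K P (chi : nat -> R) delta D li (H : setting K P chi delta D li)
   (a F : R) (f : nat -> R) : 2 <= a -> 0 <= F ->
   (forall n, (1 < n < Num.truncn a)%N -> f n <= f n.+1) ->
   ((1 < Num.truncn a)%N -> `|f 2%N| <= F /\ `|f (Num.truncn a)| <= F) ->
  `|\sum_(0 <= p < (Num.truncn a).+1) chi p * f p| <= 4 * (K ^+ 2 * err delta a) * F.
Proof.
move=> a2 F0 hf hF; have a0 : 0 < a by lra.
have A2 : (2 <= Num.truncn a)%N by rewrite truncn_ge_nat // ltW.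
have Aa : (Num.truncn a)%:R <= a by rewrite truncn_le ltW.
have z k : (k < 2)%N -> chi k = 0.
  move=> k2; apply/eqP; rewrite -normr_le0; have := st_chi H k.
  case Pk : (P k) => //; by have := st_P H Pk; rewrite leqNgt k2.
have -> : \sum_(0 <= p < (Num.truncn a).+1) chi p * f p =
   \sum_(2 <= n < (Num.truncn a).+1) (psum chi n - psum chi n.-1) * f n.
  rewrite (@big_cat_nat _ _ _ 2) //=; last by rewrite ltnS ltnW.
  rewrite [X in X + _]big_nat [X in X + _]big1 ?add0r; last by move=> k /andP[_ /z ->]; rewrite mul0r.
  apply: eq_big_nat => -[|n] // _; by rewrite psumS addrAC subrr add0r.
apply: abel_inc => //; first exact: ltnW.
move=> n /andP[_ nA]; apply: (psum_chi_le H) => //.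
by rewrite (le_trans _ Aa) // ler_nat.
Qed.

(** Uniform in [N], so that it serves for the convergence as well as for the size of the tail. In
    the Abel summation [1 / n] varies by at most [1 / n ^ 2], and
    [err delta n / n ^ 2 = delta n / (n ln n)] sums to [O (D t / ln t)]; each end term has the same
    size. *)
Lemma tail_bound {R : realType} K P (chi : nat -> R) delta D li (H : setting K P chi delta D li)
   (t : R) (N : nat) : 2 <= t ->
  `|\sum_((Num.truncn t).+1 <= p < N.+1) chi p / p%:R| <= 3 * K ^+ 2 * (D t / ln t).
Proof.
move=> t2; have K1 := st_K H; have t0 : 0 < t by lra.
have lt0 : 0 < ln t by rewrite ln_gt0; lra.
have dD := st_dD H t2; have d0 := st_d0 H t2.
have D0 : 0 <= D t / ln t by rewrite divr_ge0; lra.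
have Tt : (Num.truncn t)%:R <= t by rewrite truncn_le ltW.
set T := Num.truncn t in Tt *.
have [NT|TN] := leqP N T.
  by rewrite big_geq // normr0 mulr_ge0 // mulr_ge0 // sqr_ge0.
have -> : \sum_(T.+1 <= p < N.+1) chi p / p%:R =
   \sum_(T.+1 <= n < N.+1) (psum chi n - psum chi n.-1) * n%:R^-1.
  by apply: eq_big_nat => -[|n] // _; rewrite psumS addrAC subrr add0r.
have T2 : (2 <= T)%N by rewrite truncn_ge_nat // ltW.
have big (n : nat) : (T < n)%N -> [/\ 2 <= n%:R :> R, t <= n%:R, ln t <= ln n%:R & 0 < n%:R :> R].
  move=> Tn; have h : t <= n%:R by rewrite ltW // -truncn_lt_nat // ltW.
  by split => //; [lra|rewrite ler_ln ?posrE; lra|lra].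
have T2R : 2 <= T%:R :> R by rewrite ler_nat.
apply: (le_trans (@abel_bound R (psum chi) (fun n => n%:R^-1) (fun n => K * err delta n%:R) T N TN _)).
  move=> n /andP[Tn _]; rewrite -{1}psum_nat; apply: (st_Pi H).
  by rewrite (le_trans T2R) // ler_nat.
have i1 : K * err delta N%:R * `|N%:R^-1| <= K ^+ 2 * (D t / ln t).
  have [N2 tN lN N0] := big N TN.
  rewrite ger0_norm ?invr_ge0 // /err.
  have -> : K * (N%:R / ln N%:R * delta N%:R) / N%:R = K * (delta N%:R / ln N%:R).
    by field; rewrite !gt_eqF //; lra.
  rewrite expr2 -mulrA; apply: ler_wpM2l; first by lra.
  have h := err_large H t2 tN.
  rewrite mulrA; apply: ler_pM => //; first exact: (st_d0 H).
  - by rewrite invr_ge0; lra.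
  - apply: (le_trans h); rewrite ler_wpM2l //; lra.
  - by rewrite lef_pV2 ?posrE //; lra.
have i2 : K * err delta T%:R * `|T.+1%:R^-1| <= K ^+ 2 * (D t / ln t).
  have [N2 tN lN N0] := big T.+1 (ltnSn T).
  rewrite ger0_norm ?invr_ge0 //.
  apply: (@le_trans _ _ (K * (K * err delta t) * t^-1)).
    apply: ler_pM; rewrite ?invr_ge0 //.
    - by rewrite mulr_ge0 ?(err_ge0 H) //; lra.
    - by rewrite ler_wpM2l; [|lra|exact: (st_mono H)].
    - by rewrite lef_pV2 ?posrE.
  rewrite /err; have -> : K * (K * (t / ln t * delta t)) / t = K ^+ 2 * (delta t / ln t).
    by field; rewrite !gt_eqF.
  by rewrite ler_wpM2l ?sqr_ge0 // ler_wpM2r // invr_ge0 ltW.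
have i3 : \sum_(T.+1 <= n < N) K * err delta n%:R * `|n%:R^-1 - n.+1%:R^-1| <= K ^+ 2 * (D t / ln t).
  apply: (@le_trans _ _ (K / ln t * \sum_(T.+1 <= n < N.+1) delta n%:R / n%:R)); last first.
    apply: (@le_trans _ _ (K / ln t * (K * D t))); last by rewrite le_eqVlt; apply/orP; left; apply/eqP; ring.
    by apply: ler_wpM2l; [rewrite divr_ge0; lra | exact: (st_D H)].
  rewrite big_nat_recr //= mulrDr mulr_sumr -[leLHS]addr0; apply: lerD; last first.
    have [N2 tN lN N0] := big N TN.
    by rewrite mulr_ge0 ?divr_ge0 ?(st_d0 H) //; lra.
  apply: ler_sum_nat => n /andP[Tn _]; have [n2 tn ln_ n0] := big n Tn.
  have n1 : 0 < n.+1%:R :> R by rewrite ltr0n.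
  have e1 : n.+1%:R = n%:R + 1 :> R by rewrite natr1.
  rewrite ger0_norm; last by rewrite subr_ge0 lef_pV2 ?posrE // ler_nat.
  have lnn : 0 < ln n%:R := lt_le_trans lt0 ln_.
  apply: (@le_trans _ _ (K * err delta n%:R * (n%:R^-1 * n%:R^-1))).
    apply: ler_wpM2l; first by rewrite mulr_ge0 ?(err_ge0 H) //; lra.
    have -> : n%:R^-1 - n.+1%:R^-1 = n%:R^-1 * n.+1%:R^-1 :> R.
      by rewrite e1; field; rewrite gt_eqF // gt_eqF // -e1.
    by rewrite ler_wpM2l ?invr_ge0 ?lef_pV2 ?posrE // ler_nat.
  rewrite /err; have -> : K * (n%:R / ln n%:R * delta n%:R) * (n%:R^-1 * n%:R^-1) = K * (delta n%:R / n%:R) * (ln n%:R)^-1.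
    by field; rewrite !gt_eqF.
  have -> : K / ln t * (delta n%:R / n%:R) = K * (delta n%:R / n%:R) * (ln t)^-1 by ring.
  apply: ler_wpM2l; last by rewrite lef_pV2 ?posrE.
  by rewrite mulr_ge0 ?divr_ge0 ?(st_d0 H) //; lra.
lra.
Qed.

(** * The main term of the character sum *)

Definition Lpart {R : realType} (chi : nat -> R) (a : R) : R :=
  (a * a)^-1 * \sum_(0 <= p < (Num.truncn a).+1) chi p * p%:R.

Definition tail_sum {R : realType} (chi : nat -> R) (t : R) (N : nat) : R :=
  \sum_((Num.truncn t).+1 <= p < N.+1) chi p / p%:R.

Lemma Lpart_le {R : realType} K P (chi : nat -> R) delta D li (H : setting K P chi delta D li)
   (a : R) : 2 <= a -> `|Lpart chi a| <= 8 * K ^+ 2 * (delta a / (2 * ln a)).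
Proof.
move=> a2; have a0 : 0 < a by lra.
have Aa : (Num.truncn a)%:R <= a by rewrite truncn_le ltW.
have la : 0 < ln a by rewrite ln_gt0; lra.
rewrite /Lpart normrM ger0_norm ?invr_ge0 ?mulr_ge0 ?(ltW a0) //.
rewrite mulrC ler_pdivrMr ?mulr_gt0 //.
apply: (le_trans (chi_small_sum H (F := a) (f := fun n => n%:R) a2 (ltW a0) _ _)).
- by move=> n _; rewrite ler_nat.
- move=> A1; rewrite !normr_nat; split => //.
rewrite /err le_eqVlt; apply/orP; left; apply/eqP; field; rewrite !gt_eqF //.
Qed.

Lemma Lval_le {R : realType} K P (chi : nat -> R) delta D li (H : setting K P chi delta D li)
   (a tau : R) : 2 <= a -> `|tau| <= 3 * K ^+ 2 * (D a / ln a) ->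
  `|Lpart chi a + tau| <= 14 * K ^+ 2 * (D a / (2 * ln a)).
Proof.
move=> a2 ht; have la : 0 < ln a by rewrite ln_gt0; lra.
apply: (le_trans (ler_normD _ _)).
have h : 8 * K ^+ 2 * (delta a / (2 * ln a)) <= 8 * K ^+ 2 * (D a / (2 * ln a)).
  apply: ler_wpM2l; first by rewrite mulr_ge0 ?sqr_ge0.
  by apply: ler_wpM2r; [rewrite invr_ge0; lra | exact: (st_dD H)].
have e : 3 * K ^+ 2 * (D a / ln a) = 6 * K ^+ 2 * (D a / (2 * ln a)) by field; rewrite gt_eqF.
have := Lpart_le H a2; lra.
Qed.

(** No cancellation is used. Chebyshev's bound handles [p <= a]; for [a < p <= b] the inequality
    [1 / p <= X / (p (X - ln p))] leads back to the weighted Mertens sum. *)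
Lemma Lmain_le {R : realType} K P (chi : nat -> R) delta D li (H : setting K P chi delta D li)
   (a b : R) : 2 <= a -> 2 * (a * a) <= b * b -> 0 < b ->
  `|Lpart chi a + tail_sum chi a (Num.truncn b)| <= 109 * K * loglog a b.
Proof.
move=> a2 hab b0; have [ab l1 Xl il M0] := range_facts a2 hab b0.
have hV := weighted_le H a2 hab b0.
set X := 2 * ln b in Xl hV *; set l := 2 * ln a in l1 Xl il *.
have X0 : 0 < X by lra. have l0 : 0 < l by lra.
have a0 : 0 < a by lra. have K1 := st_K H.
have Aa : (Num.truncn a)%:R <= a by rewrite truncn_le ltW.
have Bb : (Num.truncn b)%:R <= b by rewrite truncn_le ltW.
have h1 : `|Lpart chi a| <= 6 * K * loglog a b.
  rewrite /Lpart normrM ger0_norm ?invr_ge0 ?mulr_ge0 ?(ltW a0) //.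
  rewrite mulrC ler_pdivrMr ?mulr_gt0 //.
  apply: (@le_trans _ _ (psum (fun n => (P n)%:R) (Num.truncn a) * a)).
    apply: (le_trans (ler_norm_sum _ _ _)); rewrite /psum mulr_suml; apply: ler_sum_nat => p /andP[_ pA].
    rewrite normrM normr_nat; apply: ler_pM => //; first exact: (st_chi H).
    by rewrite (le_trans _ Aa) // ler_nat.
  apply: (@le_trans _ _ (K * (a / ln a) * a)); first by rewrite ler_wpM2r ?(ltW a0) ?(st_cheb H).
  have -> : K * (a / ln a) * a = 2 * K * (a * a) * l^-1 by rewrite /l; field; rewrite gt_eqF //; rewrite /l in l0; lra.
  have -> : 6 * K * loglog a b * (a * a) = 2 * K * (a * a) * (3 * loglog a b) by ring.
  by apply: ler_wpM2l => //; rewrite !mulr_ge0 //; lra.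
have h2 : `|tail_sum chi a (Num.truncn b)| <= 103 * K * loglog a b.
  apply: (@le_trans _ _ (X * (103 * K * (loglog a b / X)))); last first.
    by rewrite le_eqVlt; apply/orP; left; apply/eqP; field; rewrite gt_eqF.
  apply: le_trans (ler_wpM2l (ltW X0) hV).
  rewrite mulr_sumr; apply: (le_trans (ler_norm_sum _ _ _)).
  apply: ler_sum_nat => p /andP[pa pb].
  rewrite normrM normfV normr_nat; have := st_chi H p.
  case Pp : (P p); last by rewrite mul0r mulr0 normr_le0 => /eqP ->; rewrite normr0 mul0r.
  have pa' : a < p%:R by rewrite -truncn_lt_nat // ltW.
  have pb' : p%:R <= b by rewrite (le_trans _ Bb) // ler_nat.
  have p0 : 0 < p%:R :> R by lra.
  have lpb : ln p%:R <= ln b by rewrite ler_ln ?posrE.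
  have lp0 : 0 <= ln p%:R :> R by clear -pa' a2; rewrite ln_ge0; lra.
  have Xp : 0 < X - ln p%:R by rewrite /X in X0 *; lra.
  move=> h; apply: (@le_trans _ _ (1 * p%:R^-1)); first by rewrite ler_wpM2r ?invr_ge0.
  rewrite !mul1r mulrCA ler_peMr ?invr_ge0 // ler_pdivlMr //; clear -lp0; lra.
apply: (le_trans (ler_normD _ _)); lra.
Qed.

(** At [r p] and at [x / p] the linear function of slope [1 / ln x] gives exactly [x / ln x] times
    the weights [p / s] and [1 / p] of [L_chi], so what remains to be estimated is the deviation
    from it. *)
Definition li_dev {R : realType} (li : R -> R) (b y : R) : R := li y - y / (2 * ln b).

(** Up to [x] the density [1 / ln v] of li is at least the slope [1 / ln x]. *)
Lemma li_dev_mono {R : realType} K P (chi : nat -> R) delta D li (H : setting K P chi delta D li)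
   (b u v : R) : 2 <= b -> 2 <= u -> u <= v -> v <= b * b ->
  li_dev li b u <= li_dev li b v.
Proof.
rewrite /li_dev => b2 u2 uv vb; have [h _] := st_li H u2 uv.
have lv : 0 < ln v by rewrite ln_gt0; lra.
have lvb : ln v <= 2 * ln b.
  have : ln v <= ln (b * b) by rewrite ler_ln ?posrE; nra.
  by rewrite lnM ?posrE; lra.
have : (v - u) / (2 * ln b) <= (v - u) / ln v.
  by apply: ler_wpM2l; [lra | rewrite lef_pV2 ?posrE //; lra].
rewrite mulrBl; lra.
Qed.

(** By monotonicity only [y = 2] and [y = z = x / a] matter. There [ln z = X - l / 2], so
    [z / ln z - z / X] gains the factor [l / X]; the error of li at [z] is [O (z / X ^ 2)], which is
    no larger since [l >= 1]. *)
Lemma li_dev_le {R : realType} K P (chi : nat -> R) delta D li (H : setting K P chi delta D li)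
   (a b y : R) : 2 <= a -> 2 * (a * a) <= b * b -> 0 < b -> 2 <= y -> y <= b * b / a ->
  `|li_dev li b y| <= 649 * (b * b / a * (2 * ln a) / (2 * ln b) ^+ 2).
Proof.
rewrite /li_dev => a2 hab b0; have [ab l1 Xl _ _] := range_facts a2 hab b0.
have b2 : 2 <= b by lra. have a0 : 0 < a by lra.
have lbb : ln b < b by apply: ln_sublinear.
have bz : b <= b * b / a by rewrite ler_pdivlMr // ler_wpM2l // ltW.
have zb : b * b / a <= b * b by rewrite ler_pdivrMr // ler_peMr ?mulr_ge0 //; lra.
have lz : ln (b * b / a) = 2 * ln b - (2 * ln a) / 2.
  by rewrite ln_div ?posrE ?mulr_gt0 // lnM ?posrE //; lra.
have mono u v := @li_dev_mono R K P chi delta D li H b u v b2.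
rewrite /li_dev in mono.
move: (b * b / a) bz zb lz => z bz zb lz.
have Xb : 2 * ln b <= 2 * b by lra.
move: (2 * ln b) (2 * ln a) lz l1 Xl Xb mono => X l lz l1 Xl Xb mono y2 yz.
have lX : l <= X by clear -Xl; lra.
have l0 : 0 < l by clear -l1; lra. have X0 : 0 < X by clear -l0 lX; lra.
have z2 : 2 <= z by exact: le_trans bz. have z0 : 0 < z by exact: lt_le_trans bz.
have lz0 : 0 < ln z by clear -lz lX X0; lra.
have := li_asymp (st_li2 H) (st_li H) z2; rewrite ler_norml => /andP[_ h].
have m1 := mono y z y2 yz zb; have m2 := mono 2 y (lexx 2) y2 (le_trans yz zb).
rewrite (st_li2 H) in m2.
have X20 : 0 < X ^+ 2 by rewrite exprn_gt0.
have h1 : 162 * z / ln z ^+ 2 <= 648 * (z * l / X ^+ 2).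
  have q : (X / 2) * (X / 2) <= ln z * ln z by clear -lz lX X0; apply: ler_pM; lra.
  rewrite ler_pdivrMr ?exprn_gt0 // mulrA mulrAC ler_pdivlMr // !expr2.
  have : 162 * z * (4 * ((X / 2) * (X / 2))) <= 162 * z * (4 * (l * (ln z * ln z))).
    have c0 : 0 < 162 * z := mulr_gt0 (ltr0Sn _ _) z0.
    rewrite (ler_pM2l c0) ler_pM2l //.
    have p : 0 <= ln z * ln z by rewrite mulr_ge0 // ltW.
    by apply: (le_trans q); rewrite ler_peMl.
  clear; lra.
have h2 : z / ln z - z / X <= z * l / X ^+ 2.
  have -> : z / ln z - z / X = z * (X - ln z) / X * (ln z)^-1 by field; rewrite !gt_eqF.
  have -> : z * l / X ^+ 2 = z * (X - ln z) / X * (X / 2)^-1 by rewrite lz; field; rewrite gt_eqF.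
  clear -lz lX X0 l0 z0 lz0; apply: ler_wpM2l; last by rewrite lef_pV2 ?posrE; lra.
  by apply: divr_ge0; [apply: mulr_ge0 => // |]; lra.
have h3 : 2 / X <= 649 * (z * l / X ^+ 2).
  have -> : 2 / X = 2 * X / X ^+ 2 by field; rewrite gt_eqF.
  rewrite [leRHS]mulrA ler_pM2r ?invr_gt0 //.
  have : b * 1 <= z * l by apply: ler_pM => //; exact: ltW.
  clear -Xb b0; lra.
rewrite ler_norml; apply/andP; split; first by clear -m2 h3; lra.
by apply: (le_trans m1); move: (z / ln z) (z / X) (_ / X ^+ 2) (_ / ln z ^+ 2) h h1 h2; clear => *; lra.
Qed.


(** The factor [l] of the deviation cancels the denominator [ln a] of [err delta a], leaving
    [1298 = 2 * 649]. *)
Lemma err_li_dev {R : realType} K P (chi : nat -> R) delta D li (H : setting K P chi delta D li)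
   (a b y : R) : 2 <= a -> 2 * (a * a) <= b * b -> 0 < b -> 2 <= y -> y <= b * b / a ->
  err delta a * `|li_dev li b y| <= 1300 * (b * b / (2 * ln b) ^+ 2 * D a).
Proof.
move=> a2 hab b0 y2 yz; have [ab l1 Xl _ _] := range_facts a2 hab b0.
have h := li_dev_le H a2 hab b0 y2 yz.
have e0 := err_ge0 H a2; have a0 : 0 < a by lra.
have la : 0 < ln a by lra. have lb : 0 < ln b by lra.
apply: (le_trans (ler_wpM2l e0 h)).
have -> : err delta a * (649 * (b * b / a * (2 * ln a) / (2 * ln b) ^+ 2)) =
   1298 * (b * b / (2 * ln b) ^+ 2 * delta a) by rewrite /err; field; rewrite !gt_eqF.
have dD := st_dD H a2.
apply: ler_pM; [lra| |lra|].
  by apply: mulr_ge0; [apply: divr_ge0; [apply: mulr_ge0; apply: ltW | apply: sqr_ge0] | exact: (st_d0 H)].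
apply: ler_wpM2l => //.
by apply: divr_ge0; [apply: mulr_ge0; apply: ltW | apply: sqr_ge0].
Qed.

Lemma chi_li_small {R : realType} K P (chi : nat -> R) delta D li (H : setting K P chi delta D li)
   (a b : R) : 2 <= a -> 2 * (a * a) <= b * b -> 0 < b ->
  `|\sum_(0 <= p < (Num.truncn a).+1) chi p * li_dev li b (b * b / (a * a) * p%:R)|
    <= 4 * 1300 * K ^+ 2 * (b * b / (2 * ln b) ^+ 2 * D a).
Proof.
move=> a2 hab b0; have [ab l1 Xl _ _] := range_facts a2 hab b0.
have a0 : 0 < a by lra. have b2 : 2 <= b by lra.
have aa0 : 0 < a * a by rewrite mulr_gt0.
have Aa : (Num.truncn a)%:R <= a by rewrite truncn_le ltW.
have A2 : (2 <= Num.truncn a)%N by rewrite truncn_ge_nat // ltW.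
have zb : b * b / a <= b * b by rewrite ler_pdivrMr // ler_peMr ?mulr_ge0 //; lra.
have r2 : 2 <= b * b / (a * a) by rewrite ler_pdivlMr.
have rb : b * b / (a * a) * a = b * b / a by field; rewrite gt_eqF.
have r0 : 0 <= b * b / (a * a) by lra.
have mon (m n : nat) : (m <= n)%N -> b * b / (a * a) * m%:R <= b * b / (a * a) * n%:R.
  by move=> mn; rewrite ler_wpM2l ?ler_nat.
have ub (n : nat) : (n <= Num.truncn a)%N -> b * b / (a * a) * n%:R <= b * b / a.
  by move=> nA; rewrite -rb ler_wpM2l // (le_trans _ Aa) // ler_nat.
have lb (n : nat) : (0 < n)%N -> 2 <= b * b / (a * a) * n%:R.
  move=> n0; have : 1 <= n%:R :> R by rewrite ler1n.
  clear -r2; move: (b * b / (a * a)) r2 => r r2; nra.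
have e0 : 0 < err delta a.
  by apply: lt_le_trans (st_low H a2); rewrite invr_gt0; have := st_K H; lra.
(* [err_li_dev] divided by [err delta a], which is positive by [st_low]: the Abel summation
   multiplies this bound on the weights by [err delta a] again. *)
pose Phi := 1300 * (b * b / (2 * ln b) ^+ 2 * D a) / err delta a.
have FP y : 2 <= y -> y <= b * b / a -> `|li_dev li b y| <= Phi.
  by move=> y2 yz; rewrite /Phi ler_pdivlMr // mulrC; apply: (err_li_dev H).
have Phi0 : 0 <= Phi by apply: le_trans (FP _ (lb 1%N isT) (ub 1%N _)); rewrite ?normr_ge0 // ltnW.
apply: (@le_trans _ _ (4 * (K ^+ 2 * err delta a) * Phi)).
  apply: (chi_small_sum H (f := fun n => li_dev li b (b * b / (a * a) * n%:R)) a2 Phi0).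
    move=> n /andP[n1 nA]; apply: (li_dev_mono H) => //; [by apply: lb; apply: ltnW|exact: mon|].
    by apply: le_trans zb; apply: ub.
  by move=> _; split; apply: FP; [exact: lb|exact: ub|apply: lb; exact: ltnW|exact: ub].
rewrite /Phi le_eqVlt; apply/orP; left; apply/eqP; field.
by rewrite !gt_eqF //; lra.
Qed.

(** The slope of [li_dev] at [x / n] is [1 / (X - ln n) - 1 / X = O (ln n / X ^ 2)]; this [ln n]
    cancels the one in [err delta n] and leaves the summand of [st_D]. *)
Lemma li_dev_step {R : realType} K P (chi : nat -> R) delta D li (H : setting K P chi delta D li)
   (b : R) (n : nat) : (2 <= n)%N -> n.+1%:R <= b ->
  K * err delta n%:R * `|li_dev li b (b * b / n%:R) - li_dev li b (b * b / n.+1%:R)|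
   <= 4 * K * (b * b / (2 * ln b) ^+ 2) * (delta n%:R / n%:R).
Proof.
move=> n2 nb.
have n2R : 2 <= n%:R :> R by rewrite ler_nat.
have e1 : n.+1%:R = n%:R + 1 :> R by rewrite natr1.
have d0 := st_d0 H n2R; have E0 := err_ge0 H n2R; have K1 := st_K H.
have n0 : 0 < n%:R :> R by lra. have n10 : 0 < n.+1%:R :> R by lra.
have lnn : 0 < ln n%:R :> R by rewrite ln_gt0; lra.
have ln1b : ln n.+1%:R <= ln b by rewrite ler_ln ?posrE; lra.
have ln1n : ln n.+1%:R <= 2 * ln n%:R :> R.
  have : ln n.+1%:R <= ln (n%:R * n%:R) :> R by rewrite ler_ln ?posrE ?mulr_gt0 // e1; nra.
  by rewrite lnM ?posrE //; lra.
have lnn1 : ln n%:R <= ln n.+1%:R :> R by rewrite ler_ln ?posrE; lra.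
have b0 : 0 < b by lra. have bb0 : 0 < b * b by rewrite mulr_gt0.
have b2 : 2 <= b by lra.
have lu : ln (b * b / n.+1%:R) = 2 * ln b - ln n.+1%:R.
  by rewrite ln_div ?posrE // lnM ?posrE //; lra.
have uv : b * b / n.+1%:R <= b * b / n%:R.
  by rewrite ler_wpM2l ?(ltW bb0) // lef_pV2 ?posrE // e1; lra.
have u2 : 2 <= b * b / n.+1%:R.
  by rewrite ler_pdivlMr //; apply: (@le_trans _ _ (2 * b)); [lra | rewrite ler_pM2r].
have vb : b * b / n%:R <= b * b by rewrite ler_pdivrMr ?ler_peMr ?(ltW bb0) //; lra.
have m := li_dev_mono H b2 u2 uv vb.
have [_ h] := st_li H u2 uv.
have vu : b * b / n%:R - b * b / n.+1%:R <= b * b / (n%:R * n%:R).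
  have -> : b * b / n%:R - b * b / n.+1%:R = b * b * (n%:R * n.+1%:R)^-1.
    by rewrite e1; field; rewrite !gt_eqF //; lra.
  have q : n%:R * n%:R <= n%:R * n.+1%:R :> R by apply: ler_wpM2l; [exact: ltW | rewrite ler_nat].
  by rewrite ler_wpM2l ?(ltW bb0) // lef_pV2 ?posrE //; apply: mulr_gt0.
have w0 : 0 <= b * b / n%:R - b * b / n.+1%:R by rewrite subr_ge0.
rewrite ger0_norm ?subr_ge0 //.
have hF : li_dev li b (b * b / n%:R) - li_dev li b (b * b / n.+1%:R) <=
    b * b / (n%:R * n%:R) * (4 * ln n%:R / (2 * ln b) ^+ 2).
  rewrite /li_dev; move: h vu w0; rewrite lu.
  have lb0 : 0 < 2 * ln b by lra.
  have h2 : ln n.+1%:R <= (2 * ln b) / 2 by lra.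
  move: (b * b / n%:R) (b * b / n.+1%:R) (b * b / (n%:R * n%:R)) (ln n%:R) (ln n.+1%:R) (2 * ln b) lnn ln1n lnn1 lb0 h2.
  clear; move=> v u w p q X p0 qp pq X0 qX h vu w0.
  (* Here [p] and [q] are the logarithms of [n] and [n.+1]. The fraction is [1 / (X - q) - 1 / X],
     bounded by [q <= 2 * p] and [X - q >= X / 2]. *)
  apply: (@le_trans _ _ ((v - u) * (q / (X * (X - q))))).
    have -> : (v - u) * (q / (X * (X - q))) = (v - u) / (X - q) - (v / X - u / X).
      by field; rewrite !gt_eqF //; lra.
    lra.
  apply: ler_pM => //; first by rewrite divr_ge0 ?mulr_ge0 //; lra.
  have -> : 4 * p / X ^+ 2 = 2 * p * (X * (X / 2))^-1 by field; rewrite gt_eqF.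
  have xx : X * (X / 2) <= X * (X - q) by apply: ler_wpM2l; lra.
  apply: ler_pM => //; first by lra.
    by rewrite invr_ge0 mulr_ge0; lra.
  by rewrite lef_pV2 ?posrE //; apply: mulr_gt0; lra.
apply: (@le_trans _ _ (K * err delta n%:R * (b * b / (n%:R * n%:R) * (4 * ln n%:R / (2 * ln b) ^+ 2)))).
  apply: (ler_wpM2l _ hF); apply: (mulr_ge0 _ E0); exact: le_trans ler01 K1.
have lb0 : 0 < ln b by clear -ln1b lnn1 lnn; lra.
by rewrite /err le_eqVlt; apply/orP; left; apply/eqP; field; rewrite !gt_eqF.
Qed.

Lemma li_dev_end {R : realType} K P (chi : nat -> R) delta D li (H : setting K P chi delta D li)
   (b : R) : 2 <= b ->
  K * err delta (Num.truncn b)%:R * `|li_dev li b (b * b / (Num.truncn b)%:R)|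
   <= 3250 * K ^+ 2 * (b * b / (2 * ln b) ^+ 2 * delta b).
Proof.
move=> b2; have b0 : 0 < b by lra. have K1 := st_K H.
have Bb : (Num.truncn b)%:R <= b by rewrite truncn_le ltW.
have B2 : 2 <= (Num.truncn b)%:R :> R by rewrite ler_nat truncn_ge_nat // ltW.
have bB : b <= 2 * (Num.truncn b)%:R.
  have := truncnS_gt b; rewrite -natr1; lra.
have m := st_mono H B2 Bb; have E0 := err_ge0 H B2; have E0' := err_ge0 H b2.
move: (Num.truncn b)%:R Bb B2 bB m E0 => B Bb B2 bB m E0.
have B0 : 0 < B by lra.
have yb : b <= b * b / B by rewrite ler_pdivlMr // ler_wpM2l // ltW.
have y2b : b * b / B <= 2 * b by rewrite ler_pdivrMr // mulrAC ler_wpM2r // ltW.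
have lb : 0 < ln b by rewrite ln_gt0; lra.
have Fy : `|li_dev li b (b * b / B)| <= 1625 * (b / (2 * ln b)).
  move: (b * b / B) yb y2b => y yb y2b; have y2 : 2 <= y by lra.
  have u1 := li_le H y2; have u2 := li_ge0 H y2.
  have ly : ln b <= ln y by rewrite ler_ln ?posrE //; lra.
  have u3 : y / ln y <= 4 * (b / (2 * ln b)).
    have -> : 4 * (b / (2 * ln b)) = 2 * b / ln b by field; rewrite gt_eqF.
    clear -y2 lb ly y2b; apply: ler_pM; [lra|rewrite invr_ge0; lra|lra|rewrite lef_pV2 ?posrE //; lra].
  have u4 : y / (2 * ln b) <= 2 * (b / (2 * ln b)).
    by rewrite mulrA ler_wpM2r // invr_ge0; lra.
  have u5 : 0 <= y / (2 * ln b) by clear -y2 lb; rewrite divr_ge0; lra.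
  have u6 : 0 <= b / (2 * ln b) by clear -b0 lb; rewrite divr_ge0; lra.
  rewrite /li_dev; move: u1 u2 u3 u4 u5 u6; clear.
  move: (li y) (y / ln y) (y / (2 * ln b)) (b / (2 * ln b)) => A1 A2 A3 A4 *.
  by rewrite ler_norml; apply/andP; split; lra.
apply: (@le_trans _ _ (K * (K * err delta b) * (1625 * (b / (2 * ln b))))).
  have K0 : 0 <= K by exact: le_trans ler01 K1.
  by apply: ler_pM => //; [apply: mulr_ge0 | apply: ler_wpM2l].
by rewrite /err le_eqVlt; apply/orP; left; apply/eqP; field; rewrite gt_eqF.
Qed.

Lemma chi_li_large {R : realType} K P (chi : nat -> R) delta D li (H : setting K P chi delta D li)
   (a b : R) : 2 <= a -> 2 * (a * a) <= b * b -> 0 < b ->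
  `|\sum_((Num.truncn a).+1 <= p < (Num.truncn b).+1) chi p * li_dev li b (b * b / p%:R)|
    <= (3250 + 1300 + 4) * K ^+ 3 * (b * b / (2 * ln b) ^+ 2 * D a).
Proof.
move=> a2 hab b0; have [ab l1 Xl _ _] := range_facts a2 hab b0.
have b2 : 2 <= b by lra. have a0 : 0 < a by lra. have K1 := st_K H.
have da := st_dD H a2; have d0 := st_d0 H a2.
have Aa : (Num.truncn a)%:R <= a by rewrite truncn_le ltW.
have Bb : (Num.truncn b)%:R <= b by rewrite truncn_le ltW.
have A2 : (2 <= Num.truncn a)%N by rewrite truncn_ge_nat // ltW.
have A2R : 2 <= (Num.truncn a)%:R :> R by rewrite ler_nat.
have AB : (Num.truncn a <= Num.truncn b)%N by apply: le_truncn.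
have Q0 : 0 <= b * b / (2 * ln b) ^+ 2 by rewrite divr_ge0 ?sqr_ge0 // mulr_ge0 // ltW.
have W0 : 0 <= b * b / (2 * ln b) ^+ 2 * D a by apply: (mulr_ge0 Q0); exact: le_trans da.
have k3 : 0 <= K ^+ 3 by rewrite exprn_ge0; lra.
have k23 : K ^+ 2 <= K ^+ 3 by rewrite [leRHS]exprS ler_peMl // sqr_ge0.
move: AB; rewrite leq_eqVlt => /orP[/eqP ->|AB].
  rewrite big_geq // normr0; apply: (mulr_ge0 (mulr_ge0 _ k3) W0); lra.
have -> : \sum_((Num.truncn a).+1 <= p < (Num.truncn b).+1) chi p * li_dev li b (b * b / p%:R) =
   \sum_((Num.truncn a).+1 <= n < (Num.truncn b).+1) (psum chi n - psum chi n.-1) * li_dev li b (b * b / n%:R).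
  by apply: eq_big_nat => -[|n] // _; rewrite psumS addrAC subrr add0r.
apply: (le_trans (@abel_bound R (psum chi) (fun n => li_dev li b (b * b / n%:R)) (fun n => K * err delta n%:R) _ _ AB _)).
  move=> n /andP[An _]; rewrite -{1}psum_nat; apply: (st_Pi H).
  by rewrite ler_nat (leq_trans A2).
have j1 : K * err delta (Num.truncn b)%:R * `|li_dev li b (b * b / (Num.truncn b)%:R)|
    <= 3250 * K ^+ 3 * (b * b / (2 * ln b) ^+ 2 * D a).
  apply: (le_trans (li_dev_end H b2)).
  have -> : 3250 * K ^+ 3 * (b * b / (2 * ln b) ^+ 2 * D a) =
     3250 * K ^+ 2 * (b * b / (2 * ln b) ^+ 2 * (K * D a)) by ring.
  apply: ler_wpM2l; first exact: (mulr_ge0 (ler0n _ _) (sqr_ge0 K)).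
  apply: ler_wpM2l => //; apply: le_trans (err_large H a2 ab) _.
  by apply: ler_wpM2l => //; lra.
have j2 : K * err delta (Num.truncn a)%:R * `|li_dev li b (b * b / (Num.truncn a).+1%:R)|
    <= 1300 * K ^+ 3 * (b * b / (2 * ln b) ^+ 2 * D a).
  have q1 : a < (Num.truncn a).+1%:R by apply: truncnS_gt.
  have q2 : (Num.truncn a).+1%:R <= b by rewrite (le_trans _ Bb) // ler_nat.
  have y2 : 2 <= b * b / (Num.truncn a).+1%:R.
    by rewrite ler_pdivlMr //; apply: ler_pM => //; lra.
  have yz : b * b / (Num.truncn a).+1%:R <= b * b / a.
    by rewrite ler_wpM2l ?mulr_ge0 ?(ltW b0) // lef_pV2 ?posrE // ltW.
  apply: (@le_trans _ _ (K * (K * err delta a) * `|li_dev li b (b * b / (Num.truncn a).+1%:R)|)).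
    apply: ler_wpM2r => //; apply: (ler_wpM2l (le_trans ler01 K1)).
    exact: (st_mono H).
  have -> : K * (K * err delta a) * `|li_dev li b (b * b / (Num.truncn a).+1%:R)| =
    K ^+ 2 * (err delta a * `|li_dev li b (b * b / (Num.truncn a).+1%:R)|) by ring.
  have h := err_li_dev H a2 hab b0 y2 yz.
  apply: (le_trans (ler_wpM2l (sqr_ge0 K) h)).
  have -> : 1300 * K ^+ 3 * (b * b / (2 * ln b) ^+ 2 * D a) =
     K ^+ 3 * (1300 * (b * b / (2 * ln b) ^+ 2 * D a)) by ring.
  exact: (ler_wpM2r (mulr_ge0 (ler0n _ _) W0) k23).
have j3 : \sum_((Num.truncn a).+1 <= n < Num.truncn b) K * err delta n%:R *
    `|li_dev li b (b * b / n%:R) - li_dev li b (b * b / n.+1%:R)| <= 4 * K ^+ 3 * (b * b / (2 * ln b) ^+ 2 * D a).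
  apply: (@le_trans _ _ (4 * K * (b * b / (2 * ln b) ^+ 2) * \sum_((Num.truncn a).+1 <= n < (Num.truncn b).+1) delta n%:R / n%:R)); last first.
    apply: (@le_trans _ _ (4 * K * (b * b / (2 * ln b) ^+ 2) * (K * D a))).
      apply: ler_wpM2l; last exact: (st_D H).
      by clear -K1 Q0; apply: (mulr_ge0 _ Q0); lra.
    have -> : 4 * K * (b * b / (2 * ln b) ^+ 2) * (K * D a) = 4 * K ^+ 2 * (b * b / (2 * ln b) ^+ 2 * D a) by ring.
    by apply: (ler_wpM2r W0); apply: (ler_wpM2l (ler0n _ _)).
  rewrite big_nat_recr //= mulrDr mulr_sumr -[leLHS]addr0; apply: lerD; last first.
    have Ba : 2 <= (Num.truncn b)%:R :> R by rewrite ler_nat (leq_trans A2) // ltnW.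
    apply: mulr_ge0; first by clear -K1 Q0; apply: (mulr_ge0 _ Q0); lra.
    by apply: divr_ge0 => //; apply: (st_d0 H).
  apply: ler_sum_nat => n /andP[An nB]; apply: (li_dev_step H).
    by apply: leq_trans A2 _; exact: ltnW.
  by rewrite (le_trans _ Bb) // ler_nat.
have e (c1 c2 c3 k w : R) : (c1 + c2 + c3) * k * w = c1 * k * w + c2 * k * w + c3 * k * w by ring.
rewrite e; exact: lerD (lerD j1 j2) j3.
Qed.

(** [tau] stands for the infinite tail. It is only required to differ from the finite sum up to [b]
    by the tail bound at [b], so that no limit enters here. *)
Lemma chi_li_sum {R : realType} K P (chi : nat -> R) delta D li (H : setting K P chi delta D li)
   (a b tau : R) : 2 <= a -> 2 * (a * a) <= b * b -> 0 < b ->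
  `|tau - tail_sum chi a (Num.truncn b)| <= 3 * K ^+ 2 * (D b / ln b) ->
  `|\sum_(0 <= p < (Num.truncn b).+1) chi p * li (q_bound a b p)
    - b * b / (2 * ln b) * (Lpart chi a + tau)|
   <= 10 * 1000 * K ^+ 3 * (b * b / (2 * ln b) ^+ 2 * D a).
Proof.
move=> a2 hab b0 htau; have [ab l1 Xl _ _] := range_facts a2 hab b0.
have b2 : 2 <= b by exact: le_trans ab. have a0 : 0 < a by exact: lt_le_trans a2.
have K1 := st_K H.
have lb : 0 < ln b by clear -l1 Xl; lra.
have p1 := chi_li_small H a2 hab b0; have p2 := chi_li_large H a2 hab b0.
have aa0 : 0 < a * a by rewrite mulr_gt0.
have da := st_dD H a2; have d0 := st_d0 H a2; have Db := st_Dm H a2 ab.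
have Aa : (Num.truncn a)%:R <= a by rewrite truncn_le ltW.
have AB : (Num.truncn a <= Num.truncn b)%N by apply: le_truncn.
have Q0 : 0 <= b * b / (2 * ln b) ^+ 2 by rewrite divr_ge0 ?sqr_ge0 // mulr_ge0 // ltW.
have W0 : 0 <= b * b / (2 * ln b) ^+ 2 * D a by rewrite mulr_ge0 //; exact: le_trans da.
have k23 : K ^+ 2 <= K ^+ 3 by rewrite [leRHS]exprS ler_peMl // sqr_ge0.
have p3 : `|b * b / (2 * ln b) * (tau - tail_sum chi a (Num.truncn b))| <= 6 * K ^+ 3 * (b * b / (2 * ln b) ^+ 2 * D a).
  have bX : 0 <= b * b / (2 * ln b) by rewrite divr_ge0 ?mulr_ge0 ?(ltW b0) // ltW.
  rewrite normrM ger0_norm //.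
  apply: (le_trans (ler_wpM2l bX htau)).
  have -> : b * b / (2 * ln b) * (3 * K ^+ 2 * (D b / ln b)) = 6 * K ^+ 2 * (b * b / (2 * ln b) ^+ 2) * D b by field; rewrite gt_eqF.
  have -> : 6 * K ^+ 3 * (b * b / (2 * ln b) ^+ 2 * D a) = 6 * K ^+ 2 * (b * b / (2 * ln b) ^+ 2) * (K * D a) by ring.
  by apply: (ler_wpM2l _ Db); exact: (mulr_ge0 (mulr_ge0 (ler0n _ _) (sqr_ge0 K)) Q0).
have -> : \sum_(0 <= p < (Num.truncn b).+1) chi p * li (q_bound a b p) - b * b / (2 * ln b) * (Lpart chi a + tau) =
  \sum_(0 <= p < (Num.truncn a).+1) chi p * li_dev li b (b * b / (a * a) * p%:R)
  + \sum_((Num.truncn a).+1 <= p < (Num.truncn b).+1) chi p * li_dev li b (b * b / p%:R)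
  - b * b / (2 * ln b) * (tau - tail_sum chi a (Num.truncn b)).
  rewrite (@big_cat_nat _ _ _ (Num.truncn a).+1 0 (Num.truncn b).+1 xpredT (fun p => chi p * li (q_bound a b p))) //=.
  have -> : \sum_(0 <= p < (Num.truncn a).+1) chi p * li (q_bound a b p) =
    \sum_(0 <= p < (Num.truncn a).+1) chi p * li_dev li b (b * b / (a * a) * p%:R) + b * b / (2 * ln b) * Lpart chi a.
    rewrite /Lpart !mulr_sumr -big_split /=; apply: eq_big_nat => p /andP[_ pA].
    have pa : p%:R <= a by rewrite (le_trans _ Aa) // ler_nat.
    by rewrite /q_bound pa /li_dev; field; rewrite !gt_eqF.
  have -> : \sum_((Num.truncn a).+1 <= p < (Num.truncn b).+1) chi p * li (q_bound a b p) =
    \sum_((Num.truncn a).+1 <= p < (Num.truncn b).+1) chi p * li_dev li b (b * b / p%:R) + b * b / (2 * ln b) * tail_sum chi a (Num.truncn b).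
    rewrite /tail_sum !mulr_sumr -big_split /=; apply: eq_big_nat => p /andP[pA _].
    have pa : a < p%:R by rewrite -truncn_lt_nat // ltW.
    have npa : (p%:R <= a) = false by rewrite leNgt pa.
    by rewrite /q_bound npa /li_dev; field; rewrite !gt_eqF // (lt_trans a0).
  ring.
apply: (le_trans (ler_normB _ _)).
have := ler_normD (\sum_(0 <= p < (Num.truncn a).+1) chi p * li_dev li b (b * b / (a * a) * p%:R)) (\sum_((Num.truncn a).+1 <= p < (Num.truncn b).+1) chi p * li_dev li b (b * b / p%:R)).
have k2 := ler_wpM2r W0 k23.
have k3 : 0 <= K ^+ 2 * (b * b / (2 * ln b) ^+ 2 * D a) by rewrite mulr_ge0 ?sqr_ge0.
move: p1 p2 p3 k2 k3; clear.
move: (b * b / (2 * ln b) ^+ 2 * D a) (`|_ + _|) (`|\sum_(0 <= _ < _) _|) (`|\sum_(_.+1 <= _ < _) _|) (`|_ * (_ - _)|) => W t1 t2 t3 t4.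
rewrite -!mulrA; move: (K ^+ 2 * W) (K ^+ 3 * W) => k2 k3 *; lra.
Qed.

(** * The ratio of the two counts *)

(** [e1] is [e] clipped to [[-A, A]]. This separates the part of the error of [N] that [delta]
    controls from the other part. *)
Lemma norm_split {R : realType} (e A B : R) : 0 <= A -> 0 <= B -> `|e| <= A + B ->
  exists e1 e2, [/\ e = e1 + e2, `|e1| <= A & `|e2| <= B].
Proof.
move=> A0 B0; rewrite ler_norml => /andP[h1 h2].
have [h|h] := leP e (- A).
  exists (- A), (e + A); split; first by ring.
    by rewrite normrN ger0_norm.
  by rewrite ler_norml; apply/andP; split; lra.
have [h'|h'] := leP e A.
  exists e, 0; split; [ring | by rewrite ler_norml; apply/andP; split; lra | by rewrite normr0].
exists A, (e - A); split; first by ring.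
  by rewrite ger0_norm.
by rewrite ler_norml; apply/andP; split; lra.
Qed.

(** The part [kappa] of the relative error of [N] that [delta] does not control
    is of order [1 / (M l)].  Multiplied by [L] it is charged to [e1] when
    [M l] is large, and to [e2], through [|L| <= kL * D / l], otherwise. *)
Lemma ratio_expand {R : realType} (k1 k2 cN kg kh ks kL N N0 M l X L g h S1 S2 eta d D : R) :
  0 <= k1 -> 0 <= k2 -> 0 <= cN -> 0 <= kg -> 0 <= kh -> 0 <= ks -> 0 <= kL ->
  0 < N -> 0 < N0 -> 0 < M -> 0 < l -> 1 < X -> 0 <= d -> d <= 1 -> 0 <= D ->
  N0 <= cN * N -> `|N - N0| <= k1 * d * N0 + k2 * (N0 / (M * l)) ->
  S1 = N0 / M * (L + g) + h -> `|g| <= kg * (D / X) -> `|h| <= kh * d * N0 ->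
  `|S1| <= 2 * N -> `|S2| <= ks * d * N0 -> `|L| <= kL * (D / l) ->
  l^-1 <= 3 * M -> `|eta| = 1 ->
  ln X / 2 <= M * l \/ X / 8 <= M * l ^+ 2 ->
  let C := 2 * (k2 * cN) + kg * (1 + 3 * (k2 * cN)) + 8 * (kL * (k2 * cN))
           + (kh * cN + (2 + kh * cN) * k1 + ks * cN) in
  exists e1 e2 e3, [/\ `|e1| <= C / ln X, `|e2| <= C * D / X, `|e3| <= C * d &
    1 + eta * S1 / N + S2 / N = 1 + eta / M * (L * (1 + e1) + e2) + e3].
Proof.
move=> k10 k20 cN0 kg0 kh0 ks0 kL0 N_gt0 N0_gt0 M0 l0 X1 d0 d1 D0 hN hNN0 hS1 hg hh hS1' hS2 hL hl heta hdich C.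
have Ml0 : 0 < M * l by apply: mulr_gt0.
have X0 : 0 < X by exact: lt_trans ltr01 X1. have lX0 : 0 < ln X by apply: ln_gt0.
have [|||eps1 [eps2 [Ne h1 h2]]] := @norm_split R (N - N0) (k1 * d * N0) (k2 * (N0 / (M * l))) => //.
- by rewrite !mulr_ge0 // ltW.
- by rewrite mulr_ge0 // divr_ge0 // ltW.
pose kappa := eps2 / N.
have N0N : N0 / N <= cN by rewrite ler_pdivrMr.
have kap : `|kappa| <= k2 * cN * (M * l)^-1.
  rewrite /kappa normrM normfV (gtr0_norm N_gt0).
  apply: (@le_trans _ _ (k2 * (N0 / (M * l)) / N)).
    by apply: ler_wpM2r h2; rewrite invr_ge0 ltW.
  have -> : k2 * (N0 / (M * l)) / N = k2 * (N0 / N) * (M * l)^-1 by ring.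
  apply: ler_wpM2r; first by rewrite invr_ge0 ltW.
  exact: ler_wpM2l.
have Ml3 : (M * l)^-1 <= 3.
  by rewrite invfM mulrC ler_pdivrMr.
have kc0 : 0 <= k2 * cN by apply: mulr_ge0.
have kap3 : `|kappa| <= 3 * (k2 * cN).
  by apply: (le_trans kap); rewrite [leRHS]mulrC; apply: ler_wpM2l.
have hg2 : `|g * (1 - kappa)| <= kg * (1 + 3 * (k2 * cN)) * (D / X).
  rewrite normrM; have -> : kg * (1 + 3 * (k2 * cN)) * (D / X) = kg * (D / X) * (1 + 3 * (k2 * cN)) by ring.
  apply: ler_pM => //; apply: (le_trans (ler_normB _ _)); rewrite normr1; clear -kap3; lra.
(* The expansion is exact: [N0 / N = 1 - kappa - eps1 / N]. The remainder [r] collects what [delta]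
   controls. *)
pose r := h / N - (S1 - h) / N0 * (eps1 / N).
have expand : S1 / N = M^-1 * ((L + g) * (1 - kappa)) + r.
  have -> : S1 / N = (S1 - h) / N + h / N by rewrite -mulrDl subrK.
  have e : M^-1 * (L + g) = (S1 - h) / N0 by rewrite hS1; field; rewrite !gt_eqF.
  rewrite mulrA e /r /kappa.
  have -> : eps1 = N - N0 - eps2 by rewrite Ne; ring.
  by field; rewrite !gt_eqF.
have hr : `|r| <= (kh * cN + (2 + kh * cN) * k1) * d.
  apply: (le_trans (ler_normB _ _)); rewrite [leRHS]mulrDl; apply: lerD.
    rewrite normrM normfV (gtr0_norm N_gt0).
    apply: (@le_trans _ _ (kh * d * N0 / N)); first by apply: ler_wpM2r hh; rewrite invr_ge0 ltW.
    have -> : kh * d * N0 / N = kh * d * (N0 / N) by ring.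
    have -> : kh * cN * d = kh * d * cN by ring.
    by apply: ler_wpM2l => //; apply: mulr_ge0.
  rewrite !normrM !normfV (gtr0_norm N_gt0) (gtr0_norm N0_gt0).
  (* The trivial bound [|S1| <= 2 * N] keeps the size of [L] out of the remainder. *)
  have sh : `|S1 - h| <= (2 + kh * cN) * N.
    apply: (le_trans (ler_normB _ _)); rewrite [leRHS]mulrDl; apply: lerD => //.
    apply: (le_trans hh); rewrite -!mulrA; apply: ler_wpM2l => //.
    by apply: le_trans hN; rewrite ler_piMl // ltW.
  have -> : (2 + kh * cN) * k1 * d = (2 + kh * cN) * N / N0 * (k1 * d * N0 / N) by field; rewrite !gt_eqF.
  by apply: ler_pM; rewrite ?mulr_ge0 ?invr_ge0 ?(ltW N_gt0) ?(ltW N0_gt0) //; apply: ler_wpM2r => //; rewrite invr_ge0 ltW.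
have hS2N : `|S2 / N| <= ks * cN * d.
  rewrite normrM normfV (gtr0_norm N_gt0).
  apply: (@le_trans _ _ (ks * d * N0 / N)); first by apply: ler_wpM2r hS2; rewrite invr_ge0 ltW.
  have -> : ks * d * N0 / N = ks * d * (N0 / N) by ring.
  have -> : ks * cN * d = ks * d * cN by ring.
  by apply: ler_wpM2l => //; apply: mulr_ge0.
pose e3 := eta * r + S2 / N.
have c0 : 0 <= kh * cN + (2 + kh * cN) * k1 + ks * cN.
  by rewrite !addr_ge0 ?mulr_ge0 // addr_ge0 // mulr_ge0.
have q1 : 0 <= 2 * (k2 * cN) by apply: mulr_ge0.
have q2 : 0 <= kg * (1 + 3 * (k2 * cN)) by clear -kg0 kc0; apply: mulr_ge0 => //; lra.
have q3 : 0 <= 8 * (kL * (k2 * cN)) by do 2?apply: mulr_ge0.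
have C0 : 0 <= C by rewrite /C; clear -c0 q1 q2 q3; lra.
have he3 : `|e3| <= C * d.
  apply: (@le_trans _ _ ((kh * cN + (2 + kh * cN) * k1 + ks * cN) * d)); last first.
    by apply: ler_wpM2r => //; rewrite /C; clear -c0 q1 q2 q3; lra.
  apply: (le_trans (ler_normD _ _)); rewrite normrM heta mul1r [leRHS]mulrDl.
  exact: lerD.
have DX0 : 0 <= D / X by apply: divr_ge0 => //; exact: ltW.
case: hdich => hdich.
  exists (- kappa), (g * (1 - kappa)), e3; split => //.
  - rewrite normrN; apply: (le_trans kap).
    have i : (M * l)^-1 <= 2 / ln X.
      have -> : 2 / ln X = (ln X / 2)^-1 by field; rewrite gt_eqF.
      by rewrite lef_pV2 ?posrE // divr_gt0.
    apply: (@le_trans _ _ (k2 * cN * (2 / ln X))); first by apply: ler_wpM2l.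
    rewrite mulrA; apply: ler_wpM2r; first by rewrite invr_ge0 ltW.
    rewrite /C; clear -c0 q1 q2 q3; lra.
  - apply: (le_trans hg2); rewrite -[leRHS]mulrA; apply: ler_wpM2r => //; rewrite /C; clear -c0 q1 q2 q3; lra.
  - rewrite -mulrA expand /e3; ring.
exists 0, (g * (1 - kappa) - L * kappa), e3; split => //.
- by rewrite normr0 divr_ge0 // ltW.
- have hLk : `|L * kappa| <= 8 * (kL * (k2 * cN)) * (D / X).
    rewrite normrM; apply: (@le_trans _ _ (kL * (D / l) * (k2 * cN * (M * l)^-1))).
      by apply: ler_pM.
    have -> : kL * (D / l) * (k2 * cN * (M * l)^-1) = kL * (k2 * cN) * D * (M * l ^+ 2)^-1 by field; rewrite !gt_eqF.
    have -> : 8 * (kL * (k2 * cN)) * (D / X) = kL * (k2 * cN) * D * (X / 8)^-1 by field; rewrite gt_eqF.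
    apply: ler_wpM2l; first by apply: mulr_ge0 => //; apply: mulr_ge0.
    rewrite lef_pV2 ?posrE //; first by apply: mulr_gt0 => //; apply: exprn_gt0.
    by rewrite divr_gt0.
  apply: (le_trans (ler_normB _ _)); apply: (le_trans (lerD hg2 hLk)).
  rewrite -mulrDl -[leRHS]mulrA; apply: ler_wpM2r => //; rewrite /C; clear -c0 q1 q2 q3; lra.
- rewrite -mulrA expand /e3; ring.
Qed.

Lemma pair_sum_norm_le {R : realType} (P : pred nat) (x r : R) (u v : nat -> R) :
  (forall n, `|u n| <= (P n)%:R) -> (forall n, `|v n| <= (P n)%:R) ->
  `|pair_sum x r u v| <= pair_sum x r (fun n => (P n)%:R) (fun n => (P n)%:R).
Proof.
move=> hu hv; apply: (le_trans (ler_norm_sum _ _ _)); apply: ler_sum => p _.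
apply: (le_trans (ler_norm_sum _ _ _)); apply: ler_sum => q _.
by rewrite normrM normr_nat; apply: ler_wpM2l => //; rewrite normrM; apply: ler_pM.
Qed.

(** If [M * l] is at least [T], the error terms of [pair_sum_PP] are at most half
    the main term.  Otherwise [ln b / ln a <= exp T], the main term has order
    [(b / ln b) ^ 2], and [pair_sum_PP_ge] suffices. *)
Lemma pair_main_le {R : realType} K P (chi : nat -> R) delta D li (H : setting K P chi delta D li)
   (a b T : R) : 2 <= a -> 2 * (a * a) <= b * b -> 0 < b -> delta b <= (520 * K ^+ 4)^-1 ->
  T = 4 * (70 * 1000 * K ^+ 2) ->
  pair_main a b <= (2 + 16 * (T * expR T)) *
     pair_sum (b * b) (b * b / (a * a)) (fun n => (P n)%:R) (fun n => (P n)%:R).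
Proof.
move=> a2 hab b0 db TE; have [ab l1 Xl il M0] := range_facts a2 hab b0.
have K1 := st_K H; have b2 : 2 <= b by lra. have dd := st_d0 H b2.
have K40 : 0 < K ^+ 4 by clear -K1; rewrite exprn_gt0; lra.
have K20 : 0 < K ^+ 2 by clear -K1; rewrite exprn_gt0; lra.
have T0 : 0 < T.
  have [c cE] : exists c : R, c = 70 * 1000 by eexists.
  have c0 : 0 < c by clear -cE; rewrite cE; lra.
  by rewrite TE -cE; apply: mulr_gt0 => //; apply: mulr_gt0.
have db2 : delta b <= (16 * K ^+ 2)^-1.
  have k24 : K ^+ 2 <= K ^+ 4 by apply: ler_weXn2l.
  apply: (le_trans db); move: (K ^+ 2) (K ^+ 4) k24 K20 K40; clear => u v uv u0 v0.
  have p1 : 0 < 16 * u := mulr_gt0 (ltr0Sn _ _) u0.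
  have p2 : 0 < 520 * v := mulr_gt0 (ltr0Sn _ _) v0.
  by rewrite lef_pV2 // ?posrE; lra.
have low := pair_sum_PP_ge H a2 hab b0 db2.
have up := pair_sum_PP H a2 hab b0.
have n0 := pair_main_gt0 a2 hab b0.
have Mge := @loglog_ge R (2 * ln a) (2 * ln b).
rewrite -/(loglog a b) in Mge.
have nE : pair_main a b = b * b * (loglog a b / (2 * ln b)) by [].
move: (pair_sum _ _ _ _) low up => N low up.
have N0 : 0 <= N.
  apply: le_trans low; apply: divr_ge0; first by rewrite mulr_ge0 // ltW.
  by apply: mulr_ge0 => //; apply: sqr_ge0.
(* As [520 = 4 * 130], the error due to [delta] takes a quarter of the main term; [T] carries a
   factor 4 for the same purpose. *)
have h1 : 130 * K ^+ 4 * (delta b * pair_main a b) <= pair_main a b / 4.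
  have -> : 130 * K ^+ 4 * (delta b * pair_main a b) = 520 * K ^+ 4 * delta b * (pair_main a b / 4) by field.
  have q : 0 <= pair_main a b / 4 by apply: divr_ge0 => //; exact: ltW.
  apply: (ler_piMl q).
  have p : 0 < 520 * K ^+ 4 := mulr_gt0 (ltr0Sn _ _) K40.
  by rewrite mulrC -ler_pdivlMr // mul1r.
have e0 : 0 <= expR T by apply: expR_ge0.
have TE0 : 0 <= T * expR T by apply: mulr_ge0 => //; exact: ltW.
have l0 : 0 < 2 * ln a by clear -l1; lra. have X0 : 0 < 2 * ln b by clear -l1 Xl; lra.
have lX : 2 * ln a <= 2 * ln b by clear -Xl; lra.
move: (Mge l0 lX) => {}Mge; clear db db2 H dd il.
have [h2|h2] := leP T (loglog a b * (2 * ln a)).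
  have h3 : 70 * 1000 * K ^+ 2 * (b * b / (2 * ln b * (2 * ln a))) <= pair_main a b / 4.
    have -> : 70 * 1000 * K ^+ 2 = T / 4 by rewrite TE; clear; field.
    rewrite nE; clear TE T0 TE0 e0; move: (loglog a b) (2 * ln a) (2 * ln b) T l0 X0 h2 b0; clear.
    move=> M l X T l0 X0 h2 b0.
    have -> : T / 4 * (b * b / (X * l)) = (b * b) / (X * l) / 4 * T by ring.
    have -> : b * b * (M / X) / 4 = (b * b) / (X * l) / 4 * (M * l) by field; rewrite !gt_eqF.
    by apply: ler_wpM2l => //; rewrite !divr_ge0 // mulr_ge0 // ltW.
  have h4 : pair_main a b <= 2 * N.
    move: up h1 h3; move: (pair_main a b) (130 * _) (70 * 1000 * _ * _) => m q1 q2.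
    rewrite ler_norml => /andP[? ?] ? ?; lra.
  have h5 := mulr_ge0 TE0 N0; move: h4 h5; clear; move: (T * expR T) (pair_main a b) => t m *; lra.
have h3 : (2 * ln b) / (2 * ln a) <= expR T.
  rewrite -[_ / _]lnK ?posrE ?divr_gt0 // ler_expR ln_div ?posrE //.
  apply: (le_trans Mge); apply: le_trans (ltW h2).
  by rewrite ler_peMr // ltW.
have h4 : pair_main a b <= 16 * (T * expR T) * (b * b / (16 * (2 * ln b) ^+ 2)).
  rewrite nE; clear TE TE0; move: (loglog a b) (2 * ln a) (2 * ln b) T (expR T) l0 X0 h2 h3 e0 T0 M0 b0; clear.
  move=> M l X T E l0 X0 h2 h3 E0 T0 M0 b0.
  have -> : b * b * (M / X) = b * b / X ^+ 2 * (M * l * (X / l)) by field; rewrite !gt_eqF.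
  have -> : 16 * (T * E) * (b * b / (16 * X ^+ 2)) = b * b / X ^+ 2 * (T * E) by field; rewrite gt_eqF.
  apply: ler_wpM2l; first by rewrite divr_ge0 ?exprn_ge0 ?mulr_ge0 // ltW.
  by apply: ler_pM => //; rewrite ?divr_ge0 ?mulr_ge0 // ltW.
apply: (le_trans h4); apply: (@le_trans _ _ (16 * (T * expR T) * N)).
  by apply: ler_wpM2l low; apply: mulr_ge0 TE0.
by apply: ler_wpM2r => //; rewrite lerDr.
Qed.

(** Covers [delta b] bounded below: [L] splits at [b] into a part [O(M)] and a tail. *)
Lemma ratio_crude {R : realType} (K d0 C : R) P (chi : nat -> R) delta D li
   (H : setting K P chi delta D li) (a b tau eta q : R) :
  2 <= a -> 2 * (a * a) <= b * b -> 0 < b -> `|eta| = 1 ->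
  `|tau - tail_sum chi a (Num.truncn b)| <= 3 * K ^+ 2 * (D b / ln b) ->
  0 < d0 -> d0 <= delta b -> 6 * K ^+ 3 + (5 + 109 * K) / d0 <= C -> `|q| <= 1 ->
  exists e1 e2 e3, [/\ `|e1| <= C / ln (2 * ln b), `|e2| <= C * D a / (2 * ln b),
    `|e3| <= C * delta b &
    q = 4^-1 * (1 + eta / loglog a b * ((Lpart chi a + tau) * (1 + e1) + e2) + e3)].
Proof.
move=> a2 hab b0 heta ht2 d0p hd hC hq.
have [ab l1 Xl il M0] := range_facts a2 hab b0.
have hLA := Lmain_le H a2 hab b0; have K1 := st_K H.
have b2 : 2 <= b by exact: le_trans a2 ab.
have db := st_d0 H b2; have da := st_d0 H a2; have Da := st_dD H a2; have Dm := st_Dm H a2 ab.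
have D0 : 0 <= D a by exact: le_trans da Da.
have X1 : 1 < 2 * ln b by clear -l1 Xl; lra.
have lX0 : 0 < ln (2 * ln b) by apply: ln_gt0.
have lb : 0 < ln b by clear -X1; lra.
have K3 : 0 <= K ^+ 3 by apply: exprn_ge0; exact: le_trans ler01 K1.
have h5 : 0 <= 5 + 109 * K by clear -K1; lra.
have h5d : 0 <= (5 + 109 * K) / d0 by apply: divr_ge0 => //; exact: ltW.
have C1 : 6 * K ^+ 3 <= C by clear -h5d hC; lra.
have C2 : (5 + 109 * K) / d0 <= C by clear -K3 hC; lra.
have C0 : 0 <= C by exact: le_trans h5d C2.
pose LA := Lpart chi a + tail_sum chi a (Num.truncn b).
pose LB := tau - tail_sum chi a (Num.truncn b).
(* With this [e2] the bracket reduces to [LA = O (M)]. All that is left is bounded by a constant,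
   hence by a multiple of [delta b >= d0]. *)
exists 0, (- LB), (4 * q - 1 - eta * (LA / loglog a b)); split.
- by rewrite normr0; apply: divr_ge0 => //; exact: ltW.
- rewrite normrN; apply: (le_trans ht2).
  have -> : 3 * K ^+ 2 * (D b / ln b) = 6 * K ^+ 2 * D b / (2 * ln b) by field; rewrite gt_eqF.
  apply: ler_wpM2r; first by rewrite invr_ge0; clear -X1; lra.
  apply: (@le_trans _ _ (6 * K ^+ 2 * (K * D a))).
    by apply: (ler_wpM2l _ Dm); exact: (mulr_ge0 (ler0n _ _) (sqr_ge0 K)).
  have -> : 6 * K ^+ 2 * (K * D a) = 6 * K ^+ 3 * D a by ring.
  exact: ler_wpM2r.
- have r2 : `|LA / loglog a b| <= 109 * K.
    by rewrite normrM normfV (gtr0_norm M0) ler_pdivrMr.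
  apply: (@le_trans _ _ (5 + 109 * K)).
    apply: (le_trans (ler_normB _ _)); rewrite normrM heta mul1r.
    apply: lerD => //; apply: (le_trans (ler_normB _ _)).
    by rewrite normrM normr_nat normr1; clear -hq; lra.
  apply: (@le_trans _ _ ((5 + 109 * K) / d0 * delta b)); last exact: ler_wpM2r.
  by rewrite mulrAC ler_pdivlMr //; apply: ler_wpM2l.
- have -> : Lpart chi a + tau = LA + LB by rewrite /LA /LB; ring.
  by rewrite addr0 mulr1 addrK; field; rewrite gt_eqF.
Qed.

(** [C] depends on [K] alone, being chosen before all other data. The threshold [d0] on [delta b]
    separates the regime of [ratio_expand] from that of [ratio_crude], and [C] adds the constants of
    both. *)
Lemma setting_ratio {R : realType} (K : R) : 1 <= K ->
  exists2 C : R, 0 < C & forall P chi delta D li, setting K P chi delta D li ->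
  forall a b tau eta Z, 2 <= a -> 2 * (a * a) <= b * b -> 0 < b -> `|eta| = 1 ->
  `|tau| <= 3 * K ^+ 2 * (D a / ln a) ->
  `|tau - tail_sum chi a (Num.truncn b)| <= 3 * K ^+ 2 * (D b / ln b) ->
  let N := pair_sum (b * b) (b * b / (a * a)) (fun n => (P n)%:R) (fun n => (P n)%:R) in
  4 * Z = N + eta * (pair_sum (b * b) (b * b / (a * a)) chi (fun n => (P n)%:R)
                     + pair_sum (b * b) (b * b / (a * a)) (fun n => (P n)%:R) chi)
            + pair_sum (b * b) (b * b / (a * a)) chi chi ->
  0 <= Z -> Z <= N ->
  exists e1 e2 e3, [/\ `|e1| <= C / ln (2 * ln b), `|e2| <= C * D a / (2 * ln b),
    `|e3| <= C * delta b &
    Z / N = 4^-1 * (1 + eta / loglog a b * ((Lpart chi a + tau) * (1 + e1) + e2) + e3)].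
Proof.
move=> K1.
have K2 : 0 <= K ^+ 2 by apply: sqr_ge0.
have K3 : 0 <= K ^+ 3 by apply: exprn_ge0; lra.
have K4 : 0 <= K ^+ 4 by apply: exprn_ge0; lra.
have [T TE] : exists T, T = 4 * (70 * 1000 * K ^+ 2) by eexists.
have [k1 k1E] : exists k, k = 130 * K ^+ 4 by eexists.
have [k2 k2E] : exists k, k = 70 * 1000 * K ^+ 2 by eexists.
have [kg kgE] : exists k, k = 10 * 1000 * K ^+ 3 by eexists.
have [kh khE] : exists k, k = 166 * K ^+ 4 + 130 * K ^+ 4 by eexists.
have [kL kLE] : exists k, k = 14 * K ^+ 2 by eexists.
have [d0 d0E] : exists k, k = (520 * K ^+ 4)^-1 by eexists.
have d0pos : 0 < d0.
  by rewrite d0E invr_gt0; apply: (mulr_gt0 (ltr0Sn _ _)); apply: exprn_gt0; lra.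
have d01 : d0 <= 1.
  rewrite d0E invf_le1; last by apply: (mulr_gt0 (ltr0Sn _ _)); apply: exprn_gt0; lra.
  have := exprn_ege1 4 K1; clear; lra.
have k10 : 0 <= k1 by rewrite k1E; clear -K1 K2 K3 K4; lra.
have k20 : 0 <= k2 by rewrite k2E; clear -K2; lra.
have kg0 : 0 <= kg by rewrite kgE; clear -K1 K2 K3 K4; lra.
have kh0 : 0 <= kh by rewrite khE; clear -K1 K2 K3 K4; lra.
have kL0 : 0 <= kL by rewrite kLE; clear -K1 K2 K3 K4; lra.
have T0 : 0 <= T by rewrite TE; clear -K2; lra.
have [cN cNE] : exists c, c = 2 + 16 * (T * expR T) by eexists.
have cN0 : 0 <= cN by rewrite cNE; have := mulr_ge0 T0 (expR_ge0 T); clear; lra.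
pose C1 := 2 * (k2 * cN) + kg * (1 + 3 * (k2 * cN)) + 8 * (kL * (k2 * cN))
           + (kh * cN + (2 + kh * cN) * k1 + k1 * cN).
have C10 : 0 <= C1.
  have q : 0 <= k2 * cN by apply: mulr_ge0.
  have q2 : 0 <= kL * (k2 * cN) by apply: mulr_ge0.
  have q3 : 0 <= kg * (1 + 3 * (k2 * cN)) by apply: mulr_ge0 => //; clear -q; lra.
  have q4 : 0 <= kh * cN by apply: mulr_ge0.
  have q5 : 0 <= k1 * cN by apply: mulr_ge0.
  have q6 : 0 <= (2 + kh * cN) * k1 by apply: mulr_ge0 => //; clear -q4; lra.
  rewrite /C1; clear -q q2 q3 q4 q5 q6; lra.
pose C2 := 6 * K ^+ 3 + (5 + 109 * K) / d0.
have C2a : 0 <= (5 + 109 * K) / d0 by apply: divr_ge0; [clear -K1; lra | exact: ltW].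
have C20 : 0 < C2 by rewrite /C2; have := exprn_ege1 3 K1; clear -C2a; lra.
exists (C1 + C2); first by clear -C10 C20; lra.
move=> P chi delta D li H a b tau eta Z a2 hab b0 heta ht1 ht2 N hZ Z0 ZN.
have [ab l1 Xl il M0] := range_facts a2 hab b0.
have b2 : 2 <= b by exact: le_trans a2 ab.
have db := st_d0 H b2; have da := st_d0 H a2; have Da := st_dD H a2; have Dm := st_Dm H a2 ab.
have D0 : 0 <= D a by exact: le_trans da Da.
have X1 : 1 < 2 * ln b by clear -l1 Xl; lra.
have X0 : 0 < 2 * ln b by clear -X1; lra.
have lb0 : 0 < ln b by clear -X1; lra.
have la0 : 0 < ln a by clear -l1; lra.
have lX0 : 0 < ln (2 * ln b) by apply: ln_gt0.
have hP n : `|(P n)%:R| <= (P n)%:R :> R by rewrite normr_nat.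
have N_ge0 : 0 <= N by apply: le_trans Z0 ZN.
have [hd|hd] := leP (delta b) d0; last first.
  have r1 : `|Z / N| <= 1.
    rewrite normrM normfV !ger0_norm //.
    (* For such [delta b] nothing prevents [N] from vanishing; the quotient is then 0 by
       convention. *)
    have [->|N0] := eqVneq N 0; first by rewrite invr0 mulr0.
    by rewrite ler_pdivrMr ?mul1r // lt_neqAle eq_sym N0.
  apply: (ratio_crude H a2 hab b0 heta ht2 d0pos (ltW hd)) r1.
  by rewrite lerDr.
have hd' := hd; rewrite d0E in hd'.
have hN := pair_main_le H a2 hab b0 hd' TE; rewrite -cNE -/N in hN.
have N0pos := pair_main_gt0 a2 hab b0.
have Npos : 0 < N.
  rewrite ltNge; apply/negP => N0; have := ler_wpM2l cN0 N0; rewrite mulr0 => q.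
  by have := lt_le_trans N0pos (le_trans hN q); rewrite ltxx.
have hNN := pair_sum_PP H a2 hab b0; rewrite -/N -k1E -k2E in hNN.
pose Sli := \sum_(0 <= p < (Num.truncn b).+1) chi p * li (q_bound a b p).
have hS := chi_li_sum H a2 hab b0 ht2; rewrite -kgE -/Sli in hS.
have hcP := pair_sum_chi_P H a2 hab b0; rewrite -/Sli in hcP.
have hPc := pair_sum_chi H a2 hab b0 hP.
have hcc := pair_sum_chi H a2 hab b0 (st_chi H).
have hL := Lval_le H a2 ht1; rewrite -kLE in hL.
have n1 := pair_sum_norm_le (b * b) (b * b / (a * a)) (st_chi H) hP.
have n2 := pair_sum_norm_le (b * b) (b * b / (a * a)) hP (st_chi H).
rewrite -/N in n1 n2.
have dich := @loglog_dichotomy R (2 * ln a) (2 * ln b) l1 Xl.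
cbv zeta in dich; rewrite -/(loglog a b) in dich.
have nE : pair_main a b = b * b * (loglog a b / (2 * ln b)) by [].
move: hN hNN hcP hPc hcc n1 n2 hZ.
set S1a := pair_sum _ _ chi (fun n => _); set S1b := pair_sum _ _ _ chi; set S2 := pair_sum _ _ chi chi.
move=> hN hNN hcP hPc hcc n1 n2 hZ.
pose L := Lpart chi a + tau.
(* [g] is the error of the li sum on the scale of [L], and [h] gathers the errors of relative size
   [delta b]. *)
pose g := (2 * ln b) / (b * b) * (Sli - b * b / (2 * ln b) * L).
pose h := (S1a - Sli) + S1b.
have hg : `|g| <= kg * (D a / (2 * ln b)).
  have c0 : 0 <= (2 * ln b) / (b * b) by apply: divr_ge0; [exact: ltW | apply: mulr_ge0; exact: ltW].
  rewrite /g normrM (ger0_norm c0); apply: (le_trans (ler_wpM2l c0 hS)).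
  by rewrite le_eqVlt; apply/orP; left; apply/eqP; field; rewrite !gt_eqF.
have hh : `|h| <= kh * delta b * pair_main a b.
  apply: (le_trans (ler_normD _ _)).
  have -> : kh * delta b * pair_main a b = 166 * K ^+ 4 * (delta b * pair_main a b) + 130 * K ^+ 4 * (delta b * pair_main a b) by rewrite khE; ring.
  exact: lerD.
have hS1 : S1a + S1b = pair_main a b / loglog a b * (L + g) + h.
  by rewrite nE /g /h; field; rewrite !gt_eqF.
have nS1 : `|S1a + S1b| <= 2 * N by apply: (le_trans (ler_normD _ _)); clear -n1 n2; lra.
have hS2 : `|S2| <= k1 * delta b * pair_main a b by rewrite k1E -mulrA.
have l0 : 0 < 2 * ln a by clear -l1; lra.
have hNN' : `|N - pair_main a b| <= k1 * delta b * pair_main a b + k2 * (pair_main a b / (loglog a b * (2 * ln a))).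
  have -> : pair_main a b / (loglog a b * (2 * ln a)) = b * b / (2 * ln b * (2 * ln a)).
    by rewrite nE; field; rewrite !gt_eqF.
  by rewrite -mulrA.
have d1 : delta b <= 1 by exact: le_trans hd d01.
have [e1 [e2 [e3 [h1 h2 h3 h4]]]] := ratio_expand k10 k20 cN0 kg0 kh0 k10 kL0 Npos N0pos M0 l0 X1 db d1 D0 hN
   hNN' hS1 hg hh nS1 hS2 hL il heta dich.
rewrite -/C1 in h1 h2 h3.
exists e1, e2, e3; split.
- by apply: (le_trans h1); apply: ler_wpM2r; [rewrite invr_ge0 ltW | rewrite lerDl ltW].
- apply: (le_trans h2); apply: ler_wpM2r; first by rewrite invr_ge0 ltW.
  by apply: ler_wpM2r => //; rewrite lerDl ltW.
- by apply: (le_trans h3); apply: ler_wpM2r => //; rewrite lerDl ltW.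
rewrite -/L -h4.
have -> : Z = 4^-1 * (N + eta * (S1a + S1b) + S2) by rewrite -hZ; field.
by field; rewrite gt_eqF.
Qed.

(** * Integrals: li and Delta *)

Definition logint {R : realType} (y : R) : R :=
  \int[@lebesgue_measure R]_(u in `[2, y]) (ln u)^-1.

Lemma logint2 {R : realType} : logint 2 = 0 :> R.
Proof. by rewrite /logint set_itv1 Rintegral_set1. Qed.

Lemma invln_integrable {R : realType} (b : R) :
  (@lebesgue_measure R).-integrable `[2, b] (EFin \o (fun u => (ln u)^-1)).
Proof.
apply: continuous_compact_integrable; first exact: segment_compact.
apply: continuous_in_subspaceT => x; rewrite inE /= in_itv /= => /andP[x2 _].
have lx : 0 < ln x by rewrite ln_gt0; lra.
by apply: cvgV; [rewrite gt_eqF | apply: continuous_ln; lra].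
Qed.

Lemma Rintegral_itv_bounds {R : realType} (f : R -> R) (a u v m M : R) :
  a <= u -> u <= v -> (@lebesgue_measure R).-integrable `[a, v] (EFin \o f) ->
  (forall t, u < t -> t <= v -> m <= f t <= M) ->
  (v - u) * m <= \int[@lebesgue_measure R]_(t in `[a, v]) f t -
                 \int[@lebesgue_measure R]_(t in `[a, u]) f t <= (v - u) * M.
Proof.
move=> au uv fi hf.
rewrite (Rintegral_itvB (x := u)) //; try by rewrite bnd_simp.
have fi' : (@lebesgue_measure R).-integrable `]u, v] (EFin \o f).
  apply: integrableS fi => //.
  by apply: subset_itvr; rewrite bnd_simp.
have len : fine (@lebesgue_measure R `]u, v]) = v - u.
  rewrite lebesgue_measure_itv /= lte_fin; case: ltP => // vu.
  have -> : v = u by apply/eqP; rewrite eq_le uv vu.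
  by rewrite subrr.
have ci (c : R) : (@lebesgue_measure R).-integrable `]u, v] (EFin \o cst c).
  have cc : (@lebesgue_measure R).-integrable `[u, v] (EFin \o cst c).
    apply: continuous_compact_integrable; first exact: segment_compact.
    by apply: continuous_subspaceT => x; exact: cvg_cst.
  apply: integrableS cc => //.
  by apply: subset_itvr; rewrite bnd_simp.
have E (c : R) : (v - u) * c = \int[@lebesgue_measure R]_(t in `]u, v]) (cst c t).
  by rewrite Rintegral_cst // len mulrC.
rewrite !E; apply/andP; split.
  by apply: le_Rintegral => // t /=; rewrite in_itv /= => /andP[h1 h2]; have /andP[] := hf t h1 h2.
by apply: le_Rintegral => // t /=; rewrite in_itv /= => /andP[h1 h2]; have /andP[] := hf t h1 h2.
Qed.

Lemma logint_bounds {R : realType} (u v : R) : 2 <= u -> u <= v ->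
  (v - u) / ln v <= logint v - logint u /\ logint v - logint u <= (v - u) / ln u.
Proof.
move=> u2 uv; apply/andP; apply: Rintegral_itv_bounds => //; first exact: invln_integrable.
move=> t ut tv; have lu : 0 < ln u by rewrite ln_gt0; lra.
have h1 : ln u <= ln t by rewrite ler_ln ?posrE; lra.
have h2 : ln t <= ln v by rewrite ler_ln ?posrE; lra.
by rewrite !lef_pV2 ?posrE; lra.
Qed.

(** Finiteness of the integral does not give measurability, which comes from the integrability of
    [delta] on the segments [[2, 2 + n]] exhausting the half-line. *)
Lemma delta_over_integrable {R : realType} (delta : R -> R) :
  (forall u, 2 <= u -> 0 <= delta u) ->
  (forall b, 2 <= b -> (@lebesgue_measure R).-integrable `[2, b] (EFin \o delta)) ->
  (\int[@lebesgue_measure R]_(u in `[2%R, +oo[%classic) (delta u / u)%:E < +oo)%E ->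
  (@lebesgue_measure R).-integrable `[2, +oo[ (EFin \o (fun u => delta u / u)).
Proof.
move=> d0 dint dfin; apply/integrableP; split; last first.
  apply: le_lt_trans dfin; rewrite le_eqVlt; apply/orP; left; apply/eqP.
  apply: eq_integral => u; rewrite inE /= in_itv /= andbT => u2.
  by rewrite ger0_norm // divr_ge0 ?d0 //; lra.
have cov : `[2%R, +oo[%classic = \bigcup_n `[2%R, (2 + n%:R : R)]%classic.
  apply/seteqP; split => x /=; rewrite in_itv /= ?andbT.
    move=> x2; exists (Num.truncn x).+1 => //=; rewrite in_itv /= x2 /=.
    by have := truncnS_gt x; lra.
  by move=> [n _] /=; rewrite in_itv /= => /andP[].
apply/measurable_realfun.measurable_EFinP; apply: measurable_realfun.measurable_funM.
  rewrite cov; apply/measurable_fun_bigcup => // n.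
  apply/measurable_realfun.measurable_EFinP.
  have h : 2 <= 2 + n%:R :> R by rewrite lerDl.
  by have /integrableP[] := dint _ h.
apply: measurable_realfun.subspace_continuous_measurable_fun => //.
apply: continuous_in_subspaceT => x; rewrite inE /= in_itv /= andbT => x2.
by apply: cvgV; [rewrite gt_eqF //; lra | exact: cvg_id].
Qed.

Lemma Rintegral_nneg_subset {R : realType} (f : R -> R) (A B : interval R) :
  [set` A] `<=` [set` B] -> (forall x, [set` B] x -> 0 <= f x) ->
  (@lebesgue_measure R).-integrable [set` B] (EFin \o f) ->
  \int[@lebesgue_measure R]_(t in [set` A]) f t <= \int[@lebesgue_measure R]_(t in [set` B]) f t.
Proof.
move=> AB f0 fi.
have fiA : (@lebesgue_measure R).-integrable [set` A] (EFin \o f) by apply: integrableS fi.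
rewrite /Rintegral; apply: fine_le; [exact: integrable_fin_num|exact: integrable_fin_num|].
apply: ge0_subset_integral => //; first by have /integrableP[] := fi.
Qed.

(** As [delta] is almost decreasing, a term is compared, up to [K], with the integral over the unit
    interval on its left. For the first term this interval would start at [T <= t], so that term is
    charged to the summand [delta t] of [Delta] instead. *)
Lemma delta_sum_le {R : realType} (K : R) (delta : R -> R) (t : R) (N : nat) : 1 <= K -> 2 <= t ->
  (forall u, 2 <= u -> 0 <= delta u) ->
  (forall u v, 2 <= u -> u <= v -> delta v <= K * delta u) ->
  (@lebesgue_measure R).-integrable `[2, +oo[ (EFin \o (fun u => delta u / u)) ->
  \sum_((Num.truncn t).+1 <= n < N.+1) delta n%:R / n%:R <= K * Delta delta t.
Proof.
move=> K1 t2 d0 dK fi.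
have sub (a b : R) : 2 <= a -> `[a, b]%classic `<=` `[2%R, +oo[%classic.
  by move=> a2 x /=; rewrite !in_itv /= andbT => /andP[ax _]; lra.
have suby (a : R) : 2 <= a -> `[a, +oo[%classic `<=` `[2%R, +oo[%classic.
  by move=> a2 x /=; rewrite !in_itv /= !andbT => ax; lra.
pose I (c : R) := \int[@lebesgue_measure R]_(u in `[t, c]) (delta u / u).
have nn (a : set R) : a `<=` `[2%R, +oo[%classic -> forall x, a x -> 0 <= delta x / x.
  by move=> h x /h /=; rewrite in_itv /= andbT => x2; rewrite divr_ge0 ?d0 //; lra.
have I0 c : 0 <= I c by apply: Rintegral_ge0 => x ax; apply: (nn _ (sub _ _ t2)) ax.
have Ile c : I c <= \int[@lebesgue_measure R]_(u in `[t, +oo[) (delta u / u).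
  apply: Rintegral_nneg_subset => //.
  - by move=> x /=; rewrite !in_itv /= andbT => /andP[].
  - exact: nn (suby _ t2).
  - by apply: integrableS fi => //; exact: suby.
have tS : t < (Num.truncn t).+1%:R by apply: truncnS_gt.
set T := Num.truncn t in tS *.
have main (k : nat) : \sum_(T.+1 <= n < (T + k).+2) delta n%:R / n%:R <= K * delta t + K * I (T + k).+1%:R.
  elim: k => [|k IH].
    rewrite addn0 big_nat1; have h : K * I T.+1%:R >= 0 by apply: mulr_ge0 => //; lra.
    have dT : delta T.+1%:R <= K * delta t by apply: dK => //; exact: ltW.
    have T1 : 1 <= T.+1%:R :> R by rewrite ler1n.
    have dT0 : 0 <= delta T.+1%:R by apply: d0; lra.
    apply: (@le_trans _ _ (delta T.+1%:R)).
      by rewrite ler_pdivrMr ?ler_peMr //; lra.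
    by apply: (le_trans dT); rewrite lerDl.
  rewrite addnS big_nat_recr /=; last by lia.
  have e : (T + k).+2%:R = (T + k).+1%:R + 1 :> R by rewrite natr1.
  have tk : t <= (T + k).+1%:R.
    by apply: (le_trans (ltW tS)); rewrite ler_nat ltnS leq_addr.
  have uv : (T + k).+1%:R <= (T + k).+2%:R :> R by rewrite ler_nat.
  have := @Rintegral_itv_bounds R (fun u => delta u / u) t _ _ (K^-1 * (delta (T + k).+2%:R / (T + k).+2%:R)) (K * delta t) tk uv.
  have fi' : (@lebesgue_measure R).-integrable `[t, (T + k).+2%:R] (EFin \o (fun u => delta u / u)).
    by apply: integrableS fi => //; exact: sub.
  move=> /(_ fi') h.
  have {}h : (T + k).+2%:R - (T + k).+1%:R <= 1 :> R -> 
     ((T + k).+2%:R - (T + k).+1%:R) * (K^-1 * (delta (T + k).+2%:R / (T + k).+2%:R)) <= I (T + k).+2%:R - I (T + k).+1%:R.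
    move=> _; apply: (proj1 (andP (h _))) => s us sv.
    have s2 : 2 <= s by lra.
    have s0 : 0 < s by exact: lt_le_trans s2.
    have v0 : 0 < (T + k).+2%:R :> R by exact: lt_le_trans sv.
    have dv : delta (T + k).+2%:R <= K * delta s by apply: dK.
    have ds : delta s <= K * delta t by apply: dK => //; exact: le_trans tk (ltW us).
    have dd := d0 _ s2.
    apply/andP; split.
      rewrite ler_pdivrMl; last by exact: lt_le_trans K1.
      rewrite mulrA; apply: ler_pM => //; first by apply: d0; exact: le_trans s2 sv.
      by rewrite lef_pV2 ?posrE.
    by apply: le_trans ds; rewrite ler_pdivrMr // ler_peMr //; exact: le_trans (ler1n R 2) s2.
  have h1 : (T + k).+2%:R - (T + k).+1%:R = 1 :> R by rewrite e; lra.
  rewrite h1 mul1r in h; have {}h := h (lexx 1).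
  have K0 : 0 < K by lra.
  rewrite ler_pdivrMl // in h.
  apply: (le_trans (lerD IH h)); lra.
have Kd0 : 0 <= K * delta t by apply: mulr_ge0; [lra | exact: d0].
have [TN|NT] := leqP T.+1 N.
  have := main (N - T.+1)%N; rewrite -addSn subnKC // => h; apply: (le_trans h).
  rewrite /Delta mulrDr lerD2l; apply: ler_wpM2l => //; lra.
rewrite big_geq //; apply: mulr_ge0; first by lra.
rewrite /Delta; apply: addr_ge0; first exact: d0.
by apply: Rintegral_ge0; exact: nn (suby _ t2).
Qed.

Lemma delta_le_Delta {R : realType} (delta : R -> R) (t : R) : 2 <= t ->
  (forall u, 2 <= u -> 0 <= delta u) -> delta t <= Delta delta t.
Proof.
move=> t2 d0; rewrite /Delta lerDl; apply: Rintegral_ge0 => x /=.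
by rewrite in_itv /= andbT => tx; rewrite divr_ge0 ?d0 //; lra.
Qed.

Lemma Delta_le {R : realType} (K : R) (delta : R -> R) (t u : R) : 1 <= K -> 2 <= t -> t <= u ->
  (forall u, 2 <= u -> 0 <= delta u) ->
  (forall u v, 2 <= u -> u <= v -> delta v <= K * delta u) ->
  (@lebesgue_measure R).-integrable `[2, +oo[ (EFin \o (fun u => delta u / u)) ->
  Delta delta u <= K * Delta delta t.
Proof.
move=> K1 t2 tu d0 dK fi; rewrite /Delta mulrDr; apply: lerD; first exact: dK.
have nn x : `[t, +oo[%classic x -> 0 <= delta x / x.
  by rewrite /= in_itv /= andbT => tx; rewrite divr_ge0 ?d0 //; lra.
apply: (@le_trans _ _ (\int[@lebesgue_measure R]_(u in `[t, +oo[) (delta u / u))).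
  apply: Rintegral_nneg_subset => //.
    by move=> x /=; rewrite !in_itv /= !andbT; exact: le_trans.
  apply: integrableS fi => //.
  by move=> x /=; rewrite !in_itv /= !andbT; exact: le_trans.
by rewrite ler_peMl //; apply: Rintegral_ge0.
Qed.

(** * From the hypotheses on delta to the abstract setting *)

Definition good_prime (Q : nat) : pred nat := fun n => prime n && coprime n Q.

Definition prime_chi {R : realType} (chi : nat -> R) (n : nat) : R := (prime n)%:R * chi n.

(** A prime not coprime to [Q] divides [Q], so there are at most [Q] of them. *)
Lemma bad_primes_le {R : realType} (Q n : nat) (f : nat -> R) : (0 < Q)%N ->
  (forall k, prime k -> 0 <= f k <= 1) ->
  0 <= psum (fun k => (prime k)%:R * f k) n - psum (fun k => (good_prime Q k)%:R * f k) n <= Q%:R.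
Proof.
move=> Q0 hf; rewrite /psum -sumrB.
have e k : (prime k)%:R * f k - (good_prime Q k)%:R * f k = (prime k && ~~ coprime k Q)%:R * f k.
  by rewrite /good_prime; case: prime; case: coprime; rewrite /= ?mul1r ?mul0r ?subr0 ?subrr.
under eq_bigr do rewrite e.
apply/andP; split.
  apply: sum_nat_ge0 => k _; case pk : (prime k); last by rewrite mul0r.
  by have /andP[h _] := hf k pk; apply: mulr_ge0.
apply: (@le_trans _ _ (\sum_(0 <= k < n.+1) ((0 < k <= Q)%N)%:R)).
  apply: ler_sum_nat => k _; case pk : (prime k) => /=; last by rewrite mul0r.
  rewrite prime_coprime // negbK; case kQ : (k %| Q)%N; last by rewrite mul0r.
  rewrite prime_gt0 // (dvdn_leq Q0 kQ) mul1r /=; by have /andP[] := hf k pk.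
elim: n => [|n IH]; first by rewrite big_nat1.
suff h m : \sum_(0 <= k < m.+1) ((0 < k <= Q)%N)%:R <= (minn m Q)%:R :> R.
  by apply: (le_trans (h _)); rewrite ler_nat geq_minr.
elim: m => [|m IHm]; first by rewrite big_nat1.
rewrite big_nat_recr //=; apply: (le_trans (lerD IHm (lexx _))).
by rewrite -natrD ler_nat; case: (leqP m.+1 Q) => h /=; lia.
Qed.

Lemma prime_piE {R : realType} (x : R) : 0 <= x ->
  prime_pi x = psum (fun p => (prime p)%:R) (Num.truncn x).
Proof.
move=> x0; rewrite /psum big_mkord /prime_pi big_mkcond /=; apply: eq_bigr => p _.
have -> : p%:R <= x by rewrite -truncn_ge_nat // -ltnS.
by rewrite andbT; case: prime.
Qed.

Lemma cmod_real {R : realType} (y : R) : cmod (y%:C)%C = `|y|.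
Proof. by rewrite /cmod /= expr0n addr0 sqrtr_sqr. Qed.

Lemma prime_pi_chiE {R : realType} (chi : nat -> R) (x : R) : 0 <= x ->
  prime_pi_chi (fun n => (chi n)%:C%C) x = (psum (prime_chi chi) (Num.truncn x))%:C%C.
Proof.
move=> x0; rewrite /psum big_mkord /prime_pi_chi big_mkcond /= rmorph_sum; apply: eq_bigr => p _.
have -> : p%:R <= x by rewrite -truncn_ge_nat // -ltnS.
by rewrite /prime_chi andbT; case: prime; rewrite ?mul1r ?mul0r.
Qed.

Lemma dirichlet_complex {R : realType} (Q : nat) (chi : nat -> R) :
  dirichlet_char Q chi -> ~ principal_char Q chi ->
  dirichlet_char Q (fun n => (chi n)%:C%C) /\ ~ principal_char Q (fun n => (chi n)%:C%C).
Proof.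
move=> [h1 h2 h3] np; split.
  split => [m n|n|n]; first by rewrite h1 rmorphM.
    by rewrite h2.
  by rewrite -h3 -(inj_eq (@complexI R)) rmorph0.
move=> h; apply: np => n; apply: (@complexI R); rewrite h.
by rewrite rmorph_nat.
Qed.

(** In the new constant, 20 covers the 14 of Chebyshev's bound and the 6 of Mertens' theorem, [Q]
    the primes dividing [Q], and [K * Q] the same primes measured by [err], through
    [K^-1 <= err delta y]. *)
Lemma setting_of_hypotheses {R : realType} (Q : nat) (K : R) (chi : nat -> R) (delta : R -> R) :
  (0 < Q)%N -> 0 < K -> quadratic_char Q chi ->
  (forall u, 2 <= u -> 0 <= delta u) ->
  (forall b, 2 <= b -> (@lebesgue_measure R).-integrable `[2, b] (EFin \o delta)) ->
  (forall x, 2 <= x -> `|prime_pi x - logint x| <= K * (x / ln x) * delta x) ->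
  (forall chi' : nat -> R[i], dirichlet_char Q chi' -> ~ principal_char Q chi' ->
       forall x, 2 <= x -> cmod (prime_pi_chi chi' x) <= K * (x / ln x) * delta x) ->
  (forall x y, 2 <= x -> x <= y -> K^-1 <= x / ln x * delta x /\
       x / ln x * delta x <= K * (y / ln y * delta y)) ->
  (forall x y, 2 <= x -> x <= y -> delta y * ln y <= K * (delta x * ln x)) ->
  (\int[@lebesgue_measure R]_(u in `[2%R, +oo[%classic) (delta u / u)%:E < +oo)%E ->
  setting (20 + Q%:R + K * (1 + Q%:R)) (good_prime Q) (prime_chi chi) delta (Delta delta) logint.
Proof.
move=> Q0 K0 [hd np h2] d0 dint hpi hPi hmono hdec dfin.
have Q1 : 0 <= Q%:R :> R by [].
have KQ : 0 <= K * Q%:R by apply: mulr_ge0 => //; exact: ltW.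
have [K' K'E] : exists K', K' = 20 + Q%:R + K * (1 + Q%:R) by eexists.
rewrite -K'E.
have K1 : 1 <= K' by rewrite K'E; lra.
have KK : K <= K' by rewrite K'E; lra.
have [hm hper hnz] := hd.
have fi := delta_over_integrable d0 dint dfin.
have E0 y : 2 <= y -> 0 <= err delta y.
  by move=> y2; rewrite mulr_ge0 ?d0 //; clear -y2; rewrite divr_ge0 ?ln_ge0; lra.
have dK u v : 2 <= u -> u <= v -> delta v <= K' * delta u.
  move=> u2 uv; have lu : 0 < ln u by clear -u2; rewrite ln_gt0; lra.
  have lv : ln u <= ln v by clear -u2 uv; rewrite ler_ln ?posrE; lra.
  have lv0 : 0 < ln v by exact: lt_le_trans lv.
  rewrite -(ler_pM2r lv0); apply: (le_trans (hdec u v u2 uv)).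
  rewrite -mulrA; apply: ler_pM => //; [exact: ltW|by rewrite mulr_ge0 ?d0 // ltW|].
  by apply: ler_wpM2l; [exact: d0|].
split => //.
- by move=> n /andP[/prime_gt1].
- move=> n; rewrite /prime_chi /good_prime normrM normr_nat.
  case pn : (prime n); last by rewrite mul0r.
  rewrite mul1r /=; case cn : (coprime n Q).
    have := h2 n cn; move/eqP; rewrite sqrf_eq1 => /orP[] /eqP ->; by rewrite ?normrN normr1.
  have /eqP -> : chi n == 0; last by rewrite normr0.
  by apply/negPn/negP => /hnz; rewrite cn.
- move=> y y2; apply: (@le_trans _ _ (14 * (y / ln y))).
    apply: le_trans (pi_le y2); apply: psum_le => k _.
    by rewrite ler_nat /good_prime; case: prime; case: coprime.
  apply: ler_wpM2r; first by clear -y2; rewrite divr_ge0 ?ln_ge0; lra.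
  by rewrite K'E; lra.
- move=> n n0; have := @mertens R n n0.
  have := @bad_primes_le R Q n (fun k => ln k%:R / k%:R) Q0.
  set A := psum _ n; set B := psum _ n => h.
  have /andP[h3 h4] : 0 <= A - B <= Q%:R.
    apply: h => k /prime_gt0 k0; have k1 : 1 <= k%:R :> R by rewrite ler1n.
    rewrite divr_ge0 ?ln_ge0 //=; rewrite ler_pdivrMr ?mul1r; last lra.
    by apply: ltW; apply: ln_sublinear; lra.
  rewrite !ler_norml => /andP[h5 h6]; rewrite K'E; clear -h3 h4 h5 h6 Q1 KQ K0; apply/andP; split; lra.
- move=> y y2; have := hpi y y2; rewrite prime_piE; last lra.
  have := @bad_primes_le R Q (Num.truncn y) (fun=> 1) Q0.
  have e1 : psum (fun k => (prime k)%:R * 1) (Num.truncn y) = psum (fun k => (prime k)%:R) (Num.truncn y) :> R.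
    by apply: eq_bigr => k _; rewrite mulr1.
  have e2 : psum (fun k => (good_prime Q k)%:R * 1) (Num.truncn y) = psum (fun k => (good_prime Q k)%:R) (Num.truncn y) :> R.
    by apply: eq_bigr => k _; rewrite mulr1.
  rewrite e1 e2 => h; have /andP[h3 h4] := h (fun k _ => introT andP (conj ler01 (lexx 1))).
  have [h5 _] := hmono y y y2 (lexx y); rewrite -/(err delta y) in h5.
  have -> : K * (y / ln y) * delta y = K * err delta y by rewrite /err mulrA.
  have h6 : Q%:R <= Q%:R * K * err delta y.
    rewrite -mulrA ler_peMr // mulrC -ler_pdivrMr // mul1r //.
  have Ey := E0 y y2.
  have h7 : K * err delta y + Q%:R * K * err delta y <= K' * err delta y.
    by rewrite -mulrDl; apply: ler_wpM2r => //; rewrite K'E; clear -Q1; lra.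
  move: h3 h4 h6 h7; set A := psum _ _; set B := psum _ _; set C1 := logint y.
  clear; rewrite !ler_norml => h3 h4 h6 h7 /andP[h8 h9]; apply/andP; split; lra.
- move=> y y2; have [hc1 hc2] := dirichlet_complex hd np.
  have := hPi _ hc1 hc2 y y2; rewrite prime_pi_chiE ?cmod_real; last lra.
  move=> h; apply: (le_trans h); rewrite -mulrA -/(err delta y).
  by apply: ler_wpM2r => //; exact: E0.
- move=> y y2; have [h5 _] := hmono y y y2 (lexx y).
  by apply: le_trans h5; clear -K0 KK; rewrite lef_pV2 ?posrE //; lra.
- move=> u v u2 uv; have [_ h] := hmono u v u2 uv; apply: (le_trans h).
  by apply: ler_wpM2r => //; apply: E0; lra.
- move=> u v u2 uv; apply: (le_trans (hdec u v u2 uv)); apply: ler_wpM2r => //.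
  by rewrite mulr_ge0 ?d0 ?ln_ge0 //; lra.
- exact: logint2.
- exact: logint_bounds.
- by move=> t N t2; apply: delta_sum_le.
- by move=> t t2; apply: delta_le_Delta.
- by move=> t u t2 tu; apply: Delta_le.
Qed.

(** * The conditionally convergent tail and the counts *)

(** The possible prime [p = a]: the tail of [Lchi] contains it, whereas [Lpart]
    takes it instead; its weights [p / s] and [1 / p] agree. *)
Definition tail_atom {R : realType} (chi : nat -> R) (a : R) : R :=
  ((Num.truncn a)%:R == a)%:R * (prime_chi chi (Num.truncn a) / a).

Lemma tail_seqE {R : realType} (chi : nat -> R) (a : R) (N : nat) : 0 < a -> (Num.truncn a <= N)%N ->
  tail_seq chi a N.+1 = tail_atom chi a + tail_sum (prime_chi chi) a N.
Proof.
move=> a0 AN; rewrite /tail_seq big_mkcond /= -(big_mkord xpredT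
  (fun p => if prime p && (a <= p%:R) then chi p / p%:R else 0)).
have Aa : (Num.truncn a)%:R <= a by rewrite truncn_le ltW.
rewrite (@big_cat_nat _ _ _ (Num.truncn a).+1) //=; congr (_ + _).
  rewrite big_nat_recr //= [X in X + _]big_nat [X in X + _]big1 ?add0r => [|p /andP[_ pA]]; last first.
    have pa : p%:R < a by apply: lt_le_trans Aa; rewrite ltr_nat.
    by rewrite [a <= _]leNgt pa andbF.
  rewrite /tail_atom /prime_chi; have -> : (a <= (Num.truncn a)%:R) = ((Num.truncn a)%:R == a).
    by rewrite eq_le Aa.
  case: eqP => [e|_]; last by rewrite andbF mul0r.
  by rewrite andbT mul1r e; case: prime; rewrite ?mul1r // !mul0r.
apply: eq_big_nat => p /andP[Ap _].
have pa : a <= p%:R by rewrite ltW // -truncn_lt_nat // ltW.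
by rewrite pa andbT /prime_chi; case: prime; rewrite ?mul1r ?mul0r.
Qed.

Lemma Lchi_E {R : realType} (chi : nat -> R) (s : R) : 0 < s ->
  Lchi chi s = Lpart (prime_chi chi) (Num.sqrt s)
     + (limn (tail_seq chi (Num.sqrt s)) - tail_atom chi (Num.sqrt s)).
Proof.
move=> s0; have a0 : 0 < Num.sqrt s by rewrite sqrtr_gt0.
have Aa : (Num.truncn (Num.sqrt s))%:R <= Num.sqrt s by rewrite truncn_le ltW.
suff e : (Num.sqrt s * Num.sqrt s)^-1 * \sum_(0 <= p < (Num.truncn (Num.sqrt s)).+1) prime_chi chi p * p%:R =
    s^-1 * (\sum_(p < (Num.truncn (Num.sqrt s)).+1 | prime p && (p%:R < Num.sqrt s)) chi p * p%:R)
    + tail_atom chi (Num.sqrt s).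
  by rewrite /Lchi /Lpart e; ring.
have sE : Num.sqrt s * Num.sqrt s = s by rewrite -expr2 sqr_sqrtr // ltW.
rewrite sE [X in _ = _ * X + _]big_mkcond /= -(big_mkord xpredT
  (fun p => if prime p && (p%:R < Num.sqrt s) then chi p * p%:R else 0)) !big_nat_recr //=.
have -> : \sum_(0 <= i < Num.truncn (Num.sqrt s))
     (if prime i && (i%:R < Num.sqrt s) then chi i * i%:R else 0) =
   \sum_(0 <= i < Num.truncn (Num.sqrt s)) prime_chi chi i * i%:R.
  apply: eq_big_nat => p /andP[_ pA].
  have pa : p%:R < Num.sqrt s by apply: lt_le_trans Aa; rewrite ltr_nat.
  by rewrite pa andbT /prime_chi; case: prime; rewrite ?mul1r ?mul0r.
rewrite !mulrDr -addrA; congr (_ + _).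
rewrite /tail_atom; move: Aa; rewrite le_eqVlt => /orP[/eqP e|lt].
  by rewrite e eqxx ltxx andbF mulr0 add0r mul1r -{1}sE; field; rewrite gt_eqF.
rewrite lt (lt_eqF lt) mul0r addr0 andbT /prime_chi.
by case: prime; rewrite ?mul1r ?mul0r.
Qed.

Lemma tail_sum_split {R : realType} (chi : nat -> R) (a b : R) (N : nat) :
  (Num.truncn a <= Num.truncn b)%N -> (Num.truncn b <= N)%N ->
  tail_sum chi a N = tail_sum chi a (Num.truncn b) + tail_sum chi b N.
Proof. by move=> ab bN; rewrite /tail_sum -big_cat_nat. Qed.

Lemma tail_seq_cvg {R : realType} K P (chi : nat -> R) delta D li
  (H : setting K P (prime_chi chi) delta D li) (a : R) : 2 <= a -> cvgn (tail_seq chi a).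
Proof.
move=> a2; have K1 := st_K H; have a0 : 0 < a by lra.
pose v (p : nat) := if prime p && (a <= p%:R) then chi p / p%:R else 0.
have -> : tail_seq chi a = series v.
  by apply/funext => N; rewrite /tail_seq big_mkcond /series /= -(big_mkord xpredT v).
apply/cauchy_cvgP/cauchy_seriesP => e e0.
have D0 : 0 <= D 2 by apply: le_trans (st_d0 H (lexx 2)) (st_dD H (lexx 2)).
pose B := 3 * K ^+ 2 * (K * D 2).
have B0 : 0 <= B by rewrite /B !mulr_ge0 ?sqr_ge0 //; lra.
(* [B] bounds [3 * K ^ 2 * D m] for every [m >= 2], and past [expR (B / e + 1)] the quotient
   [B / ln m] is below [e]. The offsets leave room for replacing [m] by its predecessor. *)
pose n0 := (maxn (Num.truncn a).+2 (Num.truncn (expR (B / e + 1))).+3)%N.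
suff key m n : (n0 <= m)%N -> (m <= n)%N -> `|\sum_(m <= k < n) v k| < e.
  exists ([set m | (n0 <= m)%N], [set n | (n0 <= n)%N]); first by split; exists n0.
  move=> [m n] /= [h1 h2].
  have [h|h] := leqP m n; first exact: key.
  by rewrite big_geq ?normr0 // ltnW.
rewrite /n0 geq_max => /andP[m1 m2] mn.
case: m m1 m2 mn => // m m1 m2 mn.
have m2R : 2 <= m%:R :> R by rewrite ler_nat; lia.
have -> : \sum_(m.+1 <= k < n) v k = tail_sum (prime_chi chi) m%:R n.-1.
  rewrite /tail_sum natrK prednK; last by lia.
  apply: eq_big_nat => k /andP[mk _].
  have ak : a <= k%:R.
    apply: ltW; rewrite -truncn_lt_nat //; [|exact: ltW].
    by apply: leq_trans mk; lia.
  by rewrite /v ak andbT /prime_chi; case: prime; rewrite ?mul1r ?mul0r.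
apply: (le_lt_trans (tail_bound H n.-1 m2R)).
have lm : B / e + 1 <= ln m%:R.
  rewrite -ler_expR lnK ?posrE; last by lra.
  apply: ltW; rewrite -truncn_lt_nat ?expR_ge0 //; lia.
have Be : 0 <= B / e by rewrite divr_ge0 // ltW.
have lm0 : 0 < ln m%:R :> R by lra.
rewrite mulrA ltr_pdivrMr //.
apply: (@le_lt_trans _ _ B).
  apply: ler_wpM2l; first by exact: (mulr_ge0 (ler0n _ _) (sqr_ge0 K)).
  exact: (st_Dm H).
rewrite mulrC -ltr_pdivrMr //; lra.
Qed.

Lemma limn_dist_le {R : realType} (u : nat -> R) (c B : R) (n0 : nat) : cvgn u ->
  (forall n, (n0 <= n)%N -> `|u n - c| <= B) -> `|limn u - c| <= B.
Proof.
move=> cu h; rewrite ler_norml lerBrDr lerBlDr; apply/andP; split.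
  apply: limr_ge => //; near=> n.
  have nn : (n0 <= n)%N by near: n; exists n0.
  by have := h n nn; rewrite ler_norml => /andP[? ?]; lra.
apply: limr_le => //; near=> n.
have nn : (n0 <= n)%N by near: n; exists n0.
by have := h n nn; rewrite ler_norml => /andP[? ?]; lra.
Unshelve. all: by end_near.
Qed.

(** The atom cancels in every partial sum, which leaves the tail beyond [b]. For [b = a] the finite
    sum is empty, and the bound becomes one for the tail itself. *)
Lemma tail_limit_dist {R : realType} K P (chi : nat -> R) delta D li
  (H : setting K P (prime_chi chi) delta D li) (a b : R) : 2 <= a -> a <= b ->
  `|limn (tail_seq chi a) - tail_atom chi a - tail_sum (prime_chi chi) a (Num.truncn b)| <= 3 * K ^+ 2 * (D b / ln b).
Proof.
move=> a2 ab; have a0 : 0 < a by lra.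
have b2 : 2 <= b by lra.
have AB : (Num.truncn a <= Num.truncn b)%N by apply: le_truncn.
rewrite -addrA -opprD; apply: (@limn_dist_le R _ _ _ (Num.truncn b).+1).
  exact: (tail_seq_cvg H).
case=> // n bn; rewrite ltnS in bn.
rewrite tail_seqE ?(leq_trans AB) // (tail_sum_split _ AB bn).
have -> : forall x y z : R, x + (y + z) - (x + y) = z by move=> *; ring.
exact: (tail_bound H).
Qed.

(** * The counting functions as pair sums *)

Lemma count_coprimeE {R : realType} (Q : nat) (x r : R) :
  count_pq (fun p q => coprime (p * q) Q) x r =
  pair_sum x r (fun n => (good_prime Q n)%:R) (fun n => (good_prime Q n)%:R).
Proof.
apply: eq_bigr => p _; apply: eq_bigr => q _; rewrite -!natrM !mulnb coprimeMl /good_prime.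
congr (_%:R); congr nat_of_bool.
by case: prime; case: prime; case: (_ <= _); case: (_ < _)%N; case: (_ <= _); case: coprime; case: coprime.
Qed.

Lemma quadratic_values {R : realType} (Q : nat) (chi : nat -> R) : quadratic_char Q chi ->
  forall n, [\/ ~~ coprime n Q /\ chi n = 0, coprime n Q /\ chi n = 1 | coprime n Q /\ chi n = -1].
Proof.
move=> [[_ _ h] _ h2] n; case cn : (coprime n Q).
  by have := h2 n cn; move/eqP; rewrite sqrf_eq1 => /orP[] /eqP ->; [constructor 2|constructor 3].
by constructor 1; split => //; apply/eqP/negPn/negP => /h; rewrite cn.
Qed.

Lemma pair_sum_comb {R : realType} (x r : R) (eta : R) (u v u1 v1 u2 v2 u3 v3 : nat -> R) (w : nat -> nat -> R) :
  (forall p q, 4 * w p q = u p * v q + eta * (u1 p * v1 q + u2 p * v2 q) + u3 p * v3 q) ->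
  4 * (\sum_(p < (Num.truncn x).+1) \sum_(q < (Num.truncn x).+1)
    [&& (p * q)%N%:R <= x, (p < q)%N & q%:R <= r * p%:R]%:R * w p q) =
  pair_sum x r u v + eta * (pair_sum x r u1 v1 + pair_sum x r u2 v2) + pair_sum x r u3 v3.
Proof.
move=> h; rewrite /pair_sum -big_split mulr_sumr mulr_sumr -!big_split; apply: eq_bigr => p _ /=.
rewrite -big_split !mulr_sumr -!big_split; apply: eq_bigr => q _ /=.
by rewrite mulrCA h; ring.
Qed.

(** If [p] or [q] is not coprime to [Q], both sides vanish because [chi] does there; otherwise
    [eta ^ 2 = 1] frees the product of the two characters from [eta]. *)
Lemma count_chiE {R : realType} (Q : nat) (chi : nat -> R) (eta x r : R) :
  quadratic_char Q chi -> (eta = 1 \/ eta = -1) ->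
  4 * count_pq (fun p q => (chi p == eta) && (chi q == eta)) x r =
  pair_sum x r (fun n => (good_prime Q n)%:R) (fun n => (good_prime Q n)%:R)
  + eta * (pair_sum x r (prime_chi chi) (fun n => (good_prime Q n)%:R)
           + pair_sum x r (fun n => (good_prime Q n)%:R) (prime_chi chi))
  + pair_sum x r (prime_chi chi) (prime_chi chi).
Proof.
move=> hq he.
rewrite -(@pair_sum_comb R x r eta _ _ _ _ _ _ _ _
  (fun p q => ((prime p && (chi p == eta)) && (prime q && (chi q == eta)))%:R)).
  congr (4 * _); apply: eq_bigr => p _; apply: eq_bigr => q _; rewrite -natrM mulnb.
  congr (_%:R); congr nat_of_bool.
  by case: prime; case: prime; case: (_ <= _); case: (_ < _)%N; case: (_ <= _); case: (_ == _); case: (_ == _).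
move=> p q; rewrite /good_prime /prime_chi.
case: (prime p); case: (prime q) => /=; rewrite ?andbF ?mul0r ?mulr0 ?mul1r ?addr0 ?mulr0 ?addr0 //.
have n10 : (1 == - 1 :> R) = false by apply/negP => /eqP; lra.
have n01 : (0 == 1 :> R) = false by apply/negP => /eqP; lra.
have n02 : (0 == - 1 :> R) = false by apply/negP => /eqP; lra.
have n20 : (- 1 == 1 :> R) = false by apply/negP => /eqP; lra.
case: (quadratic_values hq p) => -[cp ->]; case: (quadratic_values hq q) => -[cq ->];
case: he => ->; rewrite ?(negbTE cp) ?(negbTE cq) ?cp ?cq ?eqxx ?n10 ?n01 ?n02 ?n20 /=; ring.
Qed.

Lemma count_le {R : realType} (P1 P2 : nat -> nat -> bool) (x r : R) :
  (forall p q, P1 p q -> P2 p q) -> 0 <= count_pq P1 x r <= count_pq P2 x r.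
Proof.
move=> h; apply/andP; split; first by apply: sumr_ge0 => p _; apply: sumr_ge0.
apply: ler_sum => p _; apply: ler_sum => q _; rewrite ler_nat.
have := h p q; case: (P1 p q); last by rewrite !andbF.
by move=> ->.
Qed.

Theorem theorem1p5 (R : realType) (Q : nat) (K : R) :
  (0 < Q)%N -> 0 < K ->
  exists C : R, 0 < C /\
  forall (chi : nat -> R) (eta : R) (delta : R -> R),
    quadratic_char Q chi ->
    (eta = 1 \/ eta = -1) ->
    (forall u, 2 <= u -> 0 <= delta u) ->
    (forall b, 2 <= b ->
       (@lebesgue_measure R).-integrable `[2, b] (EFin \o delta)) ->
    (forall x, 2 <= x ->
       `|prime_pi x - \int[@lebesgue_measure R]_(u in `[2, x]) (ln u)^-1|
         <= K * (x / ln x) * delta x) ->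
    (forall chi' : nat -> R[i], dirichlet_char Q chi' -> ~ principal_char Q chi' ->
       forall x, 2 <= x -> cmod (prime_pi_chi chi' x) <= K * (x / ln x) * delta x) ->
    (forall x y, 2 <= x -> x <= y ->
       K^-1 <= x / ln x * delta x /\
       x / ln x * delta x <= K * (y / ln y * delta y)) ->
    (forall x y, 2 <= x -> x <= y -> delta y * ln y <= K * (delta x * ln x)) ->
    (\int[@lebesgue_measure R]_(u in `[2%R, +oo[%classic) (delta u / u)%:E < +oo)%E ->
    forall x r : R, 2 <= r -> r <= x / 4 ->
      let s := x / r in
      cvgn (tail_seq chi (Num.sqrt s)) /\
      exists e1 e2 e3 : R,
        [/\ `|e1| <= C / ln (ln x),
            `|e2| <= C * Delta delta (Num.sqrt s) / ln x,
            `|e3| <= C * delta (Num.sqrt x) &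
            count_pq (fun p q => (chi p == eta) && (chi q == eta)) x r
              / count_pq (fun p q => coprime (p * q) Q) x r
            = 4^-1 * (1 + eta / (ln (ln (x * r)) - ln (ln (x / r)))
                           * (Lchi chi s * (1 + e1) + e2) + e3)].
Proof.
move=> Q0 K0.
have K'1 : 1 <= 20 + Q%:R + K * (1 + Q%:R).
  have Q1 : 0 <= Q%:R :> R by [].
  have : 0 <= K * (1 + Q%:R) by apply: mulr_ge0; [exact: ltW | lra].
  lra.
have [C C0 hC] := setting_ratio K'1.
exists C; split => // chi eta delta hq heta d0 dint hpi hPi hmono hdec dfin x r r2 rx s.
have H := setting_of_hypotheses Q0 K0 hq d0 dint hpi hPi hmono hdec dfin.
have r0 : 0 < r by lra.
have x8 : 8 <= x by lra.
have x0 : 0 < x by lra.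
have s4 : 4 <= s by rewrite /s ler_pdivlMr //; clear -rx; lra.
have s0 : 0 < s by exact: lt_le_trans s4.
have aE : Num.sqrt s * Num.sqrt s = s by rewrite -expr2 sqr_sqrtr // ltW.
have bE : Num.sqrt x * Num.sqrt x = x by rewrite -expr2 sqr_sqrtr // ltW.
have rE : Num.sqrt x * Num.sqrt x / (Num.sqrt s * Num.sqrt s) = r.
  by rewrite aE bE /s; field; rewrite !gt_eqF.
have a2 : 2 <= Num.sqrt s.
  have : Num.sqrt (2 ^+ 2) <= Num.sqrt s by clear -s4; rewrite ler_sqrt ?expr2; lra.
  by rewrite sqrtr_sqr ger0_norm.
have hab : 2 * (Num.sqrt s * Num.sqrt s) <= Num.sqrt x * Num.sqrt x.
  rewrite aE bE /s mulrA ler_pdivrMr // mulrC; apply: ler_wpM2l => //; exact: ltW.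
have b0 : 0 < Num.sqrt x by rewrite sqrtr_gt0.
have ab : Num.sqrt s <= Num.sqrt x.
  rewrite ler_sqrt; last exact: ltW.
  by rewrite /s ler_pdivrMr // ler_peMr ?(ltW x0) //; exact: le_trans (ler1n R 2) r2.
have lb : 2 * ln (Num.sqrt x) = ln x by rewrite ln_sqrt //; field.
have la : 2 * ln (Num.sqrt s) = ln s by rewrite ln_sqrt //; field.
split; first exact: (tail_seq_cvg H).
have t1 := tail_limit_dist H a2 (lexx _); have t2 := tail_limit_dist H a2 ab.
rewrite /tail_sum big_geq // subr0 in t1.
have heta1 : `|eta| = 1 by case: heta => ->; rewrite ?normrN normr1.
(* The bounds [0 <= Z <= N] required for [delta b] not small. *)
have cle : 0 <= count_pq (fun p q => (chi p == eta) && (chi q == eta)) x r <=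
   count_pq (fun p q => coprime (p * q) Q) x r.
  apply: count_le => p q /andP[/eqP hp /eqP hq'].
  have nz n : chi n = eta -> coprime n Q.
    case: (quadratic_values hq n) => -[] // _ -> e.
    by case: heta e => -> /eqP; rewrite eq_sym ?oppr_eq0 oner_eq0.
  by rewrite coprimeMl !nz.
rewrite count_coprimeE in cle *; move/andP: cle => [c0 c1].
have := hC _ _ _ _ _ H (Num.sqrt s) (Num.sqrt x) _ eta
  (count_pq (fun p q => (chi p == eta) && (chi q == eta)) x r) a2 hab b0 heta1 t1 t2.
cbv zeta; rewrite rE bE lb /loglog la lb => /(_ (count_chiE x r hq heta) c0 c1).
(* [x * r = x ^ 2 / s]. *)
have -> : 2 * ln x - ln s = ln (x * r).
  by rewrite /s ln_div ?posrE // lnM ?posrE //; ring.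
by rewrite -/s (Lchi_E chi s0).
Qed.
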